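(* Let $d\ge1$, $B>0$, and let $\mathcal{D}_n=\{(X_i,Y_i)\}_{i=1}^n$, $n\ge 2$, be i.i.d. copies of a random pair $(X,Y)$ whose distribution is supported on $\mathbb{B}^d\times\mathbb{R}$, with $|Y|\le B$ almost surely. Let $\mu$ be the marginal law of $X$ and $h(x)=\mathbb{E}[Y\mid X=x]$, and assume $h\in\mathcal{H}$ for the class $\mathcal{H}$ specified below. Let $\widehat f_n\in\arg\min_{f\in\mathcal{NN}(N_n,M_n)}\frac1n\sum_{i=1}^n(f(X_i)-Y_i)^2$ (assume the minimum is attained). (1) If $\mathcal{H}=\mathcal{H}^\alpha$ with $0<\alpha<(d+3)/2$ and we choose $M_n \asymp n^{\frac{d+3-2\alpha}{2d+4\alpha}}$ and $N_n \gtrsim n^{\frac{d}{d+2\alpha}}$, then there are constants $c_1,c_2>0$ such that \[ \|\mathcal{T}_B\widehat{f}_n-h\|_{L^2(\mu)}^2 \lesssim n^{-\frac{2\alpha}{d+2\alpha}} \log n \] holds with probability at least $1-c_1 \exp(-c_2 n^{\frac{d}{d+2\alpha}} \log n)$. (2) If $\mathcal{H}=\mathcal{F}_\sigma(1)$, and $M\ge1$ is a constant and we choose $M_n=M$ and $N_n\gtrsim n^{\frac{d}{2d+3}}$, then there are constants $c_1,c_2>0$ such that \[ \|\mathcal{T}_B\widehat{f}_n-h\|_{L^2(\mu)}^2 \lesssim n^{-\frac{d+3}{2d+3}} \log n \] holds with probability at least $1-c_1 \exp(-c_2 n^{\frac{d}{2d+3}} \log n)$.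
   Context: $\sigma(t)=\max\{t,0\}$; $\mathbb{B}^d$ is the closed unit Euclidean ball in $\mathbb{R}^d$ and $\mathbb{S}^d$ the unit sphere in $\mathbb{R}^{d+1}$. For $\theta=(a_1,w_1^\intercal,\dots,a_N,w_N^\intercal)^\intercal\in\mathbb{R}^{(d+2)N}$ ($a_i\in\mathbb{R}$, $w_i\in\mathbb{R}^{d+1}$), $f_\theta(x)=\sum_{i=1}^N a_i\sigma((x^\intercal,1)w_i)$ on $\mathbb{B}^d$ and $\kappa(\theta)=\sum_i|a_i|\|w_i\|_2$; $\mathcal{NN}(N,M)=\{f_\theta:\theta\in\mathbb{R}^{(d+2)N},\kappa(\theta)\le M\}$. For a finite signed Borel measure $\mu$ on $\mathbb{S}^d$, $f_\mu(x)=\int_{\mathbb{S}^d}\sigma((x^\intercal,1)v)d\mu(v)$; $\mathcal{F}_\sigma$ is the set of all such $f_\mu$ on $\mathbb{B}^d$, with norm $\gamma(f)=\inf\{|\mu|(\mathbb{S}^d): f=f_\mu\}$, and $\mathcal{F}_\sigma(M)=\{f\in\mathcal{F}_\sigma:\gamma(f)\le M\}$. For $\alpha=r+\beta$ with $r\in\mathbb{N}_0$, $\beta\in(0,1]$, the Hölder norm on $\mathbb{R}^d$ is $\|f\|_{C^{r,\beta}}=\max\{\max_{\|s\|_1\le r}\|\partial^sf\|_{L^\infty},\max_{\|s\|_1=r}\sup_{x\ne y}|\partial^sf(x)-\partial^sf(y)|/\|x-y\|_2^\beta\}$; $C^{r,\beta}(\mathbb{B}^d)$ consists of restrictions to $\mathbb{B}^d$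 with the quotient (infimum over extensions) norm, and $\mathcal{H}^\alpha$ is its closed unit ball. The truncation $\mathcal{T}_Bf(x)=f(x)$ if $|f(x)|\le B$ and $\mathrm{sgn}(f(x))B$ otherwise. $A\lesssim C$ means $A\le cC$ for a constant $c>0$ independent of $n$ (depending on $d,\alpha,B$, and the implied constants in the parameter choices); $A\asymp C$ means $A\lesssim C\lesssim A$. *)

(* Defs.v *)
From HB Require Import structures.
From mathcomp Require Import all_boot all_order all_algebra.
From mathcomp Require Import all_classical all_reals all_analysis.
Set Implicit Arguments. Unset Strict Implicit. Unset Printing Implicit Defensive.
Import Order.TTheory GRing.Theory Num.Theory.
Import numFieldNormedType.Exports.
Local Open Scope classical_set_scope.
Local Open Scope ring_scope.

Section Defs.
Variable R : realType.

Definition relu (t : R) : R := Num.max t 0.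

Definition dotv (n : nat) (u v : 'rV[R]_n) : R := \sum_(i < n) u 0 i * v 0 i.
Definition enorm (n : nat) (u : 'rV[R]_n) : R := Num.sqrt (dotv u u).

Definition unit_ball (d : nat) : set 'rV[R]_d := [set x | enorm x <= 1].
Definition unit_sphere (d : nat) : set 'rV[R]_d.+1 := [set v | enorm v = 1].

Definition ext (d : nat) (x : 'rV[R]_d) : 'rV[R]_d.+1 :=
  \row_i (match unlift ord_max i with Some j => x 0 j | None => 1 end).

Definition opens (n : nat) : set (set 'rV[R]_n) := [set A | open A].
Definition Rvec (n : nat) := g_sigma_algebraType (@opens n).

Definition nn_fun (d N : nat) (a : 'I_N -> R) (w : 'I_N -> 'rV[R]_d.+1)
  (x : 'rV[R]_d) : R := \sum_(i < N) a i * relu (dotv (ext x) (w i)).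
Definition kappa (d N : nat) (a : 'I_N -> R) (w : 'I_N -> 'rV[R]_d.+1) : R :=
  \sum_(i < N) `|a i| * enorm (w i).
Definition NN (d N : nat) (M : R) : set ('rV[R]_d -> R) :=
  [set f | exists (a : 'I_N -> R) (w : 'I_N -> 'rV[R]_d.+1),
             kappa a w <= M /\ f = nn_fun a w].

Definition truncB (B t : R) : R := if `|t| <= B then t else Num.sg t * B.

Definition pdiff (d : nat) (j : 'I_d) (F : 'rV[R]_d -> R) : 'rV[R]_d -> R :=
  fun x => 'D_(delta_mx 0 j) F x.
Definition dpart (d : nat) (s : seq 'I_d) (F : 'rV[R]_d -> R) : 'rV[R]_d -> R :=
  foldr (@pdiff d) F s.

Definition holder_norm_le (d r : nat) (beta : R) (F : 'rV[R]_d -> R) (c : R) :=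
  [/\ (forall s : seq 'I_d, (size s < r)%N -> forall x, differentiable (dpart s F) x),
      (forall s : seq 'I_d, (size s <= r)%N -> forall x, `|dpart s F x| <= c) &
      (forall s : seq 'I_d, size s = r -> forall x y, x != y ->
          `|dpart s F x - dpart s F y| <= c * (enorm (x - y)) `^ beta)].

(** H^alpha: closed unit ball of C^{r,beta}(B^d) with the quotient norm
    (infimum over extensions to R^d), alpha = r + beta, r in N, beta in (0,1] *)
Definition holder_ball (d : nat) (alpha : R) (f : 'rV[R]_d -> R) :=
  exists (r : nat) (beta : R), [/\ 0 < beta <= 1, alpha = r%:R + beta &
    forall e, 0 < e -> exists F : 'rV[R]_d -> R,
      (forall x, @unit_ball d x -> F x = f x) /\ holder_norm_le r beta F (1 + e)].

(** F_sigma(c): f = f_mu on B^d for a finite signed Borel measure mu on S^d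
    with gamma(f) = inf |mu|(S^d) <= c.  The signed measure is mu = mu1 - mu2
    with mu1, mu2 finite Borel measures on R^(d+1) concentrated on S^d;
    |mu|(S^d) is the sup over finite measurable partitions of S^d. *)
Definition Fsigma_ball (d : nat) (c : R) (f : 'rV[R]_d -> R) :=
  forall e, 0 < e -> exists mu1 mu2 : {finite_measure set (Rvec d.+1) -> \bar R},
    [/\ mu1 (~` @unit_sphere d) = 0%E, mu2 (~` @unit_sphere d) = 0%E,
        (forall x, @unit_ball d x ->
           f x = fine (\int[mu1]_(v in @unit_sphere d) (relu (dotv (ext x) v))%:E)
               - fine (\int[mu2]_(v in @unit_sphere d) (relu (dotv (ext x) v))%:E)) &
        (forall (m : nat) (A : 'I_m -> set (Rvec d.+1)),
           (forall k, measurable (A k)) -> trivIset setT A ->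
           \bigcup_k A k = @unit_sphere d ->
           \sum_(k < m) `|fine (mu1 (A k)) - fine (mu2 (A k))| <= c + e)].

(** Regression function: h(x) = E[Y | X = x] (a version of it), i.e. h is
    Borel and E[Y 1_{X in A}] = E[h(X) 1_{X in A}] for all Borel A. *)
Definition regression_fun (d : nat) (dO : measure_display) (O : measurableType dO)
  (P : probability O R) (X : O -> Rvec d) (Y : O -> R) (h : 'rV[R]_d -> R) :=
  measurable_fun setT (h : Rvec d -> R) /\
  forall A : set (Rvec d), measurable A ->
    (\int[P]_(w in X @^-1` A) (Y w)%:E = \int[P]_(w in X @^-1` A) (h (X w))%:E)%E.

Definition iid_copies (d : nat)
  (dO0 : measure_display) (O0 : measurableType dO0) (P0 : probability O0 R)
  (X : O0 -> Rvec d) (Y : O0 -> R)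
  (dO : measure_display) (O : measurableType dO) (P : probability O R)
  (n : nat) (Xs : 'I_n -> O -> Rvec d) (Ys : 'I_n -> O -> R) :=
  [/\ (forall i, measurable_fun setT (Xs i) /\ measurable_fun setT (Ys i)),
      (forall i (C : set (Rvec d * R)%type), measurable C ->
          P ((fun w => (Xs i w, Ys i w)) @^-1` C) =
          P0 ((fun w => (X w, Y w)) @^-1` C)) &
      (forall C : 'I_n -> set (Rvec d * R)%type, (forall i, measurable (C i)) ->
          P (\bigcap_(i in setT) ((fun w => (Xs i w, Ys i w)) @^-1` C i)) =
          (\prod_(i < n) fine (P ((fun w => (Xs i w, Ys i w)) @^-1` C i)))%:E)].

Definition emp_risk (d n : nat) (Xs : 'I_n -> 'rV[R]_d) (Ys : 'I_n -> R)
  (f : 'rV[R]_d -> R) : R :=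
  n%:R^-1 * \sum_(i < n) (f (Xs i) - Ys i) ^+ 2.

Definition erm_rate (d : nat) (B : R) (H : ('rV[R]_d -> R) -> Prop)
  (Mok : nat -> R -> Prop) (Nok : nat -> nat -> Prop) (rho tau C c1 c2 : R) :=
  forall (dO0 : measure_display) (O0 : measurableType dO0) (P0 : probability O0 R)
         (X : O0 -> Rvec d) (Y : O0 -> R) (h : 'rV[R]_d -> R),
    measurable_fun setT X -> measurable_fun setT Y ->
    P0 (X @^-1` (~` @unit_ball d)) = 0%E ->
    P0 [set w | B < `|Y w|] = 0%E ->
    regression_fun P0 X Y h -> H h ->
  forall (n : nat), (2 <= n)%N ->
  forall (Nn : nat) (Mn : R), Mok n Mn -> Nok n Nn ->
  forall (dO : measure_display) (O : measurableType dO) (P : probability O R)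
         (Xs : 'I_n -> O -> Rvec d) (Ys : 'I_n -> O -> R),
    iid_copies P0 X Y P Xs Ys ->
  forall fhat : O -> ('rV[R]_d -> R),
    (forall w, @NN d Nn Mn (fhat w) /\
       forall g, @NN d Nn Mn g ->
         emp_risk (fun i => Xs i w) (fun i => Ys i w) (fhat w)
         <= emp_risk (fun i => Xs i w) (fun i => Ys i w) g) ->
  exists E : set O, [/\ measurable E,
    (P E >= (1 - c1 * expR (- c2 * (n%:R `^ tau) * ln n%:R))%:E)%E &
    forall w, E w ->
      (\int[P0]_z ((truncB B (fhat w (X z)) - h (X z)) ^+ 2)%:E
        <= (C * n%:R `^ (- rho) * ln n%:R)%:E)%E].

End Defs.

Arguments opens {R} n.
Arguments Rvec {R} n.
Arguments unit_ball {R} d.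
Arguments unit_sphere {R} d.
Arguments NN {R} d N M.
Arguments holder_ball {R} d alpha.
Arguments Fsigma_ball {R} d c.
Arguments erm_rate {R} d B H Mok Nok rho tau C c1 c2.

(* Main.v *)
(* Sparsification: a finite network of mass [M] can be pruned neuron by neuron.  Among the light
   neurons pointing to one face of the cube, sorted by the sign patterns of their hyperplanes on a
   few sample points (Sauer-Shelah bounds the number of patterns), pigeonhole yields [d + 3] of them
   which agree on most of the data and are close to each other; moving their weights along a
   linear relation until one vanishes costs little in squared error and nothing in mass.  With about
   [m ^ d] neurons the total loss is [M ^ 2 ln m / m ^ (d + 3)], so the estimator and its competitor
   may be replaced by networks from a class with a small covering number, and a Chernoff bound over
   a net (after discretising the law of [(X, Y)] into small cells) gives the rate as soon as the
   regression function is within [n ^ - (alpha / (d + 2 alpha))] of networks of the prescribed mass.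

   For [F_sigma] this is a Riemann sum of the representing measure.  For a Hoelder function, cut it
   off, sample it on a fine grid of a discrete torus and smooth it by products of box averages at
   scale [2 ^ - J].  Finite differences control the dyadic blocks of the discrete Fourier transform,
   hence its [(1 + |k|) ^ (d + 3)]-weighted energy.  Grouping the frequencies by rounded directions
   writes the smoothed function as a sum of ridge functions, each of which is interpolated by
   a piecewise linear network whose mass is its total second variation; Cauchy-Schwarz over the
   directions bounds the total mass by the weighted energy. *)
Require Import Defs.
From HB Require Import structures.
From mathcomp Require Import all_boot all_order all_algebra.
From mathcomp Require Import all_classical all_reals all_analysis measurable_realfun.
From mathcomp Require Import complex ring lra zify.
Import Order.TTheory GRing.Theory Num.Theory.
Import numFieldNormedType.Exports.
Local Open Scope classical_set_scope.
Local Open Scope ring_scope.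
Set Implicit Arguments.
Unset Strict Implicit.
Unset Printing Implicit Defensive.

(** * Sparsification of networks *)

Section Pigeonhole.
Local Open Scope nat_scope.

(** The width [Nn] is bounded only from below, so counting parameters of the full class is useless;
    what is bounded is the mass, and pruning converts a mass bound into a width of order [m ^ d].
    Put [s = d + 2 alpha]. With [m] of order [n ^ (1 / s)] and [M ^ 2] of order
    [n ^ ((d + 3 - 2 alpha) / s)], the pruning loss [M ^ 2 / m ^ (d + 3)], the entropy per sample
    [m ^ d / n] and the squared approximation error are all [n ^ (- 2 alpha / s)] up to logarithms;
    this balance fixes every exponent. The estimator may depend on the outcome in any way,
    measurably or not. Therefore the good event is a finite union of cells, and no supremum over an
    infinite class is ever measured. The pruned estimator depends on the sample, so it has to stay
    close to the estimator on the data and under the law at once; a single pruning over the disjoint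
    union of sample points and cells does both. On the approximation side, [alpha < (d + 3) / 2] is
    what makes the weighted energies of the dyadic blocks grow geometrically, so that the mass is
    governed by the last scale [2 ^ J]. *)

Lemma pigeonhole_seq (T U : eqType) (key : T -> U) (s : seq T) (K g : nat) :
  size (undup (map key s)) <= K -> K * g < size s ->
  exists b, g < count (fun x => key x == b) s.
Proof.
move=> hK hs; apply: contrapT => /forallNP hn.
have hc b : count (fun x => key x == b) s <= g by rewrite leqNgt; apply/negP/hn.
move: hs; rewrite ltnNge => /negP; apply.
rewrite -(sum1_size s).
have -> : \sum_(x <- s) 1 =
    \sum_(x <- s) \sum_(b <- undup (map key s) | key x == b) 1.
  rewrite big_seq [RHS]big_seq; apply: eq_bigr => x xs.
  rewrite sum1_count.
  have -> : count [eta eq_op (key x)] (undup (map key s)) =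
            count_mem (key x) (undup (map key s)).
    by apply: eq_count => y /=; rewrite eq_sym.
  by rewrite count_uniq_mem ?undup_uniq// mem_undup map_f.
rewrite (exchange_big_dep xpredT) //=.
apply: (@leq_trans (\sum_(b <- undup (map key s)) g)).
  by apply: leq_sum => b _; rewrite sum1_count.
by rewrite big_const_seq count_predT iter_addn_0 mulnC leq_mul2r hK orbT.
Qed.

(** A set of positions is a mask [m], and [mask m s] is the trace of the word [s] on it; induction
    on the length of the words then acts on [m] by adding a bit. *)
Definition shatters (S : seq bitseq) (m : bitseq) :=
  forall c : bitseq, size c = count id m -> exists2 s, s \in S & mask m s = c.

(** This is [\sum_(i < d) 'C(q, i)], given by Pascal's rule so as to follow the induction of
    [sauer_shelah]. *)
Fixpoint sauer_bound (q d : nat) : nat :=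
  match q, d with
  | _, 0 => 0
  | 0, _.+1 => 1
  | q'.+1, d'.+1 => sauer_bound q' d + sauer_bound q' d'
  end.

(** Delete the first bit. Each tail is counted once, and once more when both of its extensions lie
    in [S]. A mask shattered by these doubled tails extends by [true] to a mask shattered by [S], so
    for them [d] drops by one. *)
Lemma sauer_shelah (q d : nat) (S : seq bitseq) : uniq S ->
  (forall s, s \in S -> size s = q) ->
  (forall m, size m = q -> count id m = d -> ~ shatters S m) ->
  size S <= sauer_bound q d.
Proof.
have nil_of_zero q' (S' : seq bitseq) :
    (forall m, size m = q' -> count id m = 0 -> ~ shatters S' m) -> S' = [::].
  case: S' => // s S' /(_ (nseq q' false)); rewrite size_nseq count_nseq.
  move=> /(_ erefl erefl) []; move=> c; rewrite count_nseq /= => /size0nil ->; exists s; rewrite ?mem_head //.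
  by elim: q' s => [|k IH] [|b s] //=; exact: mask0.
elim: q d S => [|q IH] [|d] S uS sS nS.
- by rewrite (nil_of_zero _ _ nS).
- have sub : {subset S <= [:: [::]]}.
    by move=> s /sS /size0nil ->; rewrite mem_head.
  by have := uniq_leq_size uS sub.
- by rewrite (nil_of_zero _ _ nS).
pose U := undup (map behead S).
pose a b := fun s : bitseq => (b :: s) \in S.
have memU s : s \in U -> size s = q.
  by rewrite mem_undup => /mapP[t /sS h ->]; rewrite size_behead h.
have countS : size S <= count (a false) U + count (a true) U.
  rewrite -!size_filter -(size_map (cons false) (seq.filter (a false) _)).
  rewrite -(size_map (cons true) (seq.filter (a true) _)) -size_cat.
  apply: uniq_leq_size => // s sinS.
  have := sS _ sinS; case: s sinS => // b s sinS _.
  have sU : s \in U by rewrite mem_undup; apply/mapP; exists (b :: s).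
  by rewrite mem_cat; case: b sinS => sinS; apply/orP; [right|left];
    apply/mapP; exists s => //; rewrite mem_filter /a sinS.
rewrite (leq_trans countS) // -count_predUI /= leq_add //.
- apply: (leq_trans (count_size _ _)); apply: IH => //; first exact: undup_uniq.
  move=> m sm cm shm; apply: (nS (false :: m)); rewrite /= ?sm ?cm //.
  move=> c sc; have [s sU e] := shm c sc.
  move: sU; rewrite mem_undup => /mapP[t tS es]; exists t => //.
  have := sS _ tS; case: t es tS => //= b t es _ _; rewrite -es; exact: e.
- rewrite -size_filter; apply: IH; first by rewrite filter_uniq // undup_uniq.
    by move=> s; rewrite mem_filter => /andP[_ /memU].
  move=> m sm cm shm; apply: (nS (true :: m)); rewrite /= ?sm ?cm //.
  move=> [|b c] //= [sc]; have [s sU e] := shm c sc.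
  exists (b :: s); last by rewrite /= e.
  by move: sU; rewrite mem_filter /= => /andP[/andP[h0 h1] _]; case: b.
Qed.

Lemma sauer_bound_le (q d : nat) : sauer_bound q d.+1 <= q.+1 ^ d.
Proof.
elim: q d => [|q IH] d; first by rewrite exp1n.
case: d => [|d] /=.
  by have := IH 0; rewrite expn0; case: q {IH} => //= *; lia.
have h1 := IH d.+1; have h2 := IH d.
apply: (leq_trans (leq_add h1 h2)).
rewrite [X in X + _ <= _]expnS [X in _ <= X]expnS.
have : q.+1 ^ d <= q.+2 ^ d by case: d {h1 h2} => // d'; rewrite leq_exp2r.
nia.
Qed.

End Pigeonhole.

(** * Half-spaces on a face of the cube, and the choice of sample points *)

Section Geometry.
Local Close Scope classical_set_scope.
Variable R : realType.

Lemma exists_row_kernel (F : fieldType) (p q : nat) (A : 'M[F]_(p, q)) :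
  (q < p)%N -> exists2 c : 'rV[F]_p, c != 0 & c *m A = 0.
Proof.
move=> hqp; have hk : kermx A != 0.
  rewrite -mxrank_eq0 mxrank_ker subn_eq0 -ltnNge.
  exact: leq_ltn_trans (rank_leq_col A) hqp.
have [i hi] : exists i, row i (kermx A) != 0.
  by apply/existsP; rewrite -negb_forall; apply: contra hk => /forallP h;
    apply/eqP/row_matrixP => i; rewrite row0; apply/eqP/h.
by exists (row i (kermx A)) => //; rewrite -row_mul mulmx_ker row0.
Qed.

(* The half-spaces {v | 0 <= <y, v>}, with v on the hyperplane v_j0 = s, have
   VC dimension at most d: a dependency of the projected normals makes a
   combination of d + 1 of the forms constant on that hyperplane. *)
Lemma face_not_shattered (d : nat) (j0 : 'I_d.+1) (s : R)
    (y : 'I_d.+1 -> 'rV[R]_d.+1) :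
  ~ (forall c : 'I_d.+1 -> bool, exists v : 'rV[R]_d.+1,
       v 0 j0 = s /\ forall i, (0 <= dotv (y i) v) = c i).
Proof.
move=> sh.
have [l l0 lA] := @exists_row_kernel R _ _
  (\matrix_(i < d.+1, j < d) y i 0 (lift j0 j)) (ltnSn d).
pose K := (\sum_i l 0 i * y i 0 j0) * s.
have lK (v : 'rV[R]_d.+1) : v 0 j0 = s -> \sum_i l 0 i * dotv (y i) v = K.
  move=> vs; rewrite /dotv.
  under eq_bigr do rewrite mulr_sumr.
  rewrite exchange_big /= (bigD1 j0) //= [X in _ + X]big1 ?addr0.
    by rewrite /K mulr_suml -vs; apply: eq_bigr => i _; rewrite mulrA.
  move=> j jj0; have [j' ->] : exists j', j = lift j0 j'.
    by case: (unliftP j0 j) jj0 => [j' -> _|->]; [exists j'|rewrite eqxx].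
  have := congr1 (fun M : 'rV_d => M 0 j') lA; rewrite !mxE => h.
  under eq_bigr do rewrite mulrA.
  rewrite -mulr_suml (_ : \sum_i _ = 0) ?mul0r // -[RHS]h.
  by apply: eq_bigr => i _; rewrite mxE.
(* The two patterns are chosen so that every term [l 0 i * dotv (y i) v] is nonnegative at [v1] and
   nonpositive at [v2]. Both sums equal [K], so [K] and all the terms vanish, and a nonzero [l 0 i]
   contradicts the strict sign at [v1] or at [v2]. *)
have [v1 [v1s h1]] := sh (fun i => 0 <= l 0 i).
have [v2 [v2s h2]] := sh (fun i => l 0 i <= 0).
have p1 i : 0 <= l 0 i * dotv (y i) v1.
  have := h1 i; case: (leP 0 (l 0 i)) => [a /idP b|a /negP/negP b].
    by rewrite mulr_ge0.
  by rewrite -ltNge in b; rewrite nmulr_rge0 // ltW.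
have p2 i : l 0 i * dotv (y i) v2 <= 0.
  have := h2 i; case: (leP (l 0 i) 0) => [a /idP b|a /negP/negP b].
    by rewrite mulr_le0_ge0.
  by rewrite -ltNge in b; rewrite pmulr_rle0 // ltW.
have K1 : 0 <= K by rewrite -(lK _ v1s) sumr_ge0.
have K2 : K <= 0 by rewrite -(lK _ v2s) sumr_le0.
have K0 : K = 0 by apply/eqP; rewrite eq_le K1 K2.
move/negP: l0; apply; apply/eqP/rowP => i; rewrite !mxE.
have e1 := lK _ v1s; have e2 := lK _ v2s.
rewrite K0 in e1 e2.
have z1 : l 0 i * dotv (y i) v1 = 0.
  by move/eqP: e1; rewrite psumr_eq0 // => /allP /(_ i (mem_index_enum i)) /eqP.
have z2 : l 0 i * dotv (y i) v2 = 0.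
  have : \sum_i (- (l 0 i * dotv (y i) v2)) == 0 by rewrite sumrN e2 oppr0.
  rewrite psumr_eq0 => [|j _]; last by rewrite oppr_ge0.
  by move=> /allP /(_ i (mem_index_enum i)); rewrite oppr_eq0 => /eqP.
case: (ltgtP (l 0 i) 0) => // hl.
  have := h1 i; rewrite [X in _ = X]leNgt hl /= => /negP/negP; rewrite -ltNge => hd.
  by move/eqP: z1; rewrite mulf_eq0 !lt_eqF.
have := h2 i; rewrite [X in _ = X]leNgt hl /= => /negP/negP; rewrite -ltNge => hd.
by move/eqP: z2; rewrite mulf_eq0 (lt_eqF hd) gt_eqF.
Qed.

Definition sign_pattern (d : nat) (ys : seq 'rV[R]_d.+1) (v : 'rV[R]_d.+1) : bitseq :=
  [seq 0 <= dotv y v | y <- ys].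

(** A shattered mask with [d.+1] positions would give [d.+1] forms taking all sign patterns on the
    hyperplane [v_j0 = s]. Staying on one face is what keeps the exponent at [d]. *)
Lemma face_pattern_count (d : nat) (I : eqType) (v : I -> 'rV[R]_d.+1)
    (j0 : 'I_d.+1) (s : R) (ys : seq 'rV[R]_d.+1) (r : seq I) :
  (forall i, i \in r -> v i 0 j0 = s) ->
  (size (undup [seq sign_pattern ys (v i) | i <- r]) <= (size ys).+1 ^ d)%N.
Proof.
move=> vr; apply: leq_trans (sauer_bound_le _ _).
apply: sauer_shelah; first exact: undup_uniq.
  by move=> b; rewrite mem_undup => /mapP[i _ ->]; rewrite size_map.
move=> m sm cm sh.
have sz : size (mask m ys) = d.+1 by rewrite size_mask.
apply: (@face_not_shattered d j0 s (fun i => nth 0 (mask m ys) i)) => c.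
have [b] := sh [seq c i | i <- enum 'I_d.+1] ltac:(by rewrite size_map size_enum_ord cm).
rewrite mem_undup => /mapP[i ir ->] e.
exists (v i); split; first exact: vr.
move=> k; have := congr1 (fun z => nth false z k) e.
rewrite /sign_pattern -map_mask (nth_map 0) ?sz // => ->.
by rewrite (nth_map ord0) ?size_enum_ord // nth_ord_enum.
Qed.

(** Averaging over [t] with weights [nu]: each remaining pair is separated on more than an [eps]
    fraction of the total weight, so some point separates at least an [eps] fraction of the
    remaining pairs. Adding it to [ts] multiplies their number by at most
    [1 - eps <= expR (- eps)]. *)
Lemma greedy_separation (I T : finType) (sgn : T -> I -> bool) (nu : T -> R)
    (S : {set I}) (eps : R) (k : nat) :
  (forall t, 0 <= nu t) ->
  let sepw (p : I * I) := \sum_(t | sgn t p.1 != sgn t p.2) nu t in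
  exists ts : seq T, (size ts <= k)%N /\
   #|[set p in finset.setX S S | (eps * (\sum_t nu t) < sepw p) &&
       all (fun t => sgn t p.1 == sgn t p.2) ts]|%:R
     <= expR (- eps) ^+ k * (#|S| * #|S|)%:R :> R.
Proof.
move=> nu0 sepw; elim: k => [|k [ts [sts hts]]].
  exists [::]; split => //; rewrite expr0 mul1r ler_nat -cardsX.
  by apply: subset_leq_card; apply/fintype.subsetP => p; rewrite inE => /andP[].
set bad := [set p in _ | _] in hts.
have [/eqP b0|bpos] := eqVneq #|bad| 0%N.
  exists ts; split; first exact: leqW.
  rewrite -/bad (eqP b0) mulr_ge0 ?exprn_ge0 ?expR_ge0 //.
pose cnt t := #|[set p in bad | sgn t p.1 != sgn t p.2]|.
have [t ht] : exists t, eps * #|bad|%:R <= (cnt t)%:R.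
  apply: contrapT => /forallNP hn.
  have h1 : \sum_t nu t * (cnt t)%:R <= eps * #|bad|%:R * \sum_t nu t.
    rewrite mulr_sumr; apply: ler_sum => t _; rewrite mulrC ler_wpM2r //.
    by apply/ltW; rewrite ltNge; apply/negP/hn.
  have h2 : \sum_t nu t * (cnt t)%:R = \sum_(p in bad) sepw p.
    transitivity (\sum_t \sum_(p in bad | sgn t p.1 != sgn t p.2) nu t).
      apply: eq_bigr => t _; rewrite sumr_const mulr_natr; congr (_ *+ _).
      by apply: fintype.eq_card => p; rewrite inE.
    rewrite (exchange_big_dep (mem bad)) /=; last by move=> t p _ /andP[].
    by apply: eq_bigr => p pb; apply: eq_bigl => t; rewrite pb.
  have : \sum_(p in bad) (eps * \sum_t nu t) < \sum_(p in bad) sepw p.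
    apply: ltr_sum; last by move=> p; rewrite inE => /andP[_ /andP[]].
    by apply/hasP; move: bpos; rewrite cards_eq0 => /finset.set0Pn[p pb]; exists p => //; rewrite mem_index_enum.
  rewrite sumr_const -h2 ltNge => /negP; apply.
  by rewrite (le_trans h1) // mulrAC mulr_natr.
exists (t :: ts); split => //.
set bad' := [set p in _ | _].
pose A := [set p : I * I | sgn t p.1 != sgn t p.2].
have hc : cnt t = #|bad :&: A| by apply: fintype.eq_card => p; rewrite inE finset.in_setI [p \in A]inE.
have hd : #|bad'| = #|bad :\: A|.
  apply: fintype.eq_card => p; rewrite finset.in_setD [p \in A]inE negbK inE /= [p \in bad]inE.
  by case: (p \in _) => /=; case: (eps * _ < _); rewrite /= ?andbF ?andbT.
have hb : (#|bad'| + cnt t = #|bad|)%N by rewrite hc hd addnC cardsID.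
have -> : #|bad'|%:R = #|bad|%:R - (cnt t)%:R :> R by rewrite -hb natrD addrK.
apply: (@le_trans _ _ ((1 - eps) * #|bad|%:R)); first by rewrite mulrBl mul1r lerB.
apply: (@le_trans _ _ (expR (- eps) * #|bad|%:R)).
  by rewrite ler_wpM2r // (le_trans _ (expR_ge1Dx _)).
by rewrite exprS -mulrA ler_wpM2l ?expR_ge0.
Qed.

End Geometry.

(** * Removing one neuron from a group of [d + 3] *)

Section Exchange.
Variable R : realType.
Local Close Scope classical_set_scope.

Lemma exists_dependency (F : fieldType) (I : finType) (G : {set I}) (q : nat)
    (f : I -> 'I_q -> F) : (q < #|G|)%N ->
  exists c : I -> F, [/\ (exists2 i, i \in G & c i != 0),
    (forall i, i \notin G -> c i = 0) & forall j, \sum_i c i * f i j = 0].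
Proof.
move=> hq.
have [r r0 rA] := @exists_row_kernel F _ _
  (\matrix_(k < #|G|, j < q) f (enum_val k) j) hq.
have [k0 rk0] : exists k, r 0 k != 0.
  apply/existsP; rewrite -negb_forall; apply: contra r0 => /forallP h.
  by apply/eqP/rowP => k; rewrite !mxE; apply/eqP/h.
pose c i := \sum_(k < #|G|) r 0 k * (enum_val k == i)%:R.
have cE k : c (enum_val k) = r 0 k.
  rewrite /c (bigD1 k) //= eqxx mulr1 big1 ?addr0 // => k' kk'.
  by rewrite (inj_eq enum_val_inj) (negPf kk') mulr0.
exists c; split.
- by exists (enum_val k0); rewrite ?cE // enum_valP.
- move=> i iG; rewrite /c big1 // => k _; case: eqP => [e|]; last by rewrite mulr0.
  by rewrite -e enum_valP in iG.
- move=> j; have := congr1 (fun M : 'rV_q => M 0 j) rA; rewrite !mxE => h; rewrite -[RHS]h.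
  transitivity (\sum_i \sum_(k < #|G|) r 0 k * (enum_val k == i)%:R * f i j).
    by apply: eq_bigr => i _; rewrite mulr_suml.
  rewrite exchange_big /=; apply: eq_bigr => k _.
  rewrite (bigD1 (enum_val k)) //= eqxx mulr1 big1 ?addr0 ?mxE // => i ne.
  by rewrite eq_sym (negPf ne) mulr0 mul0r.
Qed.

Lemma dotvDr n (u v w : 'rV[R]_n) : dotv u (v + w) = dotv u v + dotv u w.
Proof. by rewrite /dotv -big_split; apply: eq_bigr => i _; rewrite mxE mulrDr. Qed.

Lemma dotvZr n (u v : 'rV[R]_n) c : dotv u (c *: v) = c * dotv u v.
Proof. by rewrite /dotv mulr_sumr; apply: eq_bigr => i _; rewrite mxE mulrCA. Qed.

Lemma dotvC n (u v : 'rV[R]_n) : dotv u v = dotv v u.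
Proof. by apply: eq_bigr => i _; rewrite mulrC. Qed.

Lemma dotvBr n (u v w : 'rV[R]_n) : dotv u (v - w) = dotv u v - dotv u w.
Proof. by rewrite -scaleN1r dotvDr dotvZr mulN1r. Qed.

Lemma dotv_le_coord n (u v : 'rV[R]_n) (a b : R) :
  (forall j, `|u 0 j| <= a) -> (forall j, `|v 0 j| <= b) ->
  `|dotv u v| <= n%:R * (a * b).
Proof.
move=> ua vb; rewrite (le_trans (ler_norm_sum _ _ _)) //.
rewrite (le_trans (y := \sum_(i < n) (a * b))) //.
  by apply: ler_sum => i _; rewrite normrM ler_pM.
by rewrite sumr_const card_ord mulr_natl.
Qed.

Lemma relu_pos (t : R) : 0 <= t -> relu t = t.
Proof. by move=> h; rewrite /relu; apply/max_idPl. Qed.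

Lemma relu_neg (t : R) : t <= 0 -> relu t = 0.
Proof. by move=> h; rewrite /relu; apply/max_idPr. Qed.

Lemma relu_lip (s t : R) : `|relu s - relu t| <= `|s - t|.
Proof.
case: (leP 0 s) => hs; case: (leP 0 t) => ht.
- by rewrite !relu_pos.
- by rewrite (relu_pos hs) (relu_neg (ltW ht)) subr0 !ger0_norm //; lra.
- rewrite (relu_pos ht) (relu_neg (ltW hs)) sub0r normrN distrC !ger0_norm //; lra.
- by rewrite (relu_neg (ltW hs)) (relu_neg (ltW ht)) subrr normr0.
Qed.

Lemma reluZ (c t : R) : 0 <= c -> relu (c * t) = c * relu t.
Proof.
move=> c0; case: (leP 0 t) => ht; first by rewrite !relu_pos // mulr_ge0.
by have h := ltW ht; rewrite !relu_neg ?mulr0 ?mulr_ge0_le0.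
Qed.

Section Step.
Variables (d : nat) (I T : finType) (v : I -> 'rV[R]_d.+1) (e : T -> 'rV[R]_d.+1).
Variables (nu y : T -> R).

Definition net_val (a : I -> R) (t : T) : R := \sum_i a i * relu (dotv (e t) (v i)).
Definition sq_loss (a : I -> R) : R := \sum_t nu t * (net_val a t - y t) ^+ 2.
Definition net_mass (a : I -> R) : R := \sum_i `|a i| * enorm (v i).
Definition half_space (t : T) (i : I) : bool := 0 <= dotv (e t) (v i).

Hypothesis nu_ge0 : forall t, 0 <= nu t.
Hypothesis e_le1 : forall t j, `|e t 0 j| <= 1.
Hypothesis v_ge1 : forall i, 1 <= enorm (v i).

Lemma sq_loss_move (a c : I -> R) (tau : R) :
  sq_loss (fun i => a i + tau * c i) =
  sq_loss a + tau * (2 * \sum_t nu t * ((net_val a t - y t) * net_val c t))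
            + tau ^+ 2 * \sum_t nu t * net_val c t ^+ 2.
Proof.
have nv t : net_val (fun i => a i + tau * c i) t = net_val a t + tau * net_val c t.
  rewrite /net_val mulr_sumr -big_split; apply: eq_bigr => i _ /=.
  by rewrite mulrDl mulrA.
rewrite /sq_loss !mulr_sumr -!big_split; apply: eq_bigr => t _ /=.
by rewrite nv; ring.
Qed.

(** There are [d.+3] weights and [d.+2] linear constraints: [d.+1] keep the vector sum of the
    neurons, one keeps the mass. So a direction of motion exists, and its sign is chosen to make the
    first-order change of the loss nonpositive; only the quadratic term costs. At a point where all
    neurons of the group are active, or all inactive, that term vanishes by the constraints; at the
    other points the closeness [eta] makes it small. *)
Lemma exchange_group (a : I -> R) (G : {set I}) (sg l eta om : R) :
  #|G| = d.+3 -> sg * sg = 1 -> (forall i, i \in G -> 0 < sg * a i) ->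
  0 <= eta -> 0 <= om ->
  (forall i, i \in G -> `|a i| * enorm (v i) <= l) ->
  (forall i i' j, i \in G -> i' \in G -> `|v i 0 j - v i' 0 j| <= eta) ->
  (forall i i', i \in G -> i' \in G ->
     \sum_(t | half_space t i != half_space t i') nu t <= om) ->
  exists a' : I -> R, [/\ (forall i, a i = 0 -> a' i = 0),
    (exists2 i, a i != 0 & a' i = 0), net_mass a' = net_mass a &
    sq_loss a' <= sq_loss a +
      d.+3%:R * om * (d.+3%:R ^+ 2 * d.+1%:R * l * eta) ^+ 2].
Proof.
move=> cG sg2 aG eta0 om0 al vG sepG.
have sgn1 : `|sg| = 1.
  by apply/eqP; rewrite -sqrp_eq1 // -normrX expr2 sg2 normr1.
have normG i : i \in G -> `|a i| = sg * a i.
  by move=> iG; rewrite -[RHS]gtr0_norm ?aG // normrM sgn1 mul1r.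
pose f (i : I) (j : 'I_d.+2) :=
  if unlift ord_max j is Some j' then v i 0 j' else enorm (v i).
have [c0 [c0nz c0G c0f]] := @exists_dependency R I G d.+2 f ltac:(by rewrite cG).
wlog c0lin : c0 c0nz c0G c0f /
    \sum_t nu t * ((net_val a t - y t) * net_val c0 t) <= 0.
  move=> hw; case: (leP (\sum_t nu t * ((net_val a t - y t) * net_val c0 t)) 0) => h.
    exact: (hw c0).
  apply: (hw (fun i => - c0 i)).
  - by have [i iG ci] := c0nz; exists i; rewrite ?oppr_eq0.
  - by move=> i /c0G ->; rewrite oppr0.
  - by move=> j; under eq_bigr do rewrite mulNr; rewrite sumrN c0f oppr0.
  - have nv t : net_val (fun i => - c0 i) t = - net_val c0 t.
      by rewrite /net_val -sumrN; apply: eq_bigr => i _; rewrite mulNr.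
    by under eq_bigr do rewrite nv !mulrN; rewrite sumrN oppr_le0 ltW.
pose c i := sg * c0 i.
have c0E i : c0 i = sg * c i by rewrite /c mulrA sg2 mul1r.
have cv j : \sum_i c0 i * v i 0 j = 0.
  have := c0f (lift ord_max j); rewrite /f; under eq_bigr do rewrite liftK; exact.
have cn : \sum_i c i * enorm (v i) = 0.
  have := c0f ord_max; rewrite /f; under eq_bigr do rewrite unlift_none.
  by move=> h; under eq_bigr do rewrite /c -mulrA; rewrite -mulr_sumr h mulr0.
have cG0 i : i \notin G -> c i = 0 by move=> /c0G h; rewrite /c h mulr0.
have epos i : 0 < enorm (v i) by exact: lt_le_trans ltr01 (v_ge1 i).
(* The mass constraint with positive norms excludes a direction of one sign, so some weight
   shrinks. *)
have [i1 ci1] : exists i, c i < 0.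
  apply: contrapT => /forallNP hn.
  have hc i : 0 <= c i by rewrite leNgt; apply/negP/hn.
  have [i iG ci] := c0nz; move/negP: ci; apply.
  have : \sum_i c i * enorm (v i) == 0 by rewrite cn.
  rewrite psumr_eq0 => [|k _]; last by rewrite mulr_ge0 // ltW.
  move=> /allP /(_ i (mem_index_enum i)) /=.
  by rewrite mulf_eq0 (gt_eqF (epos i)) orbF c0E => /eqP ->; rewrite mulr0.
(* Ratio test: [r i0] is the first time at which a weight of the group reaches zero, while no other
   weight has changed sign. *)
pose r i := (sg * a i) / (- c i).
pose i0 := [arg min_(i < i1 | c i < 0) r i]%O.
have [ci0 rmin] : c i0 < 0 /\ forall i, c i < 0 -> r i0 <= r i.
  by rewrite /i0; case: arg_minP.
have inG i : c i < 0 -> i \in G.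
  by apply: contraTT => /cG0 ->; rewrite ltxx.
pose tau := r i0.
have tau0 : 0 <= tau by rewrite /tau /r divr_ge0 ?ltW ?aG ?inG // oppr_gt0.
pose a' i := a i + tau * c0 i.
have tc i : i \in G -> 0 <= sg * a i + tau * c i.
  move=> iG; case: (ltP (c i) 0) => ci; last by rewrite addr_ge0 ?(mulr_ge0 tau0) ?(ltW (aG _ iG)).
  have := rmin _ ci; rewrite -/tau /r ler_pdivlMr ?oppr_gt0 //.
  by rewrite mulrN; lra.
have a'G i : i \in G -> `|a' i| = `|a i| + tau * c i.
  move=> iG; rewrite (normG _ iG) -[RHS]ger0_norm ?tc //.
  have -> : sg * a i + tau * c i = sg * a' i by rewrite mulrDr; congr (_ + _); rewrite mulrCA.
  by rewrite normrM sgn1 mul1r.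
have a'n i : `|a' i| = `|a i| + tau * c i.
  case: (boolP (i \in G)) => [/a'G //|iG].
  by rewrite /a' c0E cG0 // !mulr0 !addr0.
exists a'; split.
- move=> i ai; rewrite /a' ai add0r c0G ?mulr0 //.
  by apply/negP => /aG; rewrite ai mulr0 ltxx.
- exists i0; first by apply/eqP => h; have := aG _ (inG _ ci0); rewrite h mulr0 ltxx.
  apply/eqP; rewrite -normr_eq0 a'n normG ?inG // /tau /r invrN mulrN mulNr.
  by rewrite divfK ?(lt_eqF ci0) // subrr.
- rewrite /net_mass; under eq_bigr do rewrite a'n mulrDl -mulrA.
  by rewrite big_split /= -mulr_sumr cn mulr0 addr0.
rewrite sq_loss_move -addrA lerD2l.
rewrite (le_trans (y := tau ^+ 2 * \sum_t nu t * net_val c0 t ^+ 2)) //.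
  by rewrite gerDr mulr_ge0_le0 // mulr_ge0_le0.
have l0 : 0 <= l by rewrite (le_trans _ (al _ (inG _ ci0))) // mulr_ge0 // ltW.
have aN i : i \in G -> `|a i| <= l.
  by move=> iG; rewrite (le_trans _ (al _ iG)) // ler_peMr.
(* A shrinking weight moves by at most its own size. A growing one is paid for by the shrinking
   ones, since the norm-weighted sum of [c] is zero; hence the factor [d.+3]. *)
have tcl i : i \in G -> `|tau * c0 i| <= d.+3%:R * l.
  move=> iG; have -> : `|tau * c0 i| = `|tau * c i| by rewrite c0E mulrCA normrM sgn1 mul1r.
  have h1 j : tau * c j < 0 -> - (tau * c j) <= `|a j|.
    by move=> _; rewrite -subr_ge0 opprK -a'n.
  have [h|h] := ltP (tau * c i) 0.
    rewrite ltr0_norm // (le_trans (h1 _ h)) // (le_trans (aN _ iG)) //.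
    by rewrite ler_peMl // ler1n.
  rewrite ger0_norm // (le_trans (y := tau * c i * enorm (v i))) ?ler_peMr //.
  have -> : tau * c i * enorm (v i) = \sum_(j | j != i) - (tau * c j * enorm (v j)).
    apply/eqP; rewrite sumrN -addr_eq0 -(bigD1 i (P := xpredT) (F := fun j => tau * c j * enorm (v j))) //=.
    by under eq_bigr do rewrite -mulrA; rewrite -mulr_sumr cn mulr0.
  rewrite (le_trans (y := \sum_(j in G) l)) //; last first.
    by rewrite sumr_const cG mulr_natl.
  rewrite [leRHS](bigID (fun j => j != i)) /= (le_trans (y := \sum_(j in G | j != i) l)) //; last first.
    by rewrite lerDl sumr_ge0.
  rewrite [leLHS](bigID (fun j => j \in G)) /= [X in _ + X]big1 ?addr0; last first.
    by move=> j /andP[_ /cG0 ->]; rewrite mulr0 mul0r oppr0.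
  rewrite (eq_bigl (fun j => (j \in G) && (j != i))); last by move=> j; rewrite andbC.
  apply: ler_sum => j /andP[jG _]; rewrite (le_trans _ (al _ jG)) //.
  by rewrite -mulNr ler_wpM2r ?(ltW (epos _)) // -subr_ge0 opprK -a'n.
pose sep t := [exists i in G, half_space t i != half_space t i0].
have i0G := inG _ ci0.
pose bnd := d.+3%:R ^+ 2 * d.+1%:R * l * eta.
have valb t : tau ^+ 2 * net_val c0 t ^+ 2 <= if sep t then bnd ^+ 2 else 0.
  rewrite -exprMn; case: ifPn => hs; last first.
    suff -> : net_val c0 t = 0 by rewrite mulr0 expr0n.
    have hsame i : i \in G -> half_space t i = half_space t i0.
      by move=> iG; apply/eqP; move: hs; rewrite negb_exists_in => /forall_inP /(_ i iG); rewrite negbK.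
    rewrite /net_val; case: (boolP (half_space t i0)) => hi0.
      transitivity (\sum_i c0 i * dotv (e t) (v i)).
        apply: eq_bigr => i _; case: (boolP (i \in G)) => iG; last by rewrite c0G ?mul0r.
        by rewrite relu_pos // -/(half_space t i) hsame.
      under eq_bigr do rewrite /dotv mulr_sumr.
      rewrite exchange_big big1 // => j _.
      by under eq_bigr do rewrite mulrCA; rewrite -mulr_sumr cv mulr0.
    apply: big1 => i _; case: (boolP (i \in G)) => iG; last by rewrite c0G ?mul0r.
    rewrite relu_neg ?mulr0 //; move: hi0; rewrite -(hsame _ iG) /half_space -ltNge.
    exact: ltW.
  (* At a separated point some neuron of the group is inactive. Its value is [0], and the values of
     all the others are within [d.+1%:R * eta] of it. *)
  have [i2 i2G hi2] : exists2 i, i \in G & ~~ half_space t i.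
    case: (boolP (half_space t i0)) => h0; last by exists i0.
    by move/existsP: hs => [i /andP[iG]]; rewrite h0 eqb_id => ?; exists i.
  have hr i : i \in G -> `|relu (dotv (e t) (v i))| <= d.+1%:R * eta.
    move=> iG; rewrite -[relu _]subr0 -(@relu_neg (dotv (e t) (v i2))); last first.
      by move: hi2; rewrite /half_space -ltNge => /ltW.
    rewrite (le_trans (relu_lip _ _)) // -dotvBr -[eta]mul1r.
    by apply: dotv_le_coord => // j; rewrite !mxE vG.
  rewrite -[X in X <= _]real_normK ?num_real // ler_pXn2r ?nnegrE ?normr_ge0 //; last first.
    by rewrite /bnd !mulr_ge0 // ?exprn_ge0.
  rewrite /net_val mulr_sumr (le_trans (ler_norm_sum _ _ _)) //.
  rewrite (bigID (fun i => i \in G)) /= [X in _ + X]big1 ?addr0; last first.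
    by move=> i /c0G ->; rewrite mul0r mulr0 normr0.
  rewrite (le_trans (y := \sum_(i in G) (d.+3%:R * l * (d.+1%:R * eta)))) //.
    by apply: ler_sum => i iG; rewrite (mulrA tau) normrM; apply: ler_pM; [exact: normr_ge0|exact: normr_ge0|exact: tcl|exact: hr].
  rewrite sumr_const cG -mulr_natl /bnd; rewrite le_eqVlt; apply/orP; left; apply/eqP; ring.
rewrite mulr_sumr (le_trans (y := \sum_t nu t * (if sep t then bnd ^+ 2 else 0))) //.
  by apply: ler_sum => t _; rewrite mulrCA ler_wpM2l.
have -> : \sum_t nu t * (if sep t then bnd ^+ 2 else 0) = (\sum_(t | sep t) nu t) * bnd ^+ 2.
  rewrite mulr_suml [RHS]big_mkcond /=; apply: eq_bigr => t _.
  by case: ifP => _ //; rewrite mulr0.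
rewrite ler_wpM2r ?sqr_ge0 //.
rewrite (le_trans (y := \sum_(i in G) \sum_(t | half_space t i != half_space t i0) nu t)) //; last first.
  rewrite (le_trans (y := \sum_(i in G) om)) //; first by apply: ler_sum => i iG; rewrite sepG.
  by rewrite sumr_const cG mulr_natl.
rewrite (exchange_big_dep xpredT) //= [leRHS](bigID sep) /= -[leLHS]addr0 lerD //.
  apply: ler_sum => t /existsP[i /andP[iG hi]].
  by rewrite (bigD1 i) /= ?iG // lerDl sumr_ge0.
by apply: sumr_ge0 => t _; apply: sumr_ge0.
Qed.

End Step.
End Exchange.

(** * Finding a close group *)

Section Sparsify.
Variable R : realType.
Local Close Scope classical_set_scope.

Lemma leq_exp2r_weak (k a b : nat) : (a <= b)%N -> (a ^ k <= b ^ k)%N.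
Proof. by case: k => // k h; rewrite leq_exp2r. Qed.

(** All members of a group share one sign pattern on two families of forms: the [m] greedy sample
    points, which forces small separating weight, and forms comparing each coordinate with a grid of
    mesh [1 / m], which forces closeness. Together with the [.+1] of the pattern count this is at
    most [m * (3 * d.+1 + 2)], and a pattern class with more than [d.+2] members exists. *)
Lemma close_group (d : nat) (I T : finType) (v : I -> 'rV[R]_d.+1)
    (e : T -> 'rV[R]_d.+1) (nu : T -> R) (S : {set I}) (j0 : 'I_d.+1) (s : R)
    (m N : nat) :
  (forall t, 0 <= nu t) -> s * s = 1 ->
  (forall i, i \in S -> v i 0 j0 = s) ->
  (forall i j, `|v i 0 j| <= 1) ->
  (0 < m)%N -> (1 < N)%N -> (#|S| <= N)%N ->
  (d.+2 * (m * (3 * d.+1 + 2)) ^ d < #|S|)%N ->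
  exists G : {set I}, [/\ G \subset S, #|G| = d.+3,
    (forall i i' j, i \in G -> i' \in G -> `|v i 0 j - v i' 0 j| <= m%:R^-1) &
    (forall i i', i \in G -> i' \in G ->
      \sum_(t | half_space v e t i != half_space v e t i') nu t
        <= 3 * ln N%:R / m%:R * \sum_t nu t)].
Proof.
move=> nu0 s2 vs v1 m0 N1 SN Sbig.
(* With this value [m] greedy steps leave at most [N ^- 3 * N ^+ 2 < 1] bad pairs, that is, none. *)
set eps := 3 * ln N%:R / m%:R.
have mR : 0 < m%:R :> R by rewrite ltr0n.
have [ts [sts hts]] := @greedy_separation R I T (half_space v e) nu S eps m nu0.
set bad := [set p in _ | _] in hts.
have bad0 : #|bad| = 0%N.
  apply/eqP; rewrite -leqn0 -ltnS -(ltr_nat R); apply: le_lt_trans hts _.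
  have NR : 1 < N%:R :> R by rewrite ltr1n.
  have -> : expR (- eps) ^+ m = N%:R ^- 3.
    rewrite -expRM_natl; have -> : m%:R * - eps = - (3%:R * ln N%:R) :> R.
      by rewrite /eps; field; rewrite gt_eqF.
    by rewrite expRN expRM_natl lnK // posrE (lt_trans ltr01).
  rewrite mulrC -ltr_pdivlMr ?invr_gt0 ?exprn_gt0 ?(lt_trans ltr01) // invrK mul1r.
  apply: (@le_lt_trans _ _ (N%:R * N%:R)).
    by rewrite natrM ler_pM // ler_nat.
  by rewrite -expr2 ltr_eXn2l.
(* On the face [v_j0 = s] the affine comparison of coordinate [p.1] with [p.2 / m - 1] is a linear
   form, because [v_j0 * s = 1] can stand for the constant. *)
pose gform (p : 'I_d.+1 * 'I_(2 * m).+1) : 'rV[R]_d.+1 :=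
  delta_mx 0 p.1 - ((p.2%:R / m%:R - 1) * s) *: delta_mx 0 j0.
have dot_delta (u : 'rV[R]_d.+1) j : dotv (delta_mx 0 j) u = u 0 j.
  rewrite /dotv (bigD1 j) //= mxE !eqxx mul1r big1 ?addr0 // => k kj.
  by rewrite mxE eqxx (negPf kj) mul0r.
have gformE p i : i \in S -> dotv (gform p) (v i) = v i 0 p.1 - (p.2%:R / m%:R - 1).
  move=> iS; rewrite dotvC dotvBr dotvZr ![dotv (v i) _]dotvC !dot_delta vs //.
  by rewrite -mulrA s2 mulr1.
pose ys := [seq e t | t <- ts] ++ [seq gform p | p <- enum {: 'I_d.+1 * 'I_(2 * m).+1}].
have sys : ((size ys).+1 <= m * (3 * d.+1 + 2))%N.
  rewrite size_cat !size_map -enumT -cardE card_prod !card_ord.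
  have : (d.+1 <= m * d.+1)%N by rewrite leq_pmull.
  by nia.
have [b hb] := @pigeonhole_seq I _ (fun i => sign_pattern ys (v i)) (enum S)
   ((m * (3 * d.+1 + 2)) ^ d) d.+2
   (leq_trans (@face_pattern_count R d I v j0 s ys (enum S)
      ltac:(by move=> i; rewrite mem_enum => /vs)) (leq_exp2r_weak d sys))
   ltac:(by rewrite mulnC -cardE).
set r := [seq i <- enum S | sign_pattern ys (v i) == b].
have sr : (d.+3 <= size r)%N by rewrite size_filter.
have ur : uniq r by rewrite filter_uniq // enum_uniq.
pose G := [set i in take d.+3 r].
have Gr i : i \in G -> i \in S /\ sign_pattern ys (v i) = b.
  rewrite inE => /mem_take; rewrite mem_filter mem_enum => /andP[/eqP ? ?]; split=> //.
exists G; split.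
- by apply/fintype.subsetP => i /Gr[].
- rewrite cardsE (card_uniqP _) ?take_uniq // size_takel //.
- have key (y : 'rV[R]_d.+1) i i' : y \in ys -> i \in G -> i' \in G ->
      (0 <= dotv y (v i)) = (0 <= dotv y (v i')).
    move=> yy /Gr[_ hi] /Gr[_ hi'].
    have := congr1 (fun z => nth false z (index y ys)) (etrans hi (esym hi')).
    by rewrite /sign_pattern !(nth_map 0) ?index_mem // nth_index.
  have half i i' j : i \in G -> i' \in G -> v i 0 j - v i' 0 j <= m%:R^-1.
    move=> iG i'G; rewrite leNgt; apply/negP => hlt.
    have vi1 := v1 i j; rewrite ler_norml in vi1; case/andP: vi1 => vi1 vi1'.
    pose x := (v i 0 j + 1) * m%:R.
    have x0 : 0 <= x by rewrite mulr_ge0 //; lra.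
    have /andP[kx xk] := truncn_itv x0.
    have k2m : (Num.truncn x < (2 * m).+1)%N.
      rewrite ltnS -(ler_nat R) (le_trans kx) // natrM ler_wpM2r //; lra.
    have gin : gform (j, Ordinal k2m) \in ys.
      by rewrite mem_cat; apply/orP; right; apply: map_f; rewrite mem_enum.
    have := key _ i i' gin iG i'G.
    rewrite !gformE /=; [|exact: (Gr _ i'G).1|exact: (Gr _ iG).1].
    have h1 : (Num.truncn x)%:R / m%:R <= v i 0 j + 1 by rewrite ler_pdivrMr.
    have h2 : v i 0 j + 1 < (Num.truncn x)%:R / m%:R + m%:R^-1.
      have -> : (Num.truncn x)%:R / m%:R + m%:R^-1 = (Num.truncn x).+1%:R / m%:R :> R.
        by rewrite -natr1 mulrDl mul1r.
      by rewrite ltr_pdivlMr.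
    have -> : 0 <= v i 0 j - ((Num.truncn x)%:R / m%:R - 1) = true by apply/idP; lra.
    by move=> /esym; lra.
  move=> i i' j iG i'G; rewrite ler_norml half // andbT.
  by rewrite lerNl opprB half.
- move=> i i' iG i'G; rewrite leNgt; apply/negP => hlt.
  have : (i, i') \in bad.
    rewrite inE /= finset.in_setX (Gr _ iG).1 (Gr _ i'G).1 /= hlt /=.
    apply/allP => t tts /=; rewrite /half_space.
    have ein : e t \in ys by rewrite mem_cat map_f.
    have := congr1 (fun z => nth false z (index (e t) ys)) (etrans (Gr _ iG).2 (esym (Gr _ i'G).2)).
    by rewrite /sign_pattern !(nth_map 0) ?index_mem // nth_index // => ->.
  by move/eqP: bad0; rewrite cards_eq0 => /eqP ->; rewrite finset.in_set0.
Qed.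

End Sparsify.

(** * Iterated pruning *)

Section SparsifyNN.
Variable R : realType.
Local Close Scope classical_set_scope.

Lemma enorm_ge0 n (u : 'rV[R]_n) : 0 <= enorm u.
Proof. exact: sqrtr_ge0. Qed.

Lemma dotv_ge0 n (u : 'rV[R]_n) : 0 <= dotv u u.
Proof. by apply: sumr_ge0 => i _; rewrite -expr2 sqr_ge0. Qed.

Lemma sqr_enorm n (u : 'rV[R]_n) : enorm u ^+ 2 = dotv u u.
Proof. by rewrite sqr_sqrtr // dotv_ge0. Qed.

Lemma coord_le_enorm n (u : 'rV[R]_n) j : `|u 0 j| <= enorm u.
Proof.
rewrite -(@ler_pXn2r _ 2) ?nnegrE ?enorm_ge0 // sqr_enorm real_normK ?num_real //.
by rewrite /dotv (bigD1 j) //= -expr2 lerDl sumr_ge0 // => i _; rewrite -expr2 sqr_ge0.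
Qed.

Lemma enormZ n (c : R) (u : 'rV[R]_n) : 0 <= c -> enorm (c *: u) = c * enorm u.
Proof.
move=> c0; rewrite /enorm dotvZr dotvC dotvZr mulrA -expr2 sqrtrM ?sqr_ge0 //.
by rewrite sqrtr_sqr ger0_norm.
Qed.

(** The scaling uses the sup norm and not [enorm]: the directions then lie on faces of the cube,
    each contained in an affine hyperplane as [face_not_shattered] requires. The zero vector gets
    the scale [0] and an arbitrary direction. *)
Lemma normalize_direction d (w : 'rV[R]_d.+1) :
  exists p : R * 'rV[R]_d.+1 * 'I_d.+1,
    [/\ 0 <= p.1.1, w = p.1.1 *: p.1.2, (forall k, `|p.1.2 0 k| <= 1) &
        p.1.2 0 p.2 * p.1.2 0 p.2 = 1].
Proof.
pose j := [arg max_(j > ord0) `|w 0 j|]%O.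
have jmax k : `|w 0 k| <= `|w 0 j| by rewrite /j; case: arg_maxP => // i _; apply.
have [w0|w0] := eqVneq (w 0 j) 0.
  exists (0, delta_mx 0 ord0, ord0); split => //=; rewrite ?mxE ?eqxx ?mul1r //.
    rewrite scale0r; apply/rowP => k; rewrite mxE; apply/eqP.
    by rewrite -normr_le0; have := jmax k; rewrite w0 normr0.
  by move=> k; rewrite mxE; case: (_ && _); rewrite ?normr1 ?normr0.
exists (`|w 0 j|, `|w 0 j|^-1 *: w, j); split => //=.
- by rewrite scalerA divff ?normr_eq0 // scale1r.
- by move=> k; rewrite mxE normrM normrV ?unitfE ?normr_eq0 // normr_id mulrC ler_pdivrMr ?mul1r ?normr_gt0.
- rewrite mxE mulrACA -expr2 -[w 0 j * _]expr2 exprVn -normrX ger0_norm ?sqr_ge0 //.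
  by rewrite mulVf // expf_neq0.
Qed.

Definition seq_net d (s : seq (R * 'rV[R]_d.+1)) (x : 'rV[R]_d) : R :=
  \sum_(p <- s) p.1 * relu (dotv (ext x) p.2).
Definition seq_mass d (s : seq (R * 'rV[R]_d.+1)) : R :=
  \sum_(p <- s) `|p.1| * enorm p.2.

Lemma seq_net_NN d (s : seq (R * 'rV[R]_d.+1)) (N : nat) (M : R) :
  (size s <= N)%N -> seq_mass s <= M -> NN d N M (seq_net s).
Proof.
move=> sN sM.
have big (F : R * 'rV[R]_d.+1 -> R) : F (0, 0) = 0 ->
    \sum_(p <- s) F p = \sum_(k < N) F (nth (0, 0) s k).
  move=> F0; rewrite (big_nth (0, 0)) -(big_mkord xpredT (fun k => F (nth (0, 0) s k))).
  rewrite [RHS](@big_cat_nat _ _ _ (size s)) //= [X in _ + X]big_nat_cond [X in _ + X]big1 ?addr0 //.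
  by move=> k /andP[/andP[h _] _]; rewrite nth_default.
exists (fun k => (nth (0, 0) s k).1), (fun k => (nth (0, 0) s k).2); split.
  rewrite (le_trans _ sM) // /seq_mass (big (fun p => `|p.1| * enorm p.2)) //.
  by rewrite /= normr0 mul0r.
apply/funext => x; rewrite /seq_net (big (fun p => p.1 * relu (dotv (ext x) p.2))) //.
by rewrite /= mul0r.
Qed.

Lemma ext_coord_le1 d (x : 'rV[R]_d) j : unit_ball d x -> `|ext x 0 j| <= 1.
Proof.
move=> xb; rewrite /ext mxE; case: unliftP => [k _|_]; last by rewrite normr1.
exact: le_trans (coord_le_enorm _ _) xb.
Qed.

(** The factor [8 * d.+1] is [2] for keeping only the light half of the neurons, times [4 * d.+1]
    for the sign of the weight and the signed face; the rest is the threshold of [close_group]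
    divided by [m ^ d]. *)
Definition sparse_const (d : nat) : nat := (8 * d.+1 * d.+2 * (3 * d.+1 + 2) ^ d)%N.

Section Iterate.
Variables (d : nat) (I T : finType) (v : I -> 'rV[R]_d.+1) (e : T -> 'rV[R]_d.+1).
Variables (nu y : T -> R) (jf : I -> 'I_d.+1).
Hypothesis nu_ge0 : forall t, 0 <= nu t.
Hypothesis e_le1 : forall t j, `|e t 0 j| <= 1.
Hypothesis v_le1 : forall i j, `|v i 0 j| <= 1.
Hypothesis v_face : forall i, v i 0 (jf i) * v i 0 (jf i) = 1.

Let v_ge1 i : 1 <= enorm (v i).
Proof.
apply: le_trans (coord_le_enorm _ (jf i)).
by rewrite -(@ler_pXn2r _ 2) ?nnegrE // expr1n real_normK ?num_real // expr2 v_face.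
Qed.

Definition supp (a : I -> R) := [set i | a i != 0].

(** The cost is that of [exchange_group] with [l = 2 M / N], [eta = 1 / m] and [om] equal to
    [3 ln N / m] times the total weight, where [N] is the present number of neurons. The decay
    [ln N / N ^+ 2] makes the sum over all steps converge. *)
Lemma sparsify_step (a : I -> R) (m : nat) (M : R) :
  (0 < m)%N -> net_mass v a <= M -> (sparse_const d * m ^ d < #|supp a|)%N ->
  exists a' : I -> R, [/\ (#|supp a'| < #|supp a|)%N, net_mass v a' = net_mass v a &
    sq_loss v e nu y a' <= sq_loss v e nu y a +
      12 * d.+3%:R ^+ 5 * d.+1%:R ^+ 2 * (\sum_t nu t) * M ^+ 2 / m%:R ^+ 3
        * (ln #|supp a|%:R / #|supp a|%:R ^+ 2)].
Proof.
move=> m0 aM; set N := #|supp a| => bigN.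
have N16 : (16 <= N)%N.
  have h1 : (0 < (3 * d.+1 + 2) ^ d)%N by rewrite expn_gt0 addn2.
  have h2 : (0 < m ^ d)%N by rewrite expn_gt0 m0.
  apply: leq_trans bigN; rewrite /sparse_const.
  move: h1 h2; set u := (_ ^ d)%N; set w := (_ ^ d)%N => h1 h2; nia.
have NR : 0 < N%:R :> R by rewrite ltr0n (leq_trans _ N16).
have mass_gt0 : 0 < net_mass v a.
  have [i ia] : exists i, i \in supp a by apply/finset.set0Pn; rewrite -card_gt0 (leq_trans _ N16).
  rewrite /net_mass (bigD1 i) //= ltr_pwDl //.
    by rewrite mulr_gt0 ?(lt_le_trans ltr01 (v_ge1 i)) // normr_gt0; rewrite inE in ia.
  by apply: sumr_ge0 => k _; rewrite mulr_ge0 ?enorm_ge0.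
have M0 : 0 < M := lt_le_trans mass_gt0 aM.
(* Twice the average mass: by Markov at most half of the neurons exceed it. *)
pose l := 2 * M / N%:R.
pose L := [set i in supp a | `|a i| * enorm (v i) <= l].
have cardL : (N <= 2 * #|L|)%N.
  pose H := supp a :\: L.
  have hH : (2 * #|H| <= N)%N.
    have : #|H|%:R * l <= M.
      rewrite (le_trans _ aM) // /net_mass mulr_natl -sumr_const.
      rewrite [leRHS](bigID (fun i => i \in H)) /= -[leLHS]addr0 lerD //; last first.
        by apply: sumr_ge0 => k _; rewrite mulr_ge0 ?enorm_ge0.
      apply: ler_sum => i; rewrite finset.in_setD => /andP[hL hs].
      by move: hL; rewrite inE hs /= -ltNge => /ltW.
    rewrite /l mulrA ler_pdivrMr // mulrCA mulrA -ler_pdivlMr // mulrAC divff ?gt_eqF // mul1r.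
    by rewrite -natrM ler_nat mulnC.
  have hL : L \subset supp a by apply/fintype.subsetP => i; rewrite inE => /andP[].
  have := cardsID L (supp a); rewrite (finset.setIidPr hL) -/H -/N.
  by lia.
pose key i := ((0 < a i), jf i, (0 < v i 0 (jf i))).
have [[[b1 j0] b2] hb] := @pigeonhole_seq I _ key (enum L) (4 * d.+1) (d.+2 * (m * (3 * d.+1 + 2)) ^ d)
   ltac:(rewrite -(card_uniqP (undup_uniq _)) (leq_trans (max_card _)) // !card_prod card_bool card_ord; lia)
   ltac:(rewrite -cardE; move: bigN cardL; rewrite /sparse_const expnMn; nia).
pose S := [set i in L | key i == (b1, j0, b2)].
have cardS : (d.+2 * (m * (3 * d.+1 + 2)) ^ d < #|S|)%N.
  have u : uniq [seq i <- enum L | key i == (b1, j0, b2)] by rewrite filter_uniq // enum_uniq.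
  apply: leq_trans hb _; rewrite -size_filter -(card_uniqP u).
  by apply: subset_leq_card; apply/fintype.subsetP => i; rewrite mem_filter mem_enum => /andP[h1 h2]; rewrite inE h2 /=.
pose s : R := if b2 then 1 else -1.
have vS i : i \in S -> v i 0 j0 = s.
  rewrite inE => /andP[_ /eqP[_ hj hv]]; rewrite -hj.
  have := v_face i; rewrite -expr2 => /eqP; rewrite sqrf_eq1 => /orP[|] /eqP h;
    move: hv; rewrite h /s => <-; first by rewrite ltr01.
  by rewrite ltrNr oppr0 ltNge ler01.
have s2 : s * s = 1 by rewrite /s; case: (b2); rewrite ?mulrNN mulr1.
have SN : (#|S| <= N)%N.
  by apply: subset_leq_card; apply/fintype.subsetP => i; rewrite inE => /andP[+ _]; rewrite inE => /andP[].
have [G [GS cG cl sp]] := @close_group R d I T v e nu S j0 s m N nu_ge0 s2 vS v_le1 m0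
  (leq_trans (isT : 1 < 16)%N N16) SN cardS.
pose sg : R := if b1 then 1 else -1.
have GL i : i \in G -> [/\ a i != 0, `|a i| * enorm (v i) <= l & (0 < a i) = b1].
  move=> /(fintype.subsetP GS); rewrite inE => /andP[+ /eqP[hb1 _ _]].
  by rewrite inE => /andP[]; rewrite inE.
have lnN : 0 <= ln N%:R :> R by rewrite ln_ge0 // ler1n (leq_trans _ N16).
have sg2 : sg * sg = 1 by rewrite /sg; case: (b1); rewrite ?mulrNN mulr1.
have aG i : i \in G -> 0 < sg * a i.
  move=> /GL[ai _]; rewrite /sg; case: (b1) => h; first by rewrite mul1r.
  by rewrite mulN1r oppr_gt0 lt_neqAle ai leNgt h.
have aGl i : i \in G -> `|a i| * enorm (v i) <= l by case/GL.
have im0 : 0 <= m%:R^-1 :> R by rewrite invr_ge0.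
have om0 : 0 <= 3 * ln N%:R / m%:R * \sum_t nu t.
  by rewrite !mulr_ge0 ?sumr_ge0.
have [a' [a'0 [i ai a'i] a'm a'l]] := @exchange_group R d I T v e nu y nu_ge0 e_le1 v_ge1 a G sg l
  m%:R^-1 (3 * ln N%:R / m%:R * \sum_t nu t) cG sg2 aG im0 om0 aGl cl sp.
exists a'; split => //.
- apply: proper_card; apply/properP; split.
    by apply/fintype.subsetP => k; rewrite !inE; apply: contra => /eqP /a'0 ->.
  by exists i; rewrite !inE ?a'i ?eqxx.
- apply: le_trans a'l _; rewrite lerD2l le_eqVlt; apply/orP; left; apply/eqP.
  rewrite /l; field; rewrite !gt_eqF //= ltr0n //.
Qed.

Lemma ln2_ge_half : 1 / 2 <= ln 2 :> R.
Proof.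
have h : 0 < (1 + - (1 / 2) : R) by lra.
have := @le_ln1Dx R (- (1/2)) ltac:(lra).
have -> : 1 + - (1 / 2) = 2^-1 :> R by lra.
by rewrite lnV ?posrE //; lra.
Qed.

(** The decrement of [4 * (ln n / n)] is about [4 * (ln n - 1) / n ^+ 2], which exceeds
    [ln n / n ^+ 2] with room to spare once [ln n >= 2]; this is where [16] comes from. *)
Lemma ln_div_sq_telescope (n : nat) : (16 <= n)%N ->
  ln n.+1%:R / n.+1%:R ^+ 2 <= 4 * (ln n%:R / n%:R) - 4 * (ln n.+1%:R / n.+1%:R) :> R.
Proof.
move=> n16.
have n0 : 0 < n%:R :> R by rewrite ltr0n (leq_trans _ n16).
have nR : 16 <= n%:R :> R by rewrite (ler_nat _ 16).
have -> : n.+1%:R = n%:R + 1 :> R by rewrite natr1.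
set x := n%:R in n0 nR *.
have l16 : 2 <= ln x.
  apply: (@le_trans _ _ (ln 16)); last by rewrite ler_ln ?posrE.
  have -> : 16 = 2 ^+ 4 :> R by rewrite -natrX.
  have -> : ln (2 ^+ 4) = 4 * ln 2 :> R by rewrite lnXn // mulr_natl.
  by have := ln2_ge_half; lra.
have dl : ln (x + 1) - ln x <= x^-1.
  rewrite -ln_div ?posrE //; last lra.
  have -> : (x + 1) / x = 1 + x^-1 by field; rewrite gt_eqF.
  by apply: le_ln1Dx; rewrite (lt_trans _ (_ : 0 < x^-1)) ?invr_gt0 ?ltrN10.
have xi : x * x^-1 = 1 by rewrite divff // gt_eqF.
have ix : x^-1 <= 1 / 16 by rewrite -[1/16]/(1 * 16^-1) mul1r lef_pV2 ?posrE; lra.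
set u := ln x in l16 dl *; set w := ln (x + 1) in dl *.
have -> : 4 * (u / x) - 4 * (w / (x + 1)) =
   (4 * (u - x * (w - u)) * (x + 1) / x) / (x + 1) ^+ 2 by field; lra.
rewrite ler_pM2r ?invr_gt0 ?exprn_gt0 //; last lra.
have h1 : x * (w - u) <= 1 by rewrite -xi ler_wpM2l // ltW.
have h2 : 1 <= (x + 1) / x by rewrite ler_pdivlMr // mul1r; lra.
rewrite -mulrA; apply: (@le_trans _ _ (4 * (u - x * (w - u)))); first lra.
by rewrite ler_peMr //; lra.
Qed.

Lemma sparsify_iter (a : I -> R) (m : nat) (M : R) :
  (0 < m)%N -> net_mass v a <= M ->
  let N := (sparse_const d * m ^ d)%N in
  exists a' : I -> R, [/\ (#|supp a'| <= N)%N, net_mass v a' = net_mass v a &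
    sq_loss v e nu y a' <= sq_loss v e nu y a +
      12 * d.+3%:R ^+ 5 * d.+1%:R ^+ 2 * (\sum_t nu t) * M ^+ 2 / m%:R ^+ 3
        * (4 * (ln N%:R / N%:R))].
Proof.
move=> m0 aM N.
set K := 12 * _ * _ * _ * _ / _.
have K0 : 0 <= K by rewrite /K divr_ge0 ?exprn_ge0 // mulr_ge0 ?sqr_ge0 // mulr_ge0 ?sumr_ge0 // mulr_ge0 ?exprn_ge0 // mulr_ge0 ?exprn_ge0.
have N16 : (16 <= N)%N.
  have h1 : (0 < (3 * d.+1 + 2) ^ d)%N by rewrite expn_gt0 addn2.
  have h2 : (0 < m ^ d)%N by rewrite expn_gt0 m0.
  rewrite /N /sparse_const.
  move: h1 h2; set u := (_ ^ d)%N; set w := (_ ^ d)%N => h1 h2; nia.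
pose psi n : R := 4 * (ln n%:R / n%:R).
have psi_step n : (N <= n)%N -> ln n.+1%:R / n.+1%:R ^+ 2 <= psi n - psi n.+1.
  by move=> h; apply: ln_div_sq_telescope; exact: leq_trans h.
have psi0 n : 0 <= psi n.
  rewrite /psi mulr_ge0 // divr_ge0 //; case: n => [|n]; last by rewrite ln_ge0 // ler1n.
  by rewrite ln0.
have psi_mono n k : (N <= n)%N -> psi (n + k)%N <= psi n.
  move=> h; elim: k => [|k IH]; first by rewrite addn0.
  apply: le_trans IH; rewrite addnS -subr_ge0.
  apply: le_trans (psi_step (n + k)%N (leq_trans h (leq_addr _ _))).
  by rewrite divr_ge0 ?exprn_ge0 // ln_ge0 // ler1n.
(* The loss is charged to the potential [psi], evaluated at the size of the support until that falls
   to [N]. Each step removes at least one neuron, possibly several, and [psi] is nonincreasing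
   beyond [N]. *)
suff main n : forall a, (#|supp a| <= n)%N -> net_mass v a <= M ->
    exists a' : I -> R, [/\ (#|supp a'| <= N)%N, net_mass v a' = net_mass v a &
      sq_loss v e nu y a' <= sq_loss v e nu y a + K * (psi N - (if (#|supp a| <= N)%N then psi N else psi #|supp a|))].
  have [a' [h1 h2 h3]] := main _ a (leqnn _) aM.
  exists a'; split => //; apply: le_trans h3 _; rewrite lerD2l ler_wpM2l //.
  by case: ifP => _; rewrite ?gerBl ?psi0.
elim: n => [|n IH] {}a ha {}aM.
  exists a; split => //; first by rewrite (leq_trans ha).
  by rewrite (leq_trans ha) // subrr mulr0 addr0.
case: (leqP #|supp a| N) => hN; first by exists a; split; rewrite ?hN // subrr mulr0 addr0.
have [b [sb mb lb]] := sparsify_step m0 aM hN.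
have hb : (#|supp b| <= n)%N by rewrite -ltnS (leq_trans sb).
have [a' [h1 h2 h3]] := IH b hb ltac:(by rewrite mb).
exists a'; split => //; first by rewrite h2.
apply: le_trans h3 _; move: lb; rewrite -/K => lb.
apply: (@le_trans _ _ (sq_loss v e nu y a + K * (ln #|supp a|%:R / #|supp a|%:R ^+ 2)
   + K * (psi N - (if (#|supp b| <= N)%N then psi N else psi #|supp b|)))); first by rewrite lerD2r.
rewrite -addrA lerD2l -mulrDr ler_wpM2l //.
have := psi_step #|supp a|.-1; rewrite prednK ?(leq_trans _ hN) // => /(_ ltac:(by rewrite -ltnS prednK // (leq_trans _ hN))).
case: ifP => hbN.
  have := psi_mono N (#|supp a|.-1 - N)%N (leqnn _).
  by rewrite subnKC; [lra|rewrite -ltnS prednK // (leq_trans _ hN)].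
have hbN' : (N <= #|supp b|)%N by move/negbT: hbN; rewrite -ltnNge; apply: ltnW.
have := psi_mono #|supp b| (#|supp a|.-1 - #|supp b|)%N hbN'.
by rewrite subnKC; [lra|rewrite -ltnS prednK // (leq_trans _ hN)].
Qed.

End Iterate.

(** Points, weights and labels are arbitrary, so the same pruning can control the loss on a sample
    and the distance to the network itself. The original width [N'] does not enter the bound. *)
Theorem sparsify_NN (d : nat) (T : finType) (x : T -> 'rV[R]_d) (nu y : T -> R)
    (N' m : nat) (M : R) (f : 'rV[R]_d -> R) :
  (forall t, 0 <= nu t) -> (forall t, unit_ball d (x t)) -> (0 < m)%N ->
  NN d N' M f ->
  let N := (sparse_const d * m ^ d)%N in
  exists2 g, NN d N M g &
    \sum_t nu t * (g (x t) - y t) ^+ 2 <= \sum_t nu t * (f (x t) - y t) ^+ 2 +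
      12 * d.+3%:R ^+ 5 * d.+1%:R ^+ 2 * (\sum_t nu t) * M ^+ 2 / m%:R ^+ 3
        * (4 * (ln N%:R / N%:R)).
Proof.
move=> nu0 xb m0 [a0 [w [kM ->]]] N.
have [p hp] := choice (fun i => @normalize_direction d (w i)).
pose v i := (p i).1.2; pose a i := a0 i * (p i).1.1.
have val t : net_val v (fun t => ext (x t)) a t = nn_fun a0 w (x t).
  apply: eq_bigr => i _; have [c0 wE _ _] := hp i.
  by rewrite [in RHS]wE dotvZr reluZ // /a mulrA.
have mass : net_mass v a <= M.
  apply: le_trans kM; rewrite le_eqVlt; apply/orP; left; apply/eqP.
  apply: eq_bigr => i _; have [c0 wE _ _] := hp i.
  by rewrite [in RHS]wE enormZ // /a normrM (ger0_norm c0) mulrA.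
have [a' [s' m' l']] := @sparsify_iter d 'I_N' T v (fun t => ext (x t)) nu y (fun i => (p i).2)
  nu0 (fun t j => ext_coord_le1 j (xb t))
  ltac:(by move=> i j; have [_ _ h _] := hp i) ltac:(by move=> i; have [_ _ _ h] := hp i) a m M m0 mass.
pose s := [seq (a' i, v i) | i <- enum (supp a')].
have sumS (F : R -> 'rV[R]_d.+1 -> R) : (forall u, F 0 u = 0) ->
    \sum_(q <- s) F q.1 q.2 = \sum_i F (a' i) (v i).
  move=> F0; rewrite big_map big_enum /= [RHS](bigID (mem (supp a'))) /= [X in _ = _ + X]big1 ?addr0 //.
  by move=> i; rewrite inE negbK => /eqP ->.
have gv t : seq_net s (x t) = net_val v (fun t => ext (x t)) a' t.
  by rewrite /seq_net (sumS (fun b u => b * relu (dotv (ext (x t)) u))) // => u; rewrite mul0r.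
exists (seq_net s).
  apply: seq_net_NN; first by rewrite size_map -cardE.
  rewrite /seq_mass (sumS (fun b u => `|b| * enorm u)) -/(net_mass v a') ?m' // => u.
  by rewrite normr0 mul0r.
have -> : \sum_t nu t * (seq_net s (x t) - y t) ^+ 2 = sq_loss v (fun t => ext (x t)) nu y a'.
  by apply: eq_bigr => t _; rewrite gv.
apply: le_trans l' _; rewrite lerD2r /sq_loss.
by under eq_bigr do rewrite val.
Qed.

End SparsifyNN.

(** * Empirical risk minimisation *)

Section FiniteConcentration.
Variable R : realType.
Local Close Scope classical_set_scope.

Lemma expR_le_quadratic (x : R) : x <= 1 / 2 -> expR x <= 1 + x + 2 * x ^+ 2.
Proof.
move=> hx; have h1 : 0 < 1 - x by lra.
have h2 : 1 - x <= expR (- x) by exact: expR_ge1Dx.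
have h3 : expR x <= (1 - x)^-1.
  by rewrite -[x]opprK expRN lef_pV2 ?posrE ?expR_gt0 // opprK.
apply: le_trans h3 _; rewrite -[leLHS]mul1r ler_pdivrMr //.
have := sqr_ge0 x; rewrite expr2 => h; nra.
Qed.

Lemma mgf_le (Om : finType) (p Z : Om -> R) :
  (forall o, 0 <= p o) -> \sum_o p o = 1 -> (forall o, Z o <= 1 / 2) ->
  \sum_o p o * expR (Z o) <=
    expR (\sum_o p o * Z o + 2 * \sum_o p o * Z o ^+ 2).
Proof.
move=> p0 p1 hZ; apply: le_trans (expR_ge1Dx _).
rewrite -[X in X + (_ + _)]p1 mulr_sumr -!big_split; apply: ler_sum => o _ /=.
rewrite (le_trans (ler_wpM2l (p0 o) (expR_le_quadratic (hZ o)))) //.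
by rewrite le_eqVlt; apply/orP; left; apply/eqP; ring.
Qed.

(** The law of the sample is the product weight on [{ffun 'I_n -> Om}]; under it the exponential
    moment factorises, and Markov's inequality for it is a comparison of finite sums. *)
Lemma chernoff_finite (Om : finType) (p Z : Om -> R) (n : nat) (s t : R) :
  (forall o, 0 <= p o) -> \sum_o p o * expR (Z o) <= expR s ->
  \sum_(tau : {ffun 'I_n -> Om} | n%:R * s + t <= \sum_i Z (tau i))
     \prod_i p (tau i) <= expR (- t).
Proof.
move=> p0 hs.
pose c : R := expR (- (n%:R * s + t)).
apply: (@le_trans _ _ (\sum_(tau : {ffun 'I_n -> Om}) c * \prod_i (p (tau i) * expR (Z (tau i))))).
  rewrite big_mkcond /=; apply: ler_sum => tau _.
  have pr0 : 0 <= \prod_i p (tau i) by apply: prodr_ge0.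
  case: ifPn => h.
    rewrite big_split /= mulrCA -{1}[leLHS]mulr1 ler_wpM2l // -expR_sum /c -expRD.
    by rewrite (le_trans _ (expR_ge1Dx _)) // lerDl; lra.
  by rewrite mulr_ge0 ?expR_ge0 // prodr_ge0 // => i _; rewrite mulr_ge0 ?expR_ge0.
rewrite -mulr_sumr -(bigA_distr_bigA (fun (_ : 'I_n) o => p o * expR (Z o))).
rewrite prodr_const card_ord /c.
apply: (@le_trans _ _ (expR (- (n%:R * s + t)) * expR s ^+ n)).
  rewrite ler_wpM2l ?expR_ge0 // lerXn2r ?nnegrE ?expR_ge0 //.
  by apply: sumr_ge0 => o _; rewrite mulr_ge0 ?expR_ge0.
by rewrite -expRM_natl -expRD ler_expR; lra.
Qed.

Section Regression.
Variables (U V : finType) (p : U * V -> R) (h : U -> R) (y : V -> R).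
Variables (B b eta : R).
Hypothesis p_ge0 : forall o, 0 <= p o.
Hypothesis p_sum1 : \sum_o p o = 1.
Hypothesis h_le : forall u, `|h u| <= b.
Hypothesis y_le : forall v, `|y v| <= B.
Hypothesis B_ge0 : 0 <= B.
Hypothesis b_ge0 : 0 <= b.
Hypothesis eta_ge0 : 0 <= eta.
(** The identity defining the conditional expectation survives the rounding of [h] and of the labels
    to cells only up to [eta]. *)
Hypothesis reg : forall u, `|\sum_v p (u, v) * (y v - h u)| <= eta * \sum_v p (u, v).

Definition excess (phi : U -> R) (o : U * V) : R :=
  (phi o.1 - y o.2) ^+ 2 - (h o.1 - y o.2) ^+ 2.
Definition risk (phi : U -> R) : R := \sum_o p o * (phi o.1 - h o.1) ^+ 2.

Lemma cross_term (psi : U -> R) (c : R) : (forall u, `|psi u| <= c) ->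
  `|\sum_o p o * (psi o.1 * (y o.2 - h o.1))| <= c * eta.
Proof.
move=> psic.
have -> : \sum_o p o * (psi o.1 * (y o.2 - h o.1)) =
   \sum_u psi u * \sum_v p (u, v) * (y v - h u).
  transitivity (\sum_(o : U * V) p (o.1, o.2) * (psi o.1 * (y o.2 - h o.1))).
    by apply: eq_bigr => -[].
  rewrite -(pair_bigA _ (fun u v => p (u, v) * (psi u * (y v - h u)))) /=.
  by apply: eq_bigr => u _; rewrite mulr_sumr; apply: eq_bigr => v _; rewrite mulrCA.
rewrite (le_trans (ler_norm_sum _ _ _)) //.
rewrite (le_trans (y := \sum_u c * (eta * \sum_v p (u, v)))) //.
  by apply: ler_sum => u _; rewrite normrM ler_pM.
rewrite -mulr_sumr -mulr_sumr pair_big /=.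
have -> : \sum_(q : U * V) p (q.1, q.2) = 1.
  by rewrite -p_sum1; apply: eq_bigr => -[].
by rewrite mulr1.
Qed.

(** The second moment of the excess loss is at most [K] times the risk. At the parameter
    [l = 1 / (4 K)] the quadratic term of the exponential moment therefore consumes only half of the
    mean. This self-bounding is what gives a deviation of order [t / n] and not its square root. *)
Lemma excess_lower_tail (phi : U -> R) (n : nat) (t K : R) :
  (forall u, `|phi u| <= B) -> (3 * B + b + 1) ^+ 2 <= K ->
  \sum_(tau : {ffun 'I_n -> U * V} |
      \sum_i excess phi (tau i) <= n%:R * (risk phi / 2 - 2 * (B + b) * eta) - 4 * K * t)
     \prod_i p (tau i) <= expR (- t).
Proof.
move=> phiB hK; have B0 := B_ge0; have b0 := b_ge0.
have K1 : 1 <= K by apply: le_trans hK; apply: exprn_ege1; rewrite lerDr; move: B_ge0 b_ge0; lra.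
pose l := (4 * K)^-1.
have l0 : 0 < l by rewrite invr_gt0; lra.
have lK : l * K = 1 / 4 by rewrite /l; field; lra.
have exE o : excess phi o = (phi o.1 - h o.1) * (phi o.1 + h o.1 - 2 * y o.2).
  by rewrite /excess; ring.
have f1 (o : U * V) : `|phi o.1 - h o.1| <= B + b.
  by rewrite (le_trans (ler_normB _ _)) // lerD.
have f2 o : `|phi o.1 + h o.1 - 2 * y o.2| <= 3 * B + b.
  have a1 := phiB o.1; have a2 := h_le o.1; have a3 := y_le o.2.
  by move: a1 a2 a3; rewrite !ler_norml => /andP[? ?] /andP[? ?] /andP[? ?]; lra.
have f3 o : `|excess phi o| <= K.
  rewrite exE normrM (le_trans (ler_pM _ _ (f1 o) (f2 o))) //.
  by apply: le_trans hK; rewrite expr2; apply: ler_pM; move: B_ge0 b_ge0; lra.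
have f4 o : excess phi o ^+ 2 <= K * (phi o.1 - h o.1) ^+ 2.
  rewrite exE exprMn mulrC ler_wpM2r ?sqr_ge0 // (le_trans _ hK) //.
  have q : 0 <= 3 * B + b + 1 by lra.
  rewrite -[leLHS]real_normK ?num_real // ler_pXn2r ?nnegrE //.
  by apply: le_trans (f2 o) _; lra.
set s := - l * (risk phi / 2 - 2 * (B + b) * eta).
have mgf : \sum_o p o * expR (- l * excess phi o) <= expR s.
  apply: le_trans (mgf_le p_ge0 p_sum1 _) _.
    move=> o; have := f3 o; rewrite ler_norml => /andP[h1 _].
    by rewrite mulNr lerNl; nra.
  rewrite ler_expR.
  have e1 : risk phi - 2 * (B + b) * eta <= \sum_o p o * excess phi o.
    have -> : \sum_o p o * excess phi o = risk phi + - (2 * \sum_o p o * ((phi o.1 - h o.1) * (y o.2 - h o.1))).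
      rewrite mulr_sumr -sumrN /risk -big_split; apply: eq_bigr => o _ /=.
      by rewrite exE; ring.
    rewrite lerD2l lerN2 -mulrA ler_pM2l // (le_trans (ler_norm _)) //.
    by apply: (cross_term (psi := fun u => phi u - h u)) => u; rewrite (le_trans (ler_normB _ _)) // lerD.
  have e2 : \sum_o p o * excess phi o ^+ 2 <= K * risk phi.
    by rewrite /risk mulr_sumr; apply: ler_sum => o _; rewrite (mulrCA K) ler_wpM2l.
  have -> : \sum_o p o * (- l * excess phi o) = - l * \sum_o p o * excess phi o.
    by rewrite mulr_sumr; apply: eq_bigr => o _; rewrite mulrCA.
  have -> : \sum_o p o * (- l * excess phi o) ^+ 2 = l ^+ 2 * \sum_o p o * excess phi o ^+ 2.
    by rewrite mulr_sumr; apply: eq_bigr => o _; rewrite exprMn sqrrN mulrCA.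
  have e3 : l ^+ 2 * (\sum_o p o * excess phi o ^+ 2) <= l * (1 / 4) * risk phi.
    rewrite (le_trans (ler_wpM2l (sqr_ge0 _) e2)) // -lK le_eqVlt; apply/orP; left; apply/eqP; ring.
  have e4 := ler_wpM2l (ltW l0) e1.
  rewrite /s; move: e3 e4; set A := l ^+ 2 * _; set E := \sum_o _; set r := risk phi => e3 e4.
  have -> : - l * (r / 2 - 2 * (B + b) * eta) = - (l * (r - 2 * (B + b) * eta)) + l * r / 2 by field.
  rewrite mulNr; lra.
apply: le_trans (chernoff_finite n t p_ge0 mgf).
rewrite [leRHS](bigID (fun tau : {ffun 'I_n -> U * V} =>
  \sum_i excess phi (tau i) <= n%:R * (risk phi / 2 - 2 * (B + b) * eta) - 4 * K * t)) /=.
rewrite -[leLHS]addr0 lerD //; last by apply: sumr_ge0 => tau _; exact: prodr_ge0.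
rewrite le_eqVlt; apply/orP; left; apply/eqP; apply: eq_bigl => tau.
case: (leP (\sum_i excess phi (tau i))) => hc; rewrite ?andbF // andbT.
apply/esym; rewrite -mulr_sumr /s.
have := ler_wpM2l (ltW l0) hc; set E := \sum_i _ => hc'.
have e5 : l * (4 * K * t) = t by rewrite mulrA (mulrCA l) lK; lra.
rewrite mulrBr e5 in hc'; rewrite !mulNr mulrN; move: hc'.
rewrite (mulrCA n%:R); lra.
Qed.

(** The same computation for the approximant, with the sup-norm bound [eps ^+ 2] in the role of the
    risk. *)
Lemma excess_upper_tail (phi : U -> R) (n : nat) (t K eps : R) :
  0 <= eps -> (forall u, `|phi u - h u| <= eps) -> (eps + 2 * B + 2 * b + 1) ^+ 2 <= K ->
  \sum_(tau : {ffun 'I_n -> U * V} |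
      n%:R * (2 * eps ^+ 2 + 2 * eps * eta) + 4 * K * t <= \sum_i excess phi (tau i))
     \prod_i p (tau i) <= expR (- t).
Proof.
move=> eps0 phieps hK; have B0 := B_ge0; have b0 := b_ge0.
have K1 : 1 <= K by apply: le_trans hK; apply: exprn_ege1; rewrite lerDr; move: B_ge0 b_ge0; lra.
pose l := (4 * K)^-1.
have l0 : 0 < l by rewrite invr_gt0; lra.
have lK : l * K = 1 / 4 by rewrite /l; field; lra.
have exE o : excess phi o = (phi o.1 - h o.1) * ((phi o.1 - h o.1) + 2 * (h o.1 - y o.2)).
  by rewrite /excess; ring.
have f2 o : `|(phi o.1 - h o.1) + 2 * (h o.1 - y o.2)| <= eps + 2 * B + 2 * b.
  have a1 := phieps o.1; have a2 := h_le o.1; have a3 := y_le o.2.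
  by move: a1 a2 a3; rewrite !ler_norml => /andP[? ?] /andP[? ?] /andP[? ?]; lra.
have f3 o : `|excess phi o| <= eps * (eps + 2 * B + 2 * b).
  by rewrite exE normrM ler_pM.
have f3' o : `|excess phi o| <= K.
  apply: le_trans (f3 o) _; apply: le_trans hK; rewrite expr2.
  by apply: ler_pM; move: B_ge0 b_ge0; lra.
have f4 o : excess phi o ^+ 2 <= K * eps ^+ 2.
  rewrite -[leLHS]real_normK ?num_real // (le_trans (y := (eps * (eps + 2 * B + 2 * b)) ^+ 2)) //.
    by rewrite ler_pXn2r ?nnegrE // mulr_ge0 //; lra.
  have q : 0 <= eps + 2 * B + 2 * b by lra.
  have q' : 0 <= eps + 2 * B + 2 * b + 1 by lra.
  rewrite exprMn mulrC ler_wpM2r ?sqr_ge0 //; apply: le_trans hK.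
  by rewrite ler_pXn2r ?nnegrE //; lra.
set s := l * (2 * eps ^+ 2 + 2 * eps * eta).
have mgf : \sum_o p o * expR (l * excess phi o) <= expR s.
  apply: le_trans (mgf_le p_ge0 p_sum1 _) _.
    move=> o; have := f3' o; rewrite ler_norml => /andP[_ h1].
    by have := ler_wpM2l (ltW l0) h1; lra.
  rewrite ler_expR.
  have e1 : \sum_o p o * excess phi o <= eps ^+ 2 + 2 * eps * eta.
    have -> : \sum_o p o * excess phi o = (\sum_o p o * (phi o.1 - h o.1) ^+ 2) + - (2 * \sum_o p o * ((phi o.1 - h o.1) * (y o.2 - h o.1))).
      rewrite mulr_sumr -sumrN -big_split; apply: eq_bigr => o _ /=.
      by rewrite exE; ring.
    apply: lerD.
      rewrite -[leRHS]mul1r -p_sum1 mulr_suml; apply: ler_sum => o _; rewrite ler_wpM2l //.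
      by rewrite -[leLHS]real_normK ?num_real // ler_pXn2r ?nnegrE.
    rewrite -mulrN -mulrA ler_pM2l // (le_trans (ler_norm _)) // normrN.
    exact: (cross_term (psi := fun u => phi u - h u)).
  have e2 : \sum_o p o * excess phi o ^+ 2 <= K * eps ^+ 2.
    rewrite -[leRHS]mul1r -p_sum1 mulr_suml; apply: ler_sum => o _.
    by rewrite ler_wpM2l.
  have -> : \sum_o p o * (l * excess phi o) = l * \sum_o p o * excess phi o.
    by rewrite mulr_sumr; apply: eq_bigr => o _; rewrite mulrCA.
  have -> : \sum_o p o * (l * excess phi o) ^+ 2 = l ^+ 2 * \sum_o p o * excess phi o ^+ 2.
    by rewrite mulr_sumr; apply: eq_bigr => o _; rewrite exprMn mulrCA.
  have e3 : l ^+ 2 * (\sum_o p o * excess phi o ^+ 2) <= l * (1 / 4) * eps ^+ 2.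
    rewrite (le_trans (ler_wpM2l (sqr_ge0 _) e2)) // -lK le_eqVlt; apply/orP; left; apply/eqP; ring.
  have e4 := ler_wpM2l (ltW l0) e1.
  have e5 : 0 <= l * eps ^+ 2 by rewrite mulr_ge0 ?sqr_ge0 // ltW.
  rewrite /s; move: e3 e4 e5; set A := l ^+ 2 * _; set E := \sum_o _.
  rewrite !mulrDr; lra.
apply: le_trans (chernoff_finite n t p_ge0 mgf).
rewrite [leRHS](bigID (fun tau : {ffun 'I_n -> U * V} =>
  n%:R * (2 * eps ^+ 2 + 2 * eps * eta) + 4 * K * t <= \sum_i excess phi (tau i))) /=.
rewrite -[leLHS]addr0 lerD //; last by apply: sumr_ge0 => tau _; exact: prodr_ge0.
rewrite le_eqVlt; apply/orP; left; apply/eqP; apply: eq_bigl => tau.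
case: (leP _ (\sum_i excess phi (tau i))) => hc; rewrite ?andbF // andbT.
apply/esym; rewrite -mulr_sumr /s.
have := ler_wpM2l (ltW l0) hc; set E := \sum_i _ => hc'.
have e5 : l * (4 * K * t) = t by rewrite mulrA (mulrCA l) lK; lra.
by rewrite mulrDr e5 in hc'; rewrite (mulrCA n%:R).
Qed.

End Regression.
End FiniteConcentration.

(** * Measurability, truncation and integrals over cells *)

Section MeasureCells.
Variable R : realType.

Lemma measurable_coord (d : nat) (j : 'I_d) :
  measurable_fun setT (fun x : @Rvec R d => x 0 j : R).
Proof.
apply: (measurability _ (RGenOInfty.measurableE R)) => // _ [_ [a ->] <-].
rewrite setTI; apply: sub_sigma_algebra; rewrite /opens /=.
apply: (@open_comp _ _ (fun M : 'rV[R]_d => M 0 j)).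
  by move=> M _; exact: coord_continuous.
exact: interval_open.
Qed.

Lemma measurable_fun_dotv (d : nat) (u : 'rV[R]_d) :
  measurable_fun setT (fun x : @Rvec R d => dotv x u).
Proof.
apply: measurable_sum => j; apply: measurable_funM; first exact: measurable_coord.
exact: measurable_cst.
Qed.

Lemma dotv_ext (d : nat) (x : 'rV[R]_d) (w : 'rV[R]_d.+1) :
  dotv (ext x) w = dotv x (\row_j w 0 (lift ord_max j)) + w 0 ord_max.
Proof.
rewrite /dotv (bigD1 ord_max) //= addrC; congr (_ + _); last first.
  by rewrite /ext mxE unlift_none mul1r.
rewrite (reindex_omap (lift ord_max) (unlift ord_max)) /=; last first.
  by move=> i; case: unliftP => [j -> _|->]; rewrite ?eqxx.
apply: eq_big => [j|j _]; last by rewrite /ext !mxE liftK.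
by rewrite liftK eqxx andbT eq_sym neq_lift.
Qed.

Lemma measurable_relu_dotv (d : nat) (w : 'rV[R]_d.+1) :
  measurable_fun setT (fun x : @Rvec R d => relu (dotv (ext x) w)).
Proof.
apply: measurable_maxr; last exact: measurable_cst.
have -> : (fun x : @Rvec R d => dotv (ext x) w) =
  (fun x => dotv x (\row_j w 0 (lift ord_max j)) + w 0 ord_max).
  by apply/funext => x; rewrite dotv_ext.
apply: measurable_funD; [exact: measurable_fun_dotv|exact: measurable_cst].
Qed.

Lemma measurable_NN (d N : nat) (M : R) f : NN d N M f ->
  measurable_fun setT (f : @Rvec R d -> R).
Proof.
move=> [a [w [_ ->]]]; apply: measurable_sum => i.
apply: measurable_funM; [exact: measurable_cst|exact: measurable_relu_dotv].
Qed.

Lemma measurable_unit_ball (d : nat) : measurable (unit_ball d : set (@Rvec R d)).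
Proof.
have -> : (unit_ball d : set (@Rvec R d)) =
    setT `&` (fun x : @Rvec R d => dotv x x) @^-1` `]-oo, 1]%classic.
  rewrite setTI; apply/seteqP; split => x; rewrite /unit_ball /= in_itv /=.
    by move=> h; rewrite -sqr_enorm expr_le1 ?enorm_ge0.
  by rewrite -sqr_enorm expr_le1 ?enorm_ge0.
have m : measurable_fun setT (fun x : @Rvec R d => dotv x x).
  by apply: measurable_sum => j; apply: measurable_funM; exact: measurable_coord.
exact: m.
Qed.

Lemma truncB_minmax (B t : R) : 0 <= B -> truncB B t = Num.max (- B) (Num.min t B).
Proof.
move=> B0; rewrite /truncB; case: ifPn => [|].
  rewrite ler_norml => /andP[h1 h2].
  by rewrite (min_idPl h2); apply/esym/max_idPr.
rewrite -ltNge ltr_normr => /orP[h|h]; last first.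
  rewrite ltr0_sg ?mulN1r; last lra.
  by rewrite (min_idPl _); [apply/esym/max_idPl|]; lra.
rewrite gtr0_sg ?mul1r; last lra.
by rewrite (min_idPr (ltW h)); apply/esym/max_idPr; lra.
Qed.

Lemma truncB_bound (B t : R) : 0 <= B -> `|truncB B t| <= B.
Proof.
move=> B0; rewrite truncB_minmax // ler_norml le_max lexx /= ge_max.
by rewrite ge_min lexx orbT andbT; lra.
Qed.

Lemma truncB_contract (B t y : R) : `|y| <= B -> `|truncB B t - y| <= `|t - y|.
Proof.
move=> yB; have B0 : 0 <= B := le_trans (normr_ge0 _) yB.
rewrite /truncB; case: ifPn => //; rewrite -ltNge ltr_normr.
move: yB; rewrite ler_norml => /andP[y1 y2] /orP[h|h].
  by rewrite gtr0_sg ?mul1r; [rewrite !ger0_norm|]; lra.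
by rewrite ltr0_sg ?mulN1r; [rewrite !ler0_norm|]; lra.
Qed.

Lemma truncB_lip (B s t : R) : 0 <= B -> `|truncB B s - truncB B t| <= `|s - t|.
Proof.
move=> B0; rewrite !truncB_minmax // !maxEle !minEle.
wlog st : s t / s <= t.
  move=> hw; case: (leP s t) => [/hw //|/ltW /hw]; by rewrite distrC [leRHS]distrC.
rewrite [leRHS]distrC [leLHS]distrC [leRHS]ger0_norm ?subr_ge0 //.
by case: (leP s B) => ?; case: (leP t B) => ?; rewrite ler_norml;
  repeat (case: ifPn => //; rewrite -?ltNge => ?); apply/andP; split; lra.
Qed.

Lemma measurable_truncB (d : measure_display) (T : measurableType d) (B : R) (f : T -> R) :
  0 <= B -> measurable_fun setT f -> measurable_fun setT (fun x => truncB B (f x)).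
Proof.
move=> B0 mf; have -> : (fun x => truncB B (f x)) = (fun x => Num.max (- B) (Num.min (f x) B)).
  by apply/funext => x; rewrite truncB_minmax.
apply: measurable_maxr; first exact: measurable_cst.
by apply: measurable_minr => //; exact: measurable_cst.
Qed.

Lemma integral_near_cst (d : measure_display) (T : measurableType d)
    (mu : {finite_measure set T -> \bar R}) (D : set T) (f : T -> R) (c eta : R) :
  measurable D -> measurable_fun D f -> (forall x, D x -> `|f x - c| <= eta) ->
  (\int[mu]_(x in D) (f x)%:E \is a fin_num)%E /\
  `|fine (\int[mu]_(x in D) (f x)%:E) - c * fine (mu D)| <= eta * fine (mu D).
Proof.
move=> mD mf hf.
have fD : mu D \is a fin_num by exact: fin_num_measure.
have intc k : mu.-integrable D (EFin \o cst k).
  apply/integrableP; split; first exact/measurable_EFinP/measurable_cst.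
  under eq_integral do rewrite /=.
  rewrite (integral_cst mu mD `|k|%:E) // lte_mul_pinfty ?lee_fin // ltey_eq fD //.
have intf : mu.-integrable D (EFin \o f).
  apply: (@le_integrable _ _ _ mu D mD _ (EFin \o cst (`|c| + eta))) => //.
  - exact/measurable_EFinP.
  - move=> x Dx; rewrite /= lee_fin [leRHS]ger0_norm.
      rewrite -{1}[f x](subrK c) addrC (le_trans (ler_normD _ _)) // lerD2l; exact: hf.
    by rewrite addr_ge0 // (le_trans _ (hf _ Dx)).
have ff : (\int[mu]_(x in D) (f x)%:E \is a fin_num)%E by exact: integrable_fin_num intf.
split => //.
have up : (\int[mu]_(x in D) (f x)%:E <= (c + eta)%:E * mu D)%E.
  rewrite -(integral_cst mu mD); apply: le_integral => //; first exact: intc.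
  move=> x; rewrite inE => Dx; rewrite /= lee_fin.
  by have := hf _ Dx; rewrite ler_norml => /andP[_]; lra.
have lo : ((c - eta)%:E * mu D <= \int[mu]_(x in D) (f x)%:E)%E.
  rewrite -(integral_cst mu mD); apply: le_integral => //; first exact: intc.
  move=> x; rewrite inE => Dx; rewrite /= lee_fin.
  by have := hf _ Dx; rewrite ler_norml => /andP[]; lra.
move: up lo; rewrite -(fineK ff) -(fineK fD) -!EFinM !lee_fin /=.
set I := fine _; set m := fine (mu D); rewrite ler_norml mulrDl mulrBl => ? ?.
by apply/andP; split; lra.
Qed.

End MeasureCells.

Section Discretize.
Variable R : realType.

Lemma measure_bigcup_finType (dd : measure_display) (T : measurableType dd)
    (mu : {measure set T -> \bar R}) (I : finType) (P : pred I) (F : I -> set T) :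
  (forall i, measurable (F i)) -> trivIset setT F ->
  mu (\bigcup_(i in [set i | P i]) F i) = (\sum_(i | P i) mu (F i))%E.
Proof.
move=> mF tF.
have -> : [set i | P i] = [set` [seq i <- enum I | P i]].
  by apply/seteqP; split => i /=; rewrite mem_filter mem_enum andbT.
rewrite measure_fin_bigcup; [|exact: finite_seq|exact: sub_trivIset tF|by move=> i _].
rewrite -fsbig_seq ?filter_uniq ?enum_uniq //.
  by rewrite big_filter big_enum_cond.
by rewrite -enumT enum_uniq.
Qed.

Variables (d : nat) (B : R) (k : nat).
Hypothesis B_gt0 : 0 < B.
Hypothesis k_gt0 : (0 < k)%N.

(** A coordinate in [[-1, 1]] is sent to [[0, 2 k]]. There are [(2 * k).+1] half-open slots because
    the end point [2 k] opens a slot of its own. *)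
Definition xcell (u : {ffun 'I_d -> 'I_(2 * k).+1}) : set (@Rvec R d) :=
  unit_ball d `&` \bigcap_j (fun x : @Rvec R d => (x 0 j + 1) * k%:R) @^-1`
    `[(u j)%:R, (u j).+1%:R[%classic.
Definition ycell (v : 'I_(2 * k).+1) : set R :=
  [set y | `|y| <= B] `&` (fun y => (y / B + 1) * k%:R) @^-1` `[v%:R, v.+1%:R[%classic.

Let kR : 0 < k%:R :> R. Proof. by rewrite ltr0n. Qed.

Lemma measurable_xcell u : measurable (xcell u).
Proof.
apply: measurableI; first exact: measurable_unit_ball.
apply: (fin_bigcap_measurable finite_finset) => j _; rewrite -[X in measurable X]setTI.
have m : measurable_fun setT (fun x : @Rvec R d => (x 0 j + 1) * k%:R).
  apply: measurable_funM; last exact: measurable_cst.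
  by apply: measurable_funD; [exact: measurable_coord|exact: measurable_cst].
by apply: m.
Qed.

Lemma measurable_ycell v : measurable (ycell v).
Proof.
apply: measurableI.
  have -> : [set y : R | `|y| <= B] = `[- B, B]%classic.
    by apply/seteqP; split => y /=; rewrite in_itv /= ler_norml.
  exact: measurable_itv.
rewrite -[X in measurable X]setTI.
have m : measurable_fun setT (fun y : R => (y / B + 1) * k%:R).
  apply: measurable_funM; last exact: measurable_cst.
  apply: measurable_funD; last exact: measurable_cst.
  by apply: measurable_funM; [exact: measurable_id|exact: measurable_cst].
by apply: m.
Qed.

Lemma grid_index (r : R) : `|r| <= 1 ->
  exists v : 'I_(2 * k).+1, v%:R <= (r + 1) * k%:R < v.+1%:R.
Proof.
rewrite ler_norml => /andP[r1 r2].
have x0 : 0 <= (r + 1) * k%:R by apply: mulr_ge0; [lra|exact: ltW].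
have := truncn_itv x0; set t := Num.truncn _ => h.
have tk : (t < (2 * k).+1)%N.
  rewrite ltnS -(ler_nat R); case/andP: h => h _; rewrite (le_trans h) //.
  by rewrite natrM ler_pM2r //; lra.
by exists (Ordinal tk).
Qed.

Lemma grid_index_unique (v v' : 'I_(2 * k).+1) (x : R) :
  v%:R <= x < v.+1%:R -> v'%:R <= x < v'.+1%:R -> v = v'.
Proof.
move=> /andP[a1 a2] /andP[b1 b2]; apply/val_inj/eqP => /=.
have := le_lt_trans a1 b2; have := le_lt_trans b1 a2.
by rewrite !ltr_nat !ltnS eqn_leq => -> ->.
Qed.

Lemma xcell_cover (x : 'rV[R]_d) : unit_ball d x -> exists u, xcell u x.
Proof.
move=> xb.
have [u hu] := choice (fun j => grid_index (le_trans (coord_le_enorm x j) xb)).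
exists [ffun j => u j]; split => // j _ /=; rewrite in_itv /= !ffunE; exact: hu.
Qed.

Lemma xcell_disj u u' x : xcell u x -> xcell u' x -> u = u'.
Proof.
move=> [_ h] [_ h']; apply/ffunP => j.
by have /= := h j I; have /= := h' j I; rewrite !in_itv /= => a b; exact: (grid_index_unique b a).
Qed.

Lemma ycell_cover y : `|y| <= B -> exists v, ycell v y.
Proof.
move=> yB; have [v hv] : exists v : 'I_(2 * k).+1, v%:R <= (y / B + 1) * k%:R < v.+1%:R.
  by apply: grid_index; rewrite normrM normfV (gtr0_norm B_gt0) ler_pdivrMr // mul1r.
by exists v; split => //=; rewrite in_itv.
Qed.

Lemma ycell_disj v v' y : ycell v y -> ycell v' y -> v = v'.
Proof. by move=> [_ /=] + [_ /=]; rewrite !in_itv /=; exact: grid_index_unique. Qed.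

Lemma grid_close (v : 'I_(2 * k).+1) (r s : R) :
  v%:R <= (r + 1) * k%:R < v.+1%:R -> v%:R <= (s + 1) * k%:R < v.+1%:R ->
  `|r - s| <= k%:R^-1.
Proof.
rewrite -!natr1 => /andP[a1 a2] /andP[b1 b2].
rewrite -[leRHS]mul1r ler_pdivlMr // -{1}[k%:R]gtr0_norm // -normrM ler_norml.
by apply/andP; split; rewrite mulrBl; lra.
Qed.

Lemma xcell_close u x x' j : xcell u x -> xcell u x' -> `|x 0 j - x' 0 j| <= k%:R^-1.
Proof.
by move=> [_ h] [_ h']; have /= := h j I; have /= := h' j I; rewrite !in_itv /= => a b;
  exact: (grid_close b a).
Qed.

Lemma ycell_close v y y' : ycell v y -> ycell v y' -> `|y - y'| <= B / k%:R.
Proof.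
move=> [_ /=] + [_ /=]; rewrite !in_itv /= => a b.
have := grid_close a b; rewrite -mulrBl normrM normfV (gtr0_norm B_gt0).
by rewrite ler_pdivrMr // mulrC.
Qed.

Section Joint.
Variables (dO0 : measure_display) (O0 : measurableType dO0) (P0 : probability O0 R).
Variables (X : O0 -> @Rvec R d) (Y : O0 -> R).
Hypothesis mX : measurable_fun setT X.
Hypothesis mY : measurable_fun setT Y.
Hypothesis X_ball : P0 (X @^-1` (~` unit_ball d)) = 0%E.
Hypothesis Y_bound : P0 [set w | B < `|Y w|] = 0%E.

Let Om := ({ffun 'I_d -> 'I_(2 * k).+1} * 'I_(2 * k).+1)%type.
Definition cell (o : Om) : set (@Rvec R d * R)%type := xcell o.1 `*` ycell o.2.
Definition pcell (o : Om) : R := fine (P0 ((fun w => (X w, Y w)) @^-1` cell o)).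

Lemma measurable_cell o : measurable (cell o).
Proof. by apply: measurableX; [exact: measurable_xcell|exact: measurable_ycell]. Qed.

Lemma cell_disj o o' z : cell o z -> cell o' z -> o = o'.
Proof.
case: o o' => [u v] [u' v'] [/= a b] [/= a' b'].
by rewrite (xcell_disj a a') (ycell_disj b b').
Qed.

Lemma pcell_ge0 o : 0 <= pcell o.
Proof. exact: fine_ge0. Qed.

Let mXY : measurable_fun setT (fun w => (X w, Y w)).
Proof. exact: measurable_fun_pair. Qed.

Let mpre o : measurable ((fun w => (X w, Y w)) @^-1` cell o).
Proof. by rewrite -[X in measurable X]setTI; apply: mXY => //; exact: measurable_cell. Qed.

Let mYb : measurable [set w | B < `|Y w|].
Proof.
rewrite (_ : [set w | _] = setT `&` (fun w => `|Y w|) @^-1` `]B, +oo[%classic).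
  have m : measurable_fun setT (fun w => `|Y w|) by exact: measurableT_comp.
  by apply: m.
by rewrite setTI; apply/seteqP; split => w /=; rewrite in_itv /= andbT.
Qed.

Let mXb : measurable (X @^-1` (~` unit_ball d)).
Proof. by rewrite -[X in measurable X]setTI; apply: mX => //; apply: measurableC; exact: measurable_unit_ball. Qed.

Let mXu u : measurable (X @^-1` xcell u).
Proof. by rewrite -[X in measurable X]setTI; apply: mX => //; exact: measurable_xcell. Qed.

Lemma pcellE o : (pcell o)%:E = P0 ((fun w => (X w, Y w)) @^-1` cell o).
Proof. by rewrite /pcell fineK // fin_num_measure. Qed.

Let measure_sub_null (A C N : set O0) : measurable A -> measurable C -> measurable N ->
  P0 N = 0%E -> C `<=` A -> A `<=` C `|` N -> P0 A = P0 C.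
Proof.
move=> mA mC mN N0 CA ACN; apply/eqP; rewrite eq_le; apply/andP; split; last first.
  by apply: le_measure => //; rewrite inE.
apply: (@le_trans _ _ (P0 (C `|` N))).
  by apply: le_measure => //; rewrite inE //; exact: measurableU.
have h : (P0 (C `|` N) <= P0 C + P0 N)%E by exact: measureU2.
by rewrite (le_trans h) // N0 adde0.
Qed.

Lemma pcell_xmarginal u : P0 (X @^-1` xcell u) = (\sum_v pcell (u, v))%:E.
Proof.
rewrite -sumEFin; under eq_bigr do rewrite pcellE.
pose F v := (fun w => (X w, Y w)) @^-1` cell (u, v).
have tF : trivIset setT F.
  apply/trivIsetP => v v' _ _ vv'; apply/seteqP; split => // w [a b].
  by have := cell_disj a b => -[] /eqP; rewrite (negPf vv').
rewrite -(@measure_bigcup_finType _ _ P0 _ xpredT F) //; last by move=> v; exact: mpre.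
apply: (@measure_sub_null _ _ [set w | B < `|Y w|]) => //.
- by apply: (fin_bigcup_measurable finite_finset) => v _; exact: mpre.
- by move=> w [v _ [/= a b]].
- move=> w a; case: (leP `|Y w| B) => h; last by right.
  by left; have [v hv] := ycell_cover h; exists v.
Qed.

Lemma pcell_sum1 : \sum_o pcell o = 1.
Proof.
have -> : \sum_o pcell o = \sum_u \sum_v pcell (u, v).
  by rewrite pair_big /=; apply: eq_bigr => -[].
apply: EFin_inj; rewrite -sumEFin; under eq_bigr do rewrite -pcell_xmarginal.
have tF : trivIset setT (fun u => X @^-1` xcell u).
  apply/trivIsetP => v v' _ _ vv'; apply/seteqP; split => // w [a b].
  by have /eqP := xcell_disj a b; rewrite (negPf vv').
rewrite -(@measure_bigcup_finType _ _ P0 _ xpredT (fun u => X @^-1` xcell u)) //.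
rewrite -(@probability_setT _ _ _ P0); apply/esym.
apply: (@measure_sub_null _ _ (X @^-1` (~` unit_ball d))) => //.
  by apply: (fin_bigcup_measurable finite_finset) => v _; exact: mXu.
move=> w _; case: (pselect (unit_ball d (X w))) => h; last by right.
by left; have [u hu] := xcell_cover h; exists u.
Qed.

Lemma integral_cells_le (f : @Rvec R d -> R) (c : {ffun 'I_d -> 'I_(2 * k).+1} -> R) :
  measurable_fun setT f -> (forall x, 0 <= f x) ->
  (forall u x, xcell u x -> f x <= c u) ->
  (\int[P0]_z (f (X z))%:E <= (\sum_o pcell o * c o.1)%:E)%E.
Proof.
move=> mf f0 fc.
have mfX : measurable_fun setT (EFin \o (f \o X)).
  by apply/measurable_EFinP; exact: measurableT_comp.
have tF : trivIset [set` index_enum {ffun 'I_d -> 'I_(2 * k).+1}] (fun u => X @^-1` xcell u).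
  apply/trivIsetP => v v' _ _ vv'; apply/seteqP; split => // w [a b].
  by have /eqP := xcell_disj a b; rewrite (negPf vv').
set D := \big[setU/set0]_(u <- index_enum {ffun 'I_d -> 'I_(2 * k).+1}) (X @^-1` xcell u).
have mD : measurable D by apply: bigsetU_measurable => u _.
have DE : D = X @^-1` unit_ball d.
  rewrite /D -bigcup_seq; apply/seteqP; split => [w [u _ []//]|w /xcell_cover[u hu]].
  by exists u => //=; rewrite mem_index_enum.
have -> : setT = D `|` (X @^-1` (~` unit_ball d)) by rewrite DE preimage_setC setUv.
rewrite ge0_integral_setU //; first last.
- by rewrite DE; apply/disj_setPS => w [a b]; exact: b.
- by move=> x _; rewrite lee_fin.
- by apply: measurable_funTS.
rewrite [X in (_ + X)%E]null_set_integral //; last by apply: measurable_funTS.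
have uI := index_enum_uniq {ffun 'I_d -> 'I_(2 * k).+1}.
rewrite adde0 ge0_integral_bigsetU //; [|exact: measurable_funTS|by move=> x _; rewrite lee_fin].
have -> : \sum_o pcell o * c o.1 = \sum_u \sum_v pcell (u, v) * c u.
  by rewrite pair_big /=; apply: eq_bigr => -[].
rewrite -sumEFin; apply: lee_sum => u _.
rewrite -mulr_suml EFinM -pcell_xmarginal muleC -integral_cst //.
apply: ge0_le_integral => //.
- by move=> x _; rewrite lee_fin.
- by apply: measurable_funTS.
- by move=> w hw; rewrite lee_fin; exact: fc.
Qed.

(** One [eta] comes from replacing [h] by a constant on the cell in [x], the other from replacing
    the label by a constant on each cell in [y]; in between stands the defining identity of
    [regression_fun] on the cell. *)
Lemma regression_cells (h : 'rV[R]_d -> R) (hu : {ffun 'I_d -> 'I_(2 * k).+1} -> R)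
    (yv : 'I_(2 * k).+1 -> R) (eta : R) :
  regression_fun P0 X Y h ->
  (forall u x, xcell u x -> `|h x - hu u| <= eta) ->
  (forall v y, ycell v y -> `|y - yv v| <= eta) ->
  forall u, `|\sum_v pcell (u, v) * (yv v - hu u)| <= (eta + eta) * \sum_v pcell (u, v).
Proof.
move=> [mh reg] hh hy u.
have := reg _ (measurable_xcell u).
set D := X @^-1` xcell u => e.
have mhX : measurable_fun setT (h \o X) by exact: measurableT_comp.
have [fh ch] := @integral_near_cst R _ _ P0 D (h \o X) (hu u) eta (mXu u)
  (measurable_funTS mhX) (fun w hw => hh _ _ hw).
pose F v := (fun w => (X w, Y w)) @^-1` cell (u, v).
have cv v := @integral_near_cst R _ _ P0 (F v) Y (yv v) eta (mpre (u, v))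
  (measurable_funTS mY) (fun w hw => hy _ _ hw.2).
pose N := D `&` [set w | B < `|Y w|].
have mN : measurable N := measurableI _ _ (mXu u) mYb.
have N0 : P0 N = 0%E.
  apply/eqP; rewrite eq_le measure_ge0 andbT -Y_bound; apply: le_measure.
  - by rewrite inE.
  - by rewrite inE.
  - by move=> w [].
set D' := \big[setU/set0]_(v <- index_enum 'I_(2 * k).+1) F v.
have mD' : measurable D' by apply: bigsetU_measurable => v _; exact: mpre.
have D'E w : D' w <-> D w /\ `|Y w| <= B.
  rewrite /D' -bigcup_seq; split => [[v _ [/= a [b _]]] //|[a /ycell_cover[v hv]]].
  by exists v => //=; rewrite mem_index_enum.
have DE : D = D' `|` N.
  apply/seteqP; split => w.
    by move=> a; case: (leP `|Y w| B) => b; [left; apply/D'E|right].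
  by case=> [/D'E[]|[]].
have mYE : measurable_fun setT (EFin \o Y) by exact/measurable_EFinP.
have eY : (\int[P0]_(w in D) (Y w)%:E = \sum_v \int[P0]_(w in F v) (Y w)%:E)%E.
  rewrite [in LHS]DE integral_setU_EFin //; first last.
  - apply/disj_setPS => w [/D'E[_ a] [_ /=]]; rewrite ltNge a //.
  - by apply: measurable_funTS.
  rewrite [X in (_ + X)%E]null_set_integral //; last by apply: measurable_funTS.
  have uI := index_enum_uniq 'I_(2 * k).+1.
  have mF v : measurable (F v) by exact: mpre.
  have tF : trivIset [set` index_enum 'I_(2 * k).+1] F.
    apply/trivIsetP => v v' _ _ vv'; apply/seteqP; split => // w [a b].
    by have := cell_disj a b => -[] /eqP; rewrite (negPf vv').
  by rewrite adde0 integral_bigsetU_EFin //; exact: measurable_funTS.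
have eR : \sum_v fine (\int[P0]_(w in F v) (Y w)%:E) = fine (\int[P0]_(w in D) (h (X w))%:E).
  apply: EFin_inj; rewrite -sumEFin fineK // -[RHS]e eY.
  by apply: eq_bigr => v _; rewrite fineK //; case: (cv v).
have PD : fine (P0 D) = \sum_v pcell (u, v) by rewrite pcell_xmarginal.
rewrite PD in ch.
have -> : \sum_v pcell (u, v) * (yv v - hu u) =
   (fine (\int[P0]_(w in D) (h (X w))%:E) - hu u * \sum_v pcell (u, v))
   - \sum_v (fine (\int[P0]_(w in F v) (Y w)%:E) - yv v * pcell (u, v)).
  transitivity (\sum_v yv v * pcell (u, v) - hu u * \sum_v pcell (u, v)).
    by rewrite mulr_sumr -sumrB; apply: eq_bigr => v _; ring.
  by rewrite sumrB eR; ring.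
rewrite (le_trans (ler_normB _ _)) // mulrDl lerD //.
rewrite (le_trans (ler_norm_sum _ _ _)) // mulr_sumr; apply: ler_sum => v _.
by case: (cv v).
Qed.

(** Only finitely many cell configurations exist, so any predicate on them pulls back to a
    measurable event whose probability is a finite sum of products. This is the only passage from
    the sample space to the finite model. *)
Lemma good_event (dO : measure_display) (O : measurableType dO) (P : probability O R)
  (n : nat) (Xs : 'I_n -> O -> @Rvec R d) (Ys : 'I_n -> O -> R)
  (good : pred {ffun 'I_n -> Om}) :
  iid_copies P0 X Y P Xs Ys ->
  exists E : set O, [/\ measurable E,
    P E = (\sum_(tau | good tau) \prod_i pcell (tau i))%:E &
    forall w, E w -> exists2 tau, good tau & forall i, cell (tau i) (Xs i w, Ys i w)].
Proof.
move=> [mXs idd ind].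
pose F (tau : {ffun 'I_n -> Om}) :=
  \bigcap_(i in setT) ((fun w => (Xs i w, Ys i w)) @^-1` cell (tau i)).
have mF tau : measurable (F tau).
  apply: (fin_bigcap_measurable finite_finset) => i _; rewrite -[X in measurable X]setTI.
  have [m1 m2] := mXs i.
  have m : measurable_fun setT (fun w => (Xs i w, Ys i w)) by exact: measurable_fun_pair.
  by apply: m => //; exact: measurable_cell.
exists (\bigcup_(tau in [set tau | good tau]) F tau); split.
- by apply: (fin_bigcup_measurable finite_finset) => tau _.
- rewrite measure_bigcup_finType //; last first.
    apply/trivIsetP => t t' _ _ tt'; apply/seteqP; split => // w [a b].
    move/negP: tt'; apply; apply/eqP/ffunP => i.
    exact: cell_disj (a i I) (b i I).
  rewrite -sumEFin; apply: eq_bigr => tau _.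
  apply: etrans (ind (fun i => cell (tau i)) (fun i => measurable_cell _)) _.
  congr (_%:E); apply: eq_bigr => i _; congr fine; apply: idd; exact: measurable_cell.
- by move=> w [tau gt hw]; exists tau => // i; exact: (hw i I).
Qed.

End Joint.
End Discretize.

(** * The finite net of sparse networks *)

Section ErmCore.
Variable R : realType.

(** The constant involves the mass but not the width, so one cell size serves all networks of the
    class. *)
Lemma nn_fun_lip (d N : nat) (M : R) f (x x' : 'rV[R]_d) (delta : R) :
  NN d N M f -> 0 <= delta -> (forall j, `|x 0 j - x' 0 j| <= delta) ->
  `|f x - f x'| <= d%:R * delta * M.
Proof.
move=> [a [w [kM ->]]] d0 hx.
rewrite /nn_fun -sumrB (le_trans (ler_norm_sum _ _ _)) //.
rewrite (le_trans (y := \sum_i (d%:R * delta) * (`|a i| * enorm (w i)))) //; last first.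
  by rewrite -mulr_sumr ler_wpM2l // mulr_ge0.
apply: ler_sum => i _; rewrite -mulrBr normrM mulrCA ler_wpM2l //.
rewrite (le_trans (relu_lip _ _)) // !dotv_ext opprD addrACA subrr addr0.
rewrite dotvC [X in _ - X]dotvC -dotvBr -mulrA [_ * enorm _]mulrC.
apply: dotv_le_coord => j; last by rewrite !mxE.
by rewrite mxE coord_le_enorm.
Qed.

Lemma grid_round (K : nat) (r : R) : (0 < K)%N -> `|r| <= 1 ->
  exists v : 'I_(2 * K).+1, `|r - (v%:R / K%:R - 1)| <= K%:R^-1.
Proof.
move=> K0 r1; have [v /andP[h1 h2]] := grid_index K0 r1; exists v.
have KR : 0 < K%:R :> R by rewrite ltr0n.
rewrite -natr1 in h2.
have -> : r - (v%:R / K%:R - 1) = ((r + 1) * K%:R - v%:R) / K%:R by field; rewrite gt_eqF.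
rewrite normrM normfV (gtr0_norm KR) -[leRHS]mul1r ler_pM2r ?invr_gt0 // ler_norml.
by apply/andP; split; lra.
Qed.

(** After the normalisation of directions all inner coordinates lie in [[-1, 1]], and outer weights
    are at most [M] since a direction on the cube has norm at least [1]. Both are put on a grid of
    mesh [1 / K]; the slot [ord_max] holds the outer weight in units of [M]. *)
Definition net_index (d N K : nat) := {ffun 'I_N -> {ffun 'I_d.+2 -> 'I_(2 * K).+1}}.

Definition net_fun (d N K : nat) (M : R) (k : net_index d N K) (x : 'rV[R]_d) : R :=
  \sum_i (M * ((k i ord_max)%:R / K%:R - 1)) *
    relu (dotv (ext x) (\row_j ((k i (lift ord_max j))%:R / K%:R - 1))).

Lemma card_net_index d N K : #|{: net_index d N K}| = ((2 * K).+1 ^ (d.+2 * N))%N.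
Proof. by rewrite !card_ffun !card_ord expnM. Qed.

Lemma net_fun_cover (d N K : nat) (M : R) (f : 'rV[R]_d -> R) :
  (0 < K)%N -> 0 <= M -> NN d N M f ->
  exists k : net_index d N K, forall x, unit_ball d x ->
    `|f x - net_fun M k x| <= 2 * N%:R * M * d.+1%:R / K%:R.
Proof.
move=> K0 M0 [a0 [w [kM ->]]].
have KR : 0 < K%:R :> R by rewrite ltr0n.
have [p hp] := choice (fun i => @normalize_direction R d (w i)).
pose v i := (p i).1.2; pose a i := a0 i * (p i).1.1.
have v1 i j : `|v i 0 j| <= 1 by have [_ _ h _] := hp i.
have val x : nn_fun a0 w x = \sum_i a i * relu (dotv (ext x) (v i)).
  apply: eq_bigr => i _; have [c0 wE _ _] := hp i.
  by rewrite [in LHS]wE dotvZr reluZ // /a mulrA.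
have aM i : `|a i| <= M.
  apply: le_trans kM; rewrite /kappa (bigD1 i) //=.
  rewrite -[leLHS]addr0 lerD //; last by apply: sumr_ge0 => j _; rewrite mulr_ge0 ?enorm_ge0.
  have [c0 wE _ vf] := hp i; rewrite wE enormZ // /a normrM (ger0_norm c0).
  rewrite ler_wpM2l // ler_peMr //; apply: le_trans (coord_le_enorm _ (p i).2).
  by rewrite -(@ler_pXn2r _ 2) ?nnegrE // expr1n real_normK ?num_real // expr2 vf.
have /choice[al hal] : forall i, exists u : 'I_(2 * K).+1,
    `|a i - M * (u%:R / K%:R - 1)| <= M / K%:R.
  move=> i.
  have [M00|Mn0] := eqVneq M 0.
    exists ord0; have := aM i; rewrite M00 normr_le0 => /eqP ->.
    by rewrite !mul0r subr0 normr0.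
  have Mp : 0 < M by rewrite lt_neqAle eq_sym Mn0.
  have [u hu] := @grid_round K (a i / M) K0 ltac:(by rewrite normrM normfV (gtr0_norm Mp) ler_pdivrMr // mul1r).
  exists u; have -> : a i - M * (u%:R / K%:R - 1) = M * (a i / M - (u%:R / K%:R - 1)).
    by rewrite [RHS]mulrBr; congr (_ - _); rewrite mulrCA divff // mulr1.
  by rewrite normrM (gtr0_norm Mp) ler_pM2l.
have /choice[be hbe] : forall i, exists b : 'I_d.+1 -> 'I_(2 * K).+1,
    forall j, `|v i 0 j - ((b j)%:R / K%:R - 1)| <= K%:R^-1.
  move=> i.
  have /choice[b hb] : forall j, exists b : 'I_(2 * K).+1,
    `|v i 0 j - (b%:R / K%:R - 1)| <= K%:R^-1 by move=> j; exact: grid_round.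
  by exists b.
pose k : net_index d N K := [ffun i => [ffun j => if unlift ord_max j is Some j' then be i j' else al i]].
exists k => x xb; rewrite val /net_fun -sumrB (le_trans (ler_norm_sum _ _ _)) //.
rewrite (le_trans (y := \sum_(i < N) (2 * M * d.+1%:R / K%:R))) //; last first.
  by rewrite sumr_const card_ord -[leLHS]mulr_natl le_eqVlt; apply/orP; left; apply/eqP; ring.
apply: ler_sum => i _.
have -> : (k i ord_max) = al i by rewrite !ffunE unlift_none.
have -> : \row_j ((k i (lift ord_max j))%:R / K%:R - 1) = \row_j ((be i j)%:R / K%:R - 1) :> 'rV[R]_d.+1.
  by apply/rowP => j; rewrite !mxE !ffunE liftK.
set a' := M * _; set v' := \row_j _.
have e1 j : `|ext x 0 j| <= 1 by exact: ext_coord_le1.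
have -> : a i * relu (dotv (ext x) (v i)) - a' * relu (dotv (ext x) v') =
  (a i - a') * relu (dotv (ext x) (v' )) + a i * (relu (dotv (ext x) (v i)) - relu (dotv (ext x) v')).
  by ring.
rewrite (le_trans (ler_normD _ _)) // (normrM (a i - a')) (normrM (a i)).
have v'1 j : `|v' 0 j| <= 1.
  rewrite mxE ler_norml; have hb : (be i j)%:R <= 2 * K%:R :> R.
    by rewrite -natrM ler_nat -ltnS.
  have : (be i j)%:R / K%:R <= 2 :> R by rewrite ler_pdivrMr.
  have : 0 <= (be i j)%:R / K%:R :> R by rewrite divr_ge0 // ltW.
  by move=> ? ?; apply/andP; split; lra.
have r1 : `|relu (dotv (ext x) v')| <= d.+1%:R.
  rewrite -[relu _]subr0 -(relu_neg (lexx 0)) (le_trans (relu_lip _ _)) // subr0.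
  by rewrite (le_trans (dotv_le_coord e1 v'1)) // !mulr1.
have r2 : `|relu (dotv (ext x) (v i)) - relu (dotv (ext x) v')| <= d.+1%:R * K%:R^-1.
  rewrite (le_trans (relu_lip _ _)) // -dotvBr -[K%:R^-1]mul1r.
  by apply: dotv_le_coord => // j; rewrite !mxE.
have s1 := ler_pM (normr_ge0 _) (normr_ge0 _) (hal i) r1.
have s2 := ler_pM (normr_ge0 _) (normr_ge0 _) (aM i) r2.
apply: (le_trans (lerD s1 s2)); rewrite le_eqVlt; apply/orP; left; apply/eqP.
by field; rewrite gt_eqF.
Qed.

Lemma NN_widen (d N N' : nat) (M : R) f : (N <= N')%N -> NN d N M f -> NN d N' M f.
Proof.
move=> NN' [a [w [kM ->]]].
pose s := [seq (a i, w i) | i <- enum 'I_N].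
have -> : nn_fun a w = seq_net s.
  by apply/funext => x; rewrite /seq_net big_map big_enum.
apply: seq_net_NN; first by rewrite size_map size_enum_ord.
by rewrite /seq_mass big_map big_enum.
Qed.

Lemma sqr_diff_le (a b c : R) (x : R) : `|a| <= c -> `|b| <= c -> `|a - b| <= x ->
  a ^+ 2 <= b ^+ 2 + 2 * c * x.
Proof.
move=> ac bc abx; rewrite -lerBlDl subr_sqr (le_trans (ler_norm _)) // normrM mulrC.
by apply: ler_pM => //; rewrite (le_trans (ler_normD _ _)) //; lra.
Qed.

End ErmCore.

(** * The oracle inequality *)

Section ErmBound.
Variable R : realType.

Definition sparse_cost (d m : nat) (M : R) : R :=
  let N := (sparse_const d * m ^ d)%N in
  12 * d.+3%:R ^+ 5 * d.+1%:R ^+ 2 * M ^+ 2 / m%:R ^+ 3 * (4 * (ln N%:R / N%:R)).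

Lemma sparse_cost_ge0 d m M : 0 <= sparse_cost d m M.
Proof.
rewrite /sparse_cost; have ln0' k : 0 <= ln k%:R :> R.
  by case: k => [|k]; [rewrite ln0|rewrite ln_ge0 // ler1n].
apply: mulr_ge0; last by rewrite mulr_ge0 // divr_ge0.
by rewrite divr_ge0 ?exprn_ge0 // mulr_ge0 ?sqr_ge0 // mulr_ge0 ?exprn_ge0 // mulr_ge0 ?exprn_ge0.
Qed.

(** The linear arithmetic closing [erm_core], isolated from its large terms. [S1] and [S3] are the
    losses of the net element and of the approximant on the rounded sample, [S4], [S5], [S6] those
    of the pruned estimator, the approximant and the estimator on the true sample, [S7] is the
    distance made by pruning, and [i] is [1 / n]. *)
Lemma erm_risk_arith (rk B b KK t i S1 S2 S3 S4 S5 S6 S7 A dl eps : R) :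
  rk / 2 - 2 * (B + b) * i - 4 * KK * (t * i) < S1 - S2 * i ->
  S3 - S2 * i < 2 * eps ^+ 2 + 2 * eps * i + 4 * KK * (t * i) ->
  S1 <= S4 + 8 * B * i -> S5 <= S3 + 2 * A * i -> S6 <= S5 + dl -> 0 <= S7 ->
  S4 + S7 <= S6 + 2 * dl -> b * i <= A * i ->
  rk <= 4 * eps ^+ 2 + 6 * dl + 16 * KK * (t * i) + (4 * eps + 20 * B + 8 * A) * i.
Proof. lra. Qed.

Lemma exists_nat_ge (x : R) : exists2 k, (0 < k)%N & x <= k%:R.
Proof.
exists (Num.truncn `|x|).+1 => //; rewrite (le_trans (ler_norm _)) // ltW //.
by have /andP[] := truncn_itv (normr_ge0 x).
Qed.

(* The estimator is compared, for the same sample, with sparsifications of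
   itself and of the approximant [g0]; both are quadratic-loss controlled by
   [sparsify_NN], so only the finite net of sparse networks needs a
   concentration bound, whatever the width [Nn]. *)
Lemma erm_core (d : nat) (B b eps M t : R) (m n Nn N' K : nat)
    (dO0 : measure_display) (O0 : measurableType dO0) (P0 : probability O0 R)
    (X : O0 -> @Rvec R d) (Y : O0 -> R) (h g0 : 'rV[R]_d -> R)
    (dO : measure_display) (O : measurableType dO) (P : probability O R)
    (Xs : 'I_n -> O -> @Rvec R d) (Ys : 'I_n -> O -> R) :
  0 < B -> 0 <= b -> 0 <= eps -> 0 <= M -> 0 <= t ->
  (0 < m)%N -> (0 < n)%N -> (0 < K)%N ->
  measurable_fun setT X -> measurable_fun setT Y ->
  P0 (X @^-1` (~` unit_ball d)) = 0%E -> P0 [set w | B < `|Y w|] = 0%E ->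
  regression_fun P0 X Y h ->
  (forall x, unit_ball d x -> `|h x| <= b) ->
  (forall e : R, 0 < e -> exists2 del : R, 0 < del & forall x x',
     unit_ball d x -> unit_ball d x' -> (forall j, `|x 0 j - x' 0 j| <= del) ->
     `|h x - h x'| <= e) ->
  NN d N' M g0 -> (forall x, unit_ball d x -> `|g0 x - h x| <= eps) ->
  (sparse_const d * m ^ d <= Nn)%N ->
  2 * (sparse_const d * m ^ d)%:R * M * d.+1%:R / K%:R <= n%:R^-1 ->
  iid_copies P0 X Y P Xs Ys ->
  exists E : set O, [/\ measurable E,
    ((1 - (((2 * K).+1 ^ (d.+2 * (sparse_const d * m ^ d)))%:R + 1) * expR (- t))%:E <= P E)%E &
    forall w, E w -> forall f, NN d Nn M f ->
      (forall g, NN d Nn M g ->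
         emp_risk (fun i => Xs i w) (fun i => Ys i w) f
         <= emp_risk (fun i => Xs i w) (fun i => Ys i w) g) ->
      (\int[P0]_z ((truncB B (f (X z)) - h (X z)) ^+ 2)%:E
        <= (1000 * (B + b + eps + 1) ^+ 2 *
            (sparse_cost d m M + eps ^+ 2 + (t + 1) / n%:R))%:E)%E].
Proof.
move=> B0 b0 eps0 M0 t0 m0 n0 K0 mX mY Xb Yb reg hb huc g0N g0h NNn hK iid.
set N := (sparse_const d * m ^ d)%N in NNn hK *.
have nR : 0 < n%:R :> R by rewrite ltr0n.
have in0 : 0 < n%:R^-1 :> R by rewrite invr_gt0.
have [del del0 hdel] := huc (n%:R^-1 / 2) ltac:(lra).
(* The cells are so fine that [h], the labels and every network of mass [M] vary by at most [1 / n]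
   on each. Their number [k] enters neither the probability nor the risk bound. *)
have [k k0 hk] := exists_nat_ge (del^-1 + (1 + B) * (n%:R * (d%:R * M + 1) + 2 * n%:R)).
have kR : 0 < k%:R :> R by rewrite ltr0n.
have dM0 : 0 <= d%:R * M by rewrite mulr_ge0.
have idel : 0 < del^-1 by rewrite invr_gt0.
have q1 : 0 <= (1 + B) * (n%:R * (d%:R * M + 1)) by rewrite !mulr_ge0 //; lra.
have q2 : 0 <= (1 + B) * (2 * n%:R) by rewrite !mulr_ge0 //; lra.
rewrite mulrDr in hk.
have k1 : k%:R^-1 <= del by rewrite -[leRHS]invrK lef_pV2 ?posrE //; lra.
have k2 : (1 + B) / k%:R * (d%:R * M + 1) <= n%:R^-1.
  rewrite mulrAC ler_pdivrMr // -(@ler_pM2l _ n%:R) // [leRHS]mulrA divff ?gt_eqF // mul1r.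
  by rewrite mulrCA; lra.
have k3 : (1 + B) / k%:R <= n%:R^-1 / 2.
  rewrite ler_pdivrMr // -ler_pdivrMl ?divr_gt0 //.
  by rewrite invf_div invrK; lra.
have ik0 : 0 < k%:R^-1 :> R by rewrite invr_gt0.
pose U := {ffun 'I_d -> 'I_(2 * k).+1}; pose V := 'I_(2 * k).+1.
have ball0 : unit_ball d (0 : 'rV[R]_d).
  by rewrite /unit_ball /= /enorm /dotv big1 ?sqrtr0 // => i _; rewrite mxE mul0r.
have ex_xu : forall u : U, exists x : 'rV[R]_d,
    unit_ball d x /\ ((exists x', @xcell R d k u x') -> @xcell R d k u x).
  move=> u; case: (pselect (exists x', @xcell R d k u x')) => [[x hx]|hn].
    by exists x; split => //; case: hx.
  by exists 0.
have [xu hxu] := choice ex_xu.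
have ex_yv : forall v : V, exists y : R, `|y| <= B /\ ((exists y', ycell B v y') -> ycell B v y).
  move=> v; case: (pselect (exists y', ycell B v y')) => [[y hy]|hn].
    by exists y; split => //; case: hy.
  by exists 0; rewrite normr0; split => //; exact: ltW.
have [yv hyv] := choice ex_yv.
pose hu u := h (xu u).
pose p := @pcell R d B k _ _ P0 X Y.
have xc u x j : @xcell R d k u x -> `|x 0 j - xu u 0 j| <= k%:R^-1.
  by move=> hx; apply: (xcell_close k0 j hx); apply: (hxu u).2; exists x.
have yc v y : ycell B v y -> `|y - yv v| <= B / k%:R.
  by move=> hy; apply: (ycell_close B0 k0 hy); apply: (hyv v).2; exists y.
have hc u x : @xcell R d k u x -> `|h x - hu u| <= n%:R^-1 / 2.
  move=> hx; apply: hdel; [by case: hx|exact: (hxu u).1|].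
  by move=> j; apply: le_trans (xc _ _ _ hx) k1.
have Bk : B / k%:R <= n%:R^-1 / 2.
  by rewrite (le_trans _ k3) // ler_pM2r //; move: B0; clear; lra.
have pge := @pcell_ge0 R d B k _ _ P0 X Y.
have psum : \sum_o p o = 1 := pcell_sum1 B0 k0 mX mY Xb Yb.
have preg u : `|\sum_v p (u, v) * (yv v - hu u)| <= n%:R^-1 * \sum_v p (u, v).
  have := @regression_cells R d B k B0 k0 _ _ P0 X Y mX mY Yb h hu yv (n%:R^-1 / 2) reg hc.
  move=> /(_ (fun v y hy => le_trans (yc v y hy) Bk) u).
  by rewrite (_ : n%:R^-1 / 2 + n%:R^-1 / 2 = n%:R^-1); last by clear; lra.
pose A := B + b + eps + 1.
have A1 : 1 <= A by move: B0 b0 eps0; rewrite /A; clear; lra.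
pose KK := (3 * A) ^+ 2.
have hul u : `|hu u| <= b by apply: hb; exact: (hxu u).1.
have yvl v : `|yv v| <= B by exact: (hyv v).1.
pose phi (q : net_index d N K) (u : U) := truncB B (net_fun M q (xu u)).
have phiB q u : `|phi q u| <= B by apply: truncB_bound; exact: ltW.
pose Sbad q (tau : {ffun 'I_n -> U * V}) := \sum_i excess hu yv (phi q) (tau i) <=
  n%:R * (risk p hu (phi q) / 2 - 2 * (B + b) * n%:R^-1) - 4 * KK * t.
pose gu u := g0 (xu u).
pose Gbad (tau : {ffun 'I_n -> U * V}) :=
  n%:R * (2 * eps ^+ 2 + 2 * eps * n%:R^-1) + 4 * KK * t <= \sum_i excess hu yv gu (tau i).
pose good (tau : {ffun 'I_n -> U * V}) := ~~ Gbad tau && [forall q, ~~ Sbad q tau].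
have [E [mE PE hE]] := @good_event R d B k _ _ P0 X Y _ _ P n Xs Ys good iid.
exists E; split => //.
  rewrite PE lee_fin -/p.
  have tot : \sum_(tau : {ffun 'I_n -> U * V}) \prod_i p (tau i) = 1.
    by rewrite -(bigA_distr_bigA (fun (_ : 'I_n) o => p o)) /= psum prodr_const expr1n.
  have pr0 (tau : {ffun 'I_n -> U * V}) : 0 <= \prod_i p (tau i).
    by apply: prodr_ge0 => i _; exact: pge.
  have tot2 : \sum_(tau | good tau) \prod_i p (tau i) = 1 - \sum_(tau | ~~ good tau) \prod_i p (tau i).
    have e := tot; rewrite (bigID good) /= in e.
    by apply/eqP; rewrite -subr_eq0 opprB addrA e subrr.
  rewrite tot2 lerD2l lerN2.
  have hG : \sum_(tau | Gbad tau) \prod_i p (tau i) <= expR (- t).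
    apply: (@excess_upper_tail R U V p hu yv B b n%:R^-1) => //; try exact: ltW.
    - by move=> u; apply: g0h; exact: (hxu u).1.
    - have w1 : 0 <= eps + 2 * B + 2 * b + 1 by move: B0 b0 eps0; clear; lra.
      have w2 : 0 <= 3 * A by move: A1; clear; lra.
      by rewrite /KK ler_pXn2r ?nnegrE //; move: B0 b0 eps0; rewrite /A; clear; lra.
  have hS q : \sum_(tau | Sbad q tau) \prod_i p (tau i) <= expR (- t).
    apply: (@excess_lower_tail R U V p hu yv B b n%:R^-1) => //; try exact: ltW.
    have w1 : 0 <= 3 * B + b + 1 by move: B0 b0; clear; lra.
    have w2 : 0 <= 3 * A by move: A1; clear; lra.
    by rewrite /KK ler_pXn2r ?nnegrE //; move: B0 b0 eps0; rewrite /A; clear; lra.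
  apply: (@le_trans _ _ (\sum_(q : net_index d N K) \sum_(tau | Sbad q tau) \prod_i p (tau i) +
     \sum_(tau | Gbad tau) \prod_i p (tau i))).
    rewrite (exchange_big_dep xpredT) //= [X in _ <= _ + X]big_mkcond /= -big_split /=.
    rewrite big_mkcond /=; apply: ler_sum => tau _.
    have s0 : 0 <= \sum_(q | Sbad q tau) \prod_i p (tau i) by apply: sumr_ge0.
    case: ifPn => hg; last by rewrite addr_ge0 //; case: ifP.
    move: hg; rewrite /good negb_and negbK => /orP[->|]; first by rewrite lerDr.
    rewrite negb_forall => /existsP[q]; rewrite negbK => hq.
    rewrite (bigD1 q) //= -addrA lerDl addr_ge0 //; first exact: sumr_ge0.
    by case: ifP.
  rewrite mulrDl mul1r lerD // (le_trans (y := \sum_(q : net_index d N K) expR (- t))) //.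
    by apply: ler_sum => q _; exact: hS.
  by rewrite sumr_const card_net_index mulr_natl.
move=> w Ew f fN fmin.
have [tau gt htau] := hE w Ew.
pose xs i : 'rV[R]_d := Xs i w; pose ys i := Ys i w.
have xsb i : unit_ball d (xs i) by case: (htau i) => -[].
have ysB i : `|ys i| <= B by case: (htau i) => _ [].
have xst i j : `|xs i 0 j - xu (tau i).1 0 j| <= k%:R^-1 by case: (htau i) => /(xc _ _ j).
have yst i : `|ys i - yv (tau i).2| <= B / k%:R by case: (htau i) => _ /yc.
have lipk N1 g (x x' : 'rV[R]_d) : NN d N1 M g -> (forall j, `|x 0 j - x' 0 j| <= k%:R^-1) ->
    `|g x - g x'| <= d%:R * M / k%:R.
  move=> gN hx; rewrite mulrAC; exact: nn_fun_lip gN (ltW ik0) hx.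
have om : d%:R * M / k%:R + B / k%:R <= n%:R^-1.
  apply: le_trans k2; rewrite -mulrDl mulrAC ler_pM2r //.
  have : 0 <= B * (d%:R * M) by rewrite mulr_ge0 // ltW.
  by move: B0; rewrite mulrDl mul1r mulrDr mulr1; clear; lra.
have Bk0 : 0 <= B / k%:R by rewrite divr_ge0 // ltW.
have dMk0 : 0 <= d%:R * M / k%:R by rewrite divr_ge0 // ltW.
set dl := sparse_cost d m M.
have dl0 : 0 <= dl by exact: sparse_cost_ge0.
have empE g : emp_risk (fun i => Xs i w) (fun i => Ys i w) g =
   \sum_(i < n) n%:R^-1 * (g (xs i) - ys i) ^+ 2.
  by rewrite /emp_risk mulr_sumr.
have sumn : \sum_(i < n) n%:R^-1 = 1 :> R.
  by rewrite sumr_const card_ord -[LHS]mulr_natl mulfV // gt_eqF.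
(* The width of the approximant is unrelated to [Nn], so it is pruned on the sample before the
   minimality of [f] is used. *)
have [g1 g1N g1l] := @sparsify_NN R d 'I_n xs (fun _ => n%:R^-1) ys N' m M g0
  (fun _ => ltW in0) xsb m0 g0N.
rewrite sumn mulr1 -/N -/dl in g1l.
have e1 : \sum_(i < n) n%:R^-1 * (f (xs i) - ys i) ^+ 2 <=
   \sum_(i < n) n%:R^-1 * (g0 (xs i) - ys i) ^+ 2 + dl.
  by apply: le_trans g1l; rewrite -!empE; apply: fmin; exact: NN_widen g1N.
(* On the cells the labels are the values of [f] itself, where [f] has loss zero. The pruned network
   [ft] thus stays near [f] under the discretised law while its empirical loss hardly grows; the
   total weight is [2], hence [2 * dl]. *)
pose T2 := ('I_n + U * V)%type.
pose x2 (z : T2) := match z with inl i => xs i | inr o => xu o.1 end.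
pose nu2 (z : T2) := match z with inl i => n%:R^-1 | inr o => p o end.
pose y2 (z : T2) := match z with inl i => ys i | inr o => f (xu o.1) end.
have [ft ftN ftl] := @sparsify_NN R d T2 x2 nu2 y2 Nn m M f
  ltac:(by case=> [i|o] /=; [exact: ltW|exact: pge])
  ltac:(by case=> [i|o] /=; [exact: xsb|exact: (hxu _).1]) m0 fN.
rewrite !big_sumType /= sumn psum in ftl.
have z0 : \sum_(o : U * V) p o * (f (xu o.1) - f (xu o.1)) ^+ 2 = 0.
  by apply: big1 => o _; rewrite subrr expr0n mulr0.
rewrite z0 addr0 in ftl.
have ftl' : \sum_(i < n) n%:R^-1 * (ft (xs i) - ys i) ^+ 2 +
    \sum_o p o * (ft (xu o.1) - f (xu o.1)) ^+ 2 <=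
    \sum_(i < n) n%:R^-1 * (f (xs i) - ys i) ^+ 2 + 2 * dl.
  apply: le_trans ftl _; rewrite lerD2l /dl /sparse_cost -/N le_eqVlt; apply/orP; left; apply/eqP.
  by ring.
have e2 : \sum_(i < n) n%:R^-1 * (f (xs i) - ys i) ^+ 2 <=
    \sum_(i < n) n%:R^-1 * (ft (xs i) - ys i) ^+ 2.
  by rewrite -!empE; apply: fmin; exact: NN_widen ftN.
have e3 : 0 <= \sum_o p o * (ft (xu o.1) - f (xu o.1)) ^+ 2.
  by apply: sumr_ge0 => o _; rewrite mulr_ge0 ?sqr_ge0 //; exact: pge.
have [q hq] := @net_fun_cover R d N K M ft K0 M0 ftN.
have hq' x : unit_ball d x -> `|ft x - net_fun M q x| <= n%:R^-1.
  by move=> xb; exact: le_trans (hq x xb) hK.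
have s1 : \sum_(i < n) n%:R^-1 * (phi q (tau i).1 - yv (tau i).2) ^+ 2 <=
    \sum_(i < n) n%:R^-1 * (ft (xs i) - ys i) ^+ 2 + 8 * B * n%:R^-1.
  rewrite -[X in _ <= _ + X]mul1r -{3}sumn mulr_suml -big_split /=.
  apply: ler_sum => i _; rewrite -mulrDr ler_pM2l //.
  have c1 : `|phi q (tau i).1 - yv (tau i).2| <= 2 * B.
    by rewrite (le_trans (ler_normB _ _)) //; have := phiB q (tau i).1; have := yvl (tau i).2; clear; lra.
  have c2 : `|truncB B (ft (xs i)) - ys i| <= 2 * B.
    by rewrite (le_trans (ler_normB _ _)) //; have := truncB_bound (ft (xs i)) (ltW B0); have := ysB i; clear; lra.
  have c3 : `|phi q (tau i).1 - yv (tau i).2 - (truncB B (ft (xs i)) - ys i)| <= 2 * n%:R^-1.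
    have -> : phi q (tau i).1 - yv (tau i).2 - (truncB B (ft (xs i)) - ys i) =
       (phi q (tau i).1 - truncB B (ft (xs i))) + (ys i - yv (tau i).2) by ring.
    rewrite (le_trans (ler_normD _ _)) //.
    have c4 : `|phi q (tau i).1 - truncB B (ft (xs i))| <= n%:R^-1 + d%:R * M / k%:R.
      rewrite (le_trans (truncB_lip _ _ (ltW B0))) //.
      have -> : net_fun M q (xu (tau i).1) - ft (xs i) =
        - (ft (xu (tau i).1) - net_fun M q (xu (tau i).1)) - (ft (xs i) - ft (xu (tau i).1)) by ring.
      rewrite (le_trans (ler_normB _ _)) // normrN lerD //; first exact: hq' (hxu _).1.
      exact: lipk ftN (xst i).
    by have := yst i; move: c4 om; clear; lra.
  have c5 := sqr_diff_le c1 c2 c3.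
  apply: le_trans c5 _; rewrite (_ : 2 * (2 * B) * (2 * n%:R^-1) = 8 * B / n%:R); last by ring.
  rewrite lerD2r -[leLHS]real_normK ?num_real // -[leRHS]real_normK ?num_real //.
  by rewrite ler_pXn2r ?nnegrE //; exact: truncB_contract.
have s2 : \sum_(i < n) n%:R^-1 * (g0 (xs i) - ys i) ^+ 2 <=
    \sum_(i < n) n%:R^-1 * (gu (tau i).1 - yv (tau i).2) ^+ 2 + 2 * A * n%:R^-1.
  rewrite -[X in _ <= _ + X]mul1r -{3}sumn mulr_suml -big_split /=.
  apply: ler_sum => i _; rewrite -mulrDr ler_pM2l //.
  have gA x : unit_ball d x -> `|g0 x| <= b + eps.
    move=> xb; rewrite -[g0 x](subrK (h x)) addrC (le_trans (ler_normD _ _)) // lerD //.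
      exact: hb.
    exact: g0h.
  apply: sqr_diff_le.
  - by rewrite (le_trans (ler_normB _ _)) //; have := gA _ (xsb i); have := ysB i; rewrite /A; clear; lra.
  - by rewrite (le_trans (ler_normB _ _)) //; have := gA _ (hxu (tau i).1).1; have := yvl (tau i).2; rewrite /gu /A; clear; lra.
  - have -> : g0 (xs i) - ys i - (gu (tau i).1 - yv (tau i).2) =
       (g0 (xs i) - gu (tau i).1) - (ys i - yv (tau i).2) by ring.
    rewrite (le_trans (ler_normB _ _)) //.
    have := yst i; have := lipk _ _ _ _ g0N (xst i); move: om; rewrite /gu; clear; lra.
case/andP: gt => hG /forallP /(_ q) hS.
rewrite -ltNge in hG; rewrite -ltNge in hS.
have x1 : \sum_i excess hu yv (phi q) (tau i) =
   n%:R * (\sum_(i < n) n%:R^-1 * (phi q (tau i).1 - yv (tau i).2) ^+ 2) - \sum_(i < n) (hu (tau i).1 - yv (tau i).2) ^+ 2.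
  rewrite mulr_sumr -sumrB; apply: eq_bigr => i _.
  by rewrite /excess mulrA divff ?gt_eqF // mul1r.
have x2' : \sum_i excess hu yv gu (tau i) =
   n%:R * (\sum_(i < n) n%:R^-1 * (gu (tau i).1 - yv (tau i).2) ^+ 2) - \sum_(i < n) (hu (tau i).1 - yv (tau i).2) ^+ 2.
  rewrite mulr_sumr -sumrB; apply: eq_bigr => i _.
  by rewrite /excess mulrA divff ?gt_eqF // mul1r.
rewrite x1 in hS; rewrite x2' in hG.
move: hS hG s1 s2 e1 e2 e3 ftl'.
set S1 := \sum_(i < n) n%:R^-1 * (phi q (tau i).1 - yv (tau i).2) ^+ 2.
set S2 := \sum_(i < n) (hu (tau i).1 - yv (tau i).2) ^+ 2.
set S3 := \sum_(i < n) n%:R^-1 * (gu (tau i).1 - yv (tau i).2) ^+ 2.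
set S4 := \sum_(i < n) n%:R^-1 * (ft (xs i) - ys i) ^+ 2.
set S5 := \sum_(i < n) n%:R^-1 * (g0 (xs i) - ys i) ^+ 2.
set S6 := \sum_(i < n) n%:R^-1 * (f (xs i) - ys i) ^+ 2.
set S7 := \sum_o p o * (ft (xu o.1) - f (xu o.1)) ^+ 2.
set rk := risk p hu (phi q).
move=> hS hG s1 s2 e1 e2 e3 ftl'.
have rkb : rk <= 4 * eps ^+ 2 + 6 * dl + 16 * KK * (t / n%:R) + (4 * eps + 20 * B + 8 * A) / n%:R.
  have hS' : rk / 2 - 2 * (B + b) * n%:R^-1 - 4 * KK * (t / n%:R) < S1 - S2 / n%:R.
    rewrite -(@ltr_pM2l _ n%:R) // [ltRHS]mulrBr [ltLHS]mulrBr.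
    rewrite (_ : n%:R * (S2 / n%:R) = S2); last by rewrite mulrC divfK // gt_eqF.
    rewrite (_ : n%:R * (4 * KK * (t / n%:R)) = 4 * KK * t); last by field; rewrite gt_eqF.
    exact: hS.
  have hG' : S3 - S2 / n%:R < 2 * eps ^+ 2 + 2 * eps * n%:R^-1 + 4 * KK * (t / n%:R).
    rewrite -(@ltr_pM2l _ n%:R) // [ltRHS]mulrDr [ltLHS]mulrBr.
    rewrite (_ : n%:R * (S2 / n%:R) = S2); last by rewrite mulrC divfK // gt_eqF.
    rewrite (_ : n%:R * (4 * KK * (t / n%:R)) = 4 * KK * t); last by field; rewrite gt_eqF.
    exact: hG.
  have bA : b <= A by move: B0 eps0; rewrite /A; clear; lra.
  exact: (erm_risk_arith hS' hG' s1 s2 e1 e3 ftl' (ler_wpM2r (ltW in0) bA)).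
(* The difference is [a1 + a2 + a3 + a4], with [a1] from rounding, [a2] from pruning, [a3] from the
   net and [a4] the deviation of the net element from [h]. The weights are [2] for [a1] and [6] for
   the others, and [14 = 2 * 4 + 6] as [a1] is at most [2 / n] and [a3] at most [1 / n]. *)
have tb : (\int[P0]_z ((truncB B (f (X z)) - h (X z)) ^+ 2)%:E <=
   (\sum_o p o * (6 * (ft (xu o.1) - f (xu o.1)) ^+ 2 + 6 * (phi q o.1 - hu o.1) ^+ 2 + 14 * n%:R^-1 ^+ 2))%:E)%E.
  apply: (@integral_cells_le R d B k B0 k0 _ _ P0 X Y mX mY Xb Yb
    (fun x => (truncB B (f x) - h x) ^+ 2)
    (fun u => 6 * (ft (xu u) - f (xu u)) ^+ 2 + 6 * (phi q u - hu u) ^+ 2 + 14 * n%:R^-1 ^+ 2)).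
  - apply: measurable_funX; apply: measurable_funB; last by case: reg.
    by apply: measurable_truncB; [exact: ltW|exact: measurable_NN fN].
  - by move=> x; exact: sqr_ge0.
  - move=> u x hx.
    have c1 : `|truncB B (f x) - truncB B (f (xu u))| <= n%:R^-1.
      rewrite (le_trans (truncB_lip _ _ (ltW B0))) //.
      by have := lipk _ _ _ _ fN (fun j => xc _ _ j hx); move: om Bk0; clear; lra.
    have c2 := hc _ _ hx.
    have c3 : `|truncB B (f (xu u)) - truncB B (ft (xu u))| <= `|ft (xu u) - f (xu u)|.
      by rewrite [leRHS]distrC; apply: truncB_lip; exact: ltW.
    have c4 : `|truncB B (ft (xu u)) - phi q u| <= n%:R^-1.
      by rewrite (le_trans (truncB_lip _ _ (ltW B0))) //; apply: hq'; exact: (hxu u).1.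
    have sq (a c : R) : `|a| <= c -> a ^+ 2 <= c ^+ 2.
      move=> ac; rewrite -[leLHS]real_normK ?num_real // ler_pXn2r ?nnegrE //.
      exact: le_trans ac.
    have d1 : `|(truncB B (f x) - truncB B (f (xu u))) - (h x - hu u)| <= 2 * n%:R^-1.
      by rewrite (le_trans (ler_normB _ _)) //; move: c1 c2 in0; clear; lra.
    have q1' := sq _ _ d1; have q4 := sq _ _ c4.
    have q3 : (truncB B (f (xu u)) - truncB B (ft (xu u))) ^+ 2 <= (ft (xu u) - f (xu u)) ^+ 2.
      by rewrite -[leRHS]real_normK ?num_real //; exact: sq.
    move: q1' q3 q4.
    set a1 := _ - _ - _; set a2 := truncB B (f (xu u)) - _; set a3 := truncB B (ft (xu u)) - _.
    have -> : truncB B (f x) - h x = a1 + (a2 + a3 + (phi q u - hu u)).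
      by rewrite /a1 /a2 /a3; ring.
    move: (phi q u - hu u) => a4 q1' q3 q4.
    have := sqr_ge0 (a1 - (a2 + a3 + a4)).
    have := sqr_ge0 (a2 - a3); have := sqr_ge0 (a2 - a4); have := sqr_ge0 (a3 - a4).
    rewrite exprMn in q1'; move: q1' q3 q4.
    set ii := n%:R^-1 ^+ 2; set fq := (ft _ - _) ^+ 2; rewrite !expr2; clear; lra.
apply: le_trans tb _; rewrite lee_fin.
have -> : \sum_o p o * (6 * (ft (xu o.1) - f (xu o.1)) ^+ 2 + 6 * (phi q o.1 - hu o.1) ^+ 2 + 14 * n%:R^-1 ^+ 2) =
   6 * S7 + 6 * rk + 14 * n%:R^-1 ^+ 2.
  rewrite /S7 /rk /risk !mulr_sumr -[X in _ = _ + X]mul1r -psum mulr_suml -!big_split /=.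
  by apply: eq_bigr => o _; ring.
(* Minimality of [f] makes the empirical loss of [ft] at least that of [f], so the whole pruning
   budget bounds the distance. *)
have S7b : S7 <= 2 * dl by move: e2 ftl'; clear; lra.
have in1 : n%:R^-1 <= 1 :> R by rewrite invf_le1 // ler1n.
have in2 : n%:R^-1 ^+ 2 <= n%:R^-1 :> R by rewrite expr2 ler_piMl // ltW.
have A2 : A <= A ^+ 2 by rewrite expr2 ler_peMl //; move: A1; clear; lra.
have A21 : 1 <= A ^+ 2 by move: A1 A2; clear; lra.
apply: (@le_trans _ _ (48 * dl + 24 * eps ^+ 2 + 864 * A ^+ 2 * (t / n%:R) + (24 * eps + 120 * B + 48 * A + 14) / n%:R)).
  have KKE : KK = 9 * A ^+ 2 by rewrite /KK exprMn; ring.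
  rewrite KKE in rkb.
  have -> : (24 * eps + 120 * B + 48 * A + 14) / n%:R = 6 * ((4 * eps + 20 * B + 8 * A) / n%:R) + 14 * n%:R^-1 by ring.
  have -> : 864 * A ^+ 2 * (t / n%:R) = 6 * (16 * (9 * A ^+ 2) * (t / n%:R)) by ring.
  move: rkb S7b in2; move: (A ^+ 2) => A2'; clear; lra.
have tn0 : 0 <= t / n%:R by rewrite divr_ge0 // ltW.
have a1 : 48 * dl <= 1000 * A ^+ 2 * dl by rewrite ler_wpM2r //; move: A21; clear; lra.
have a2 : 24 * eps ^+ 2 <= 1000 * A ^+ 2 * eps ^+ 2 by rewrite ler_wpM2r ?sqr_ge0 //; move: A21; clear; lra.
have a3 : 864 * A ^+ 2 * (t / n%:R) <= 1000 * A ^+ 2 * (t / n%:R).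
  by rewrite ler_wpM2r //; move: A21; clear; lra.
have a4 : (24 * eps + 120 * B + 48 * A + 14) / n%:R <= 1000 * A ^+ 2 * n%:R^-1.
  rewrite ler_pM2r //; have : B <= A /\ eps <= A by move: B0 b0 eps0; rewrite /A; clear; split; lra.
  by case; move: A1 A2; clear; lra.
have -> : 1000 * (B + b + eps + 1) ^+ 2 * (dl + eps ^+ 2 + (t + 1) / n%:R) =
   1000 * A ^+ 2 * dl + 1000 * A ^+ 2 * eps ^+ 2 + 1000 * A ^+ 2 * (t / n%:R) + 1000 * A ^+ 2 * n%:R^-1.
  by rewrite -/A; ring.
by rewrite !lerD.
Qed.

End ErmBound.

(** * From approximation to the rate *)

Section Rate.
Variable R : realType.

Lemma sparse_const_gt0 d : (0 < sparse_const d)%N.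
Proof. by rewrite /sparse_const !muln_gt0 expn_gt0 addn2. Qed.

Lemma ln_nat_ge_half (n : nat) : (2 <= n)%N -> 1 / 2 <= ln n%:R :> R.
Proof.
move=> n2; apply: le_trans (ln2_ge_half R) _; rewrite ler_ln ?posrE ?ler_nat //.
by rewrite ltr0n (leq_trans _ n2).
Qed.

(* For [alpha = (d + 3) / 2] the mass bound is constant, which covers the
   class [Fsigma_ball]. *)
Lemma erm_rate_of_approximation (d : nat) (B alpha m2 k b C0 : R)
    (H : ('rV[R]_d -> R) -> Prop) (Mok : nat -> R -> Prop) :
  (1 <= d)%N -> 0 < B -> 0 < alpha -> alpha <= (d%:R + 3) / 2 ->
  0 < m2 -> 0 < k -> 0 <= b -> 0 <= C0 ->
  (forall n M, Mok n M -> 0 <= M <=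
     m2 * n%:R `^ ((d%:R + 3 - 2 * alpha) / (2 * d%:R + 4 * alpha))) ->
  (forall h, H h -> forall x, unit_ball d x -> `|h x| <= b) ->
  (forall h, H h -> forall e : R, 0 < e -> exists2 del : R, 0 < del & forall x x',
     unit_ball d x -> unit_ball d x' -> (forall j, `|x 0 j - x' 0 j| <= del) ->
     `|h x - h x'| <= e) ->
  (forall h n M, H h -> (2 <= n)%N -> Mok n M -> exists N' g0, NN d N' M g0 /\
     forall x, unit_ball d x ->
       `|g0 x - h x| <= C0 * n%:R `^ (- (alpha / (d%:R + 2 * alpha)))) ->
  exists C c1 c2 : R, [/\ 0 < C, 0 < c1, 0 < c2 &
    erm_rate d B H Mok (fun n Nn => k * n%:R `^ (d%:R / (d%:R + 2 * alpha)) <= Nn%:R)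
      (2 * alpha / (d%:R + 2 * alpha)) (d%:R / (d%:R + 2 * alpha)) C c1 c2].
Proof.
move=> d1 B0 al0 al3 m20 k0 b0 C00 hM hb huc happ.
have dR : 1 <= d%:R :> R by rewrite ler1n.
pose s : R := d%:R + 2 * alpha.
have s0 : 1 < s by rewrite /s; lra.
have sn0 : s != 0 by rewrite gt_eqF //; lra.
pose mu : R := (d%:R + 3 - 2 * alpha) / (2 * d%:R + 4 * alpha).
pose tau : R := d%:R / s.
pose rho : R := 2 * alpha / s.
have tr : tau + rho = 1 by rewrite /tau /rho -mulrDl divff.
have tau0 : 0 < tau by rewrite divr_gt0 //; lra.
have rho0 : 0 < rho by rewrite divr_gt0 //; lra.
have mus : mu = (d%:R + 3 - 2 * alpha) / (2 * s).
  by rewrite /mu /s; congr (_ / _); ring.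
have mu0 : 0 <= mu by rewrite mus divr_ge0 //; [move: al3; clear|move: s0; clear]; lra.
have mu2 : mu <= 2 by rewrite mus ler_pdivrMr ?/s; lra.
(* The exponent of [M ^+ 2 / (m ^+ 3 * N)] for [m] of order [n ^ (1 / s)] and [N] of order
   [m ^ d]. *)
have expo : mu *+ 2 - 3 / s - tau = - rho.
  by rewrite mus /tau /rho mulr2n; field.
pose A : R := (sparse_const d)%:R.
have A1 : 1 <= A.
  by rewrite /A ler1n sparse_const_gt0.
(* The scale will be [m = truncn (c * n ^ (1 / s))]; this [c] makes the pruned width at most
   [k * n ^ tau], hence at most [Nn]. *)
pose c : R := Num.min 1 (k / A).
have c0 : 0 < c by rewrite /c lt_min ltr01 divr_gt0 // (lt_le_trans ltr01 A1).
have A0 : 0 < A := lt_le_trans ltr01 A1.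
have c1 : c <= 1 by rewrite /c ge_min lexx.
have cA : A * c <= k.
  rewrite mulrC -ler_pdivlMr //.
  by rewrite /c ge_min lexx orbT.
have cd : A * c ^+ d <= k.
  apply: le_trans cA; rewrite ler_pM2l //.
  by rewrite -[leRHS]expr1 ler_wiXn2l // ltW.
pose Cd : R := 12 * d.+3%:R ^+ 5 * d.+1%:R ^+ 2.
have Cd0 : 0 <= Cd by rewrite /Cd mulr_ge0 ?exprn_ge0 // mulr_ge0 ?exprn_ge0.
(* A bound [2 K + 1 <= Q * n ^+ 4] for the resolution of the net: [K] is of order [n * N * M] with
   [N <= k * n] and [M <= m2 * n ^+ 2]. Then [C'] bounds its logarithm in units of [ln n], and [T]
   exceeds the resulting entropy by [1]. *)
pose Q : R := 4 * k * m2 * d.+1%:R + 3.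
have Q3 : 3 <= Q by rewrite /Q lerDr !mulr_ge0 // ltW.
pose C' : R := 2 * ln Q + 4.
have lnQ : 0 <= ln Q by rewrite ln_ge0 //; move: Q3; clear; lra.
pose T : R := d.+2%:R * k * C' + 1.
have T1 : 1 <= T by rewrite /T lerDr !mulr_ge0 // ?(ltW k0) // /C'; move: lnQ; clear; lra.
pose lk : R := 2 * ln (k + 1) + 1.
have lk0 : 0 <= ln (k + 1) by rewrite ln_ge0 //; move: k0; clear; lra.
pose Ss : R := Cd * m2 ^+ 2 * (2 / c) ^+ 3 * (4 * (lk / (A * (c / 2) ^+ d))).
have Ac0 : 0 < A * (c / 2) ^+ d by rewrite mulr_gt0 ?exprn_gt0 ?divr_gt0.
have Ss0 : 0 <= Ss.
  rewrite /Ss; apply: mulr_ge0.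
    apply: mulr_ge0; first by rewrite mulr_ge0 ?sqr_ge0.
    by rewrite exprn_ge0 // divr_ge0 // ltW.
  by rewrite mulr_ge0 // divr_ge0 //; [rewrite /lk; move: lk0; clear; lra|exact: ltW].
have [n0 n00 hn0] := exists_nat_ge ((1 / c) `^ s).
have k1000 : 0 < 1000 :> R by rewrite ltr0n.
have hCd : 0 < 1000 * (B + b + C0 + 1) ^+ 2 * (Ss + 2 * C0 ^+ 2 + T + 2).
  apply: mulr_gt0; first (apply: mulr_gt0; [exact: k1000|apply: exprn_gt0; move: B0 b0 C00; clear; lra]).
  by have := sqr_ge0 C0; move: Ss0 T1; clear; lra.
exists (1000 * (B + b + C0 + 1) ^+ 2 * (Ss + 2 * C0 ^+ 2 + T + 2)),
  (2 + expR (n0%:R ^+ 2)), 1; split; [exact: hCd| |exact: ltr01|].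
  by have := expR_gt0 (n0%:R ^+ 2 : R); clear; lra.
move=> dO0 O0 P0 X Y h mX mY Xb Yb reg Hh n n2 Nn M Mo No dO O P Xs Ys iid fhat ferm.
have nR2 : 2 <= n%:R :> R by rewrite ler_nat.
have nR : 0 < n%:R :> R by move: nR2; clear; lra.
have nR1 : 1 <= n%:R :> R by move: nR2; clear; lra.
have L0 := ln_nat_ge_half n2.
set L : R := ln n%:R in L0 *.
have pw (u w : R) : u <= w -> n%:R `^ u <= n%:R `^ w :> R by move=> uw; apply: ler_powR.
have pw0 (u : R) : 0 < n%:R `^ u :> R by rewrite powR_gt0.
have pwD (u w : R) : n%:R `^ (u + w) = n%:R `^ u * n%:R `^ w :> R.
  by apply: powRD; rewrite (gt_eqF nR) implybT.
rewrite -/s -/tau -/rho -/L in No *.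
have tau1 : tau <= 1 by move: tr rho0; clear; lra.
have Lp : 0 < L by move: L0; clear; lra.
have ntau : n%:R `^ tau <= n%:R :> R by rewrite -[leRHS]powRr1 ?pw // ltW.
(* For [n < n0] the scale [m] could be zero. There [c1] is so large that the required probability is
   nonpositive, and the empty event serves. *)
case: (ltnP n n0) => hn.
  exists set0; split => //.
  rewrite measure0 lee_fin subr_le0 mulN1r.
  have Ln : L <= n%:R.
    have := @le_ln1Dx R (n%:R - 1) ltac:(move: nR; clear; lra); rewrite addrCA subrr addr0 -/L; clear; lra.
  have : n%:R `^ tau * L <= n0%:R ^+ 2.
    rewrite expr2; apply: ler_pM; [exact: ltW (pw0 _)|exact: ltW|apply: le_trans ntau _|apply: le_trans Ln _];
      by rewrite ler_nat ltnW.
  move=> h2; rewrite mulNr.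
  have e0 := expR_gt0 (- (n%:R `^ tau * L)).
  rewrite mulrDl -expRD (le_trans (y := expR (n0%:R ^+ 2 + - (n%:R `^ tau * L)))) //.
    by rewrite -[leLHS]expR0 ler_expR; move: h2; clear; lra.
  by rewrite lerDr; move: e0; clear; lra.
pose a : R := n%:R `^ (s^-1).
have a0 : 0 < a by exact: pw0.
have ca : 1 <= c * a.
  have h1 : (1 / c) `^ s <= n%:R by apply: le_trans hn0 _; rewrite ler_nat.
  have h2 : 1 / c <= a.
    have -> : 1 / c = ((1 / c) `^ s) `^ (s^-1).
      by rewrite -powRrM divff // powRr1 // divr_ge0 // ltW.
    by apply: ge0_ler_powR => //; rewrite ?nnegrE ?powR_ge0 ?invr_ge0 // ltW // (lt_trans ltr01).
  by move: h2; rewrite ler_pdivrMr // mulrC.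
pose m := Num.truncn (c * a).
have /andP[ma am] := truncn_itv (le_trans ler01 ca).
rewrite -/m in ma am.
have m0 : (0 < m)%N.
  by rewrite -ltnS -(ltr_nat R); exact: le_lt_trans ca am.
have m1R : 1 <= m%:R :> R by rewrite ler1n.
have mR0 : 0 < m%:R :> R by rewrite ltr0n.
have mlow : c / 2 * a <= m%:R.
  by rewrite -natr1 in am; rewrite mulrAC ler_pdivrMr //; move: am m1R; clear; lra.
have ad : a ^+ d = n%:R `^ tau.
  by rewrite /a -powR_mulrn ?powR_ge0 // -powRrM mulrC.
pose N := (sparse_const d * m ^ d)%N.
have NE : N%:R = A * m%:R ^+ d :> R by rewrite /N natrM natrX.
have Nup : N%:R <= k * n%:R `^ tau.
  rewrite NE -ad (le_trans (y := A * (c * a) ^+ d)) //.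
    by rewrite ler_pM2l // lerXn2r ?nnegrE // ltW // mulr_gt0.
  by rewrite exprMn mulrA ler_pM2r ?exprn_gt0.
have Nlow : A * (c / 2) ^+ d * n%:R `^ tau <= N%:R.
  rewrite NE -ad -mulrA -exprMn ler_pM2l //.
  by rewrite lerXn2r ?nnegrE // ?ltW // mulr_gt0 ?divr_gt0.
have NNn : (N <= Nn)%N by rewrite -(ler_nat R); exact: le_trans No.
have N1 : 1 <= N%:R :> R.
  by rewrite NE -[leLHS]mulr1 ler_pM // exprn_ege1.
have /andP[M0 MM] := hM _ _ Mo.
rewrite -/mu in MM.
have [N' [g0 [g0N g0h]]] := happ _ _ _ Hh n2 Mo.
rewrite -/s in g0h.
pose eps := C0 * n%:R `^ (- (alpha / s)).
have eps0 : 0 <= eps by rewrite mulr_ge0 // ltW.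
have epsC : eps <= C0.
  have as0 : - (alpha / s) <= 0 by rewrite oppr_le0 divr_ge0 // ltW // (lt_trans ltr01).
  have := pw _ _ as0; rewrite powRr0 => p1.
  by rewrite -[leRHS]mulr1 ler_wpM2l.
have epsr : eps ^+ 2 = C0 ^+ 2 * n%:R `^ (- rho).
  rewrite exprMn; congr (_ * _); rewrite expr2 -pwD; congr (_ `^ _).
  by rewrite /rho; field.
pose z : R := 2 * n%:R * N%:R * M * d.+1%:R.
have z0 : 0 <= z by rewrite !mulr_ge0.
pose K := (Num.truncn z).+1.
have /andP[Kz zK] := truncn_itv z0; rewrite -/K in zK.
have KR : 0 < K%:R :> R by rewrite ltr0n.
have hK : 2 * N%:R * M * d.+1%:R / K%:R <= n%:R^-1.
  rewrite ler_pdivrMr // -ler_pdivrMl ?invr_gt0 // invrK; apply: le_trans (ltW zK).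
  by rewrite /z le_eqVlt; apply/orP; left; apply/eqP; ring.
pose t : R := T * n%:R `^ tau * L.
have nL0 : 0 < n%:R `^ tau * L by rewrite mulr_gt0.
have t0 : 0 <= t by rewrite /t -mulrA mulr_ge0 // ?ltW // (lt_le_trans ltr01 T1).
have [E [mE PE hE]] := @erm_core R d B b eps M t m n Nn N' K _ _ P0 X Y h g0 _ _ P Xs Ys
  B0 b0 eps0 M0 t0 m0 (leq_trans (isT : (0 < 2)%N) n2) isT mX mY Xb Yb reg (hb _ Hh) (huc _ Hh)
  g0N g0h NNn hK iid.
rewrite -/N in PE.
exists E; split => //.
  apply: le_trans PE; rewrite lee_fin lerD2l lerN2 mulN1r.
  set net : R := (_ ^ _)%:R.
  have net1 : 1 <= net by rewrite /net natrX exprn_ege1 // ler1n.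
  have q0 : (2 * K).+1%:R <= Q * n%:R ^+ 4 :> R.
    have : (2 * K).+1%:R <= 2 * z + 3 :> R.
      by rewrite -natr1 natrM /K -natr1; move: Kz; clear; lra.
    have zb : 2 * z <= (4 * k * m2 * d.+1%:R) * n%:R ^+ 4.
      have u1 : N%:R <= k * n%:R by apply: le_trans Nup _; rewrite ler_pM2l.
      have u2 : M <= m2 * n%:R ^+ 2.
        apply: le_trans MM _; rewrite ler_pM2l // -powR_mulrn ?pw // ltW.
      have := ler_pM (ltW (lt_le_trans ltr01 N1)) M0 u1 u2 => u3.
      have -> : 2 * z = (4 * n%:R * d.+1%:R) * (N%:R * M) by rewrite /z; ring.
      have -> : 4 * k * m2 * d.+1%:R * n%:R ^+ 4 = (4 * n%:R * d.+1%:R) * (k * n%:R * (m2 * n%:R ^+ 2)) by ring.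
      by rewrite ler_wpM2l // !mulr_ge0.
    have n41 : 1 <= n%:R ^+ 4 :> R by rewrite exprn_ege1.
    rewrite /Q mulrDl; move: zb n41; clear; lra.
  have q1 : ln (2 * K).+1%:R <= C' * L :> R.
    rewrite (le_trans (y := ln (Q * n%:R ^+ 4))) //.
      by rewrite ler_ln ?posrE // mulr_gt0 ?exprn_gt0 //; move: Q3; clear; lra.
    rewrite lnM ?posrE ?exprn_gt0 //; last by move: Q3; clear; lra.
    have -> : ln (n%:R ^+ 4) = 4 * L :> R by rewrite lnXn // mulr_natl.
    have -> : C' * L = 2 * ln Q * L + 4 * L by rewrite /C'; ring.
    rewrite lerD2r; have := ler_wpM2l lnQ L0; clear; lra.
  have q2 : net <= expR (d.+2%:R * k * C' * (n%:R `^ tau * L)).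
    have -> : net = expR (ln net) by rewrite lnK // posrE (lt_le_trans ltr01).
    rewrite ler_expR /net natrX lnXn ?ltr0n // -[leLHS]mulr_natl natrM.
    rewrite (le_trans (y := d.+2%:R * (k * n%:R `^ tau) * (C' * L))) //.
      apply: ler_pM => //; [by rewrite ln_ge0 // ler1n|by rewrite ler_wpM2l].
    by rewrite le_eqVlt; apply/orP; left; apply/eqP; ring.
  clearbody net.
  have q3 : net * expR (- t) <= expR (- (n%:R `^ tau * L)).
    rewrite (le_trans (ler_wpM2r (expR_ge0 _) q2)) // -expRD ler_expR /t /T.
    set A1' := d.+2%:R * k * C'; rewrite le_eqVlt; apply/orP; left; apply/eqP; ring.
  rewrite mulNr (le_trans (y := 2 * (net * expR (- t)))) //.
    rewrite mulrA ler_wpM2r ?expR_ge0 //; move: net1; clear; lra.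
  rewrite ler_pM //; first by rewrite !mulr_ge0 ?expR_ge0 // (le_trans ler01).
  by rewrite lerDl expR_ge0.
move=> w Ew; have [fN fmin] := ferm w.
apply: le_trans (hE w Ew _ fN fmin) _; rewrite lee_fin.
have nr0 := pw0 (- rho).
have nrL : n%:R `^ (- rho) <= 2 * (n%:R `^ (- rho) * L).
  by have := ler_wpM2l (ltW nr0) L0; clear; lra.
have rL0 : 0 < n%:R `^ (- rho) * L by rewrite mulr_gt0.
have b1 : sparse_cost d m M <= Ss * (n%:R `^ (- rho) * L).
  rewrite /sparse_cost -/N -/Cd.
  have v1 : M ^+ 2 <= m2 ^+ 2 * n%:R `^ (mu *+ 2).
    rewrite mulr2n pwD -expr2 -exprMn lerXn2r ?nnegrE //.
    by rewrite mulr_ge0 // ?ltW.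
  have v2 : (m%:R ^+ 3)^-1 <= (2 / c) ^+ 3 * n%:R `^ (- (3 / s)).
    have -> : n%:R `^ (- (3 / s)) = (a ^+ 3)^-1 :> R.
      by rewrite powRN /a -powR_mulrn ?powR_ge0 // -powRrM mulrC.
    have -> : (2 / c) ^+ 3 * (a ^+ 3)^-1 = ((c / 2 * a) ^+ 3)^-1.
      by field; rewrite (gt_eqF c0) (gt_eqF a0).
    have ca0 : 0 < c / 2 * a by rewrite mulr_gt0 // divr_gt0.
    by rewrite lef_pV2 ?posrE ?exprn_gt0 // lerXn2r ?nnegrE // ltW.
  have v3 : ln N%:R <= lk * L.
    rewrite (le_trans (y := ln ((k + 1) * n%:R))) //.
      rewrite ler_ln ?posrE //; [|exact: lt_le_trans ltr01 N1|by rewrite mulr_gt0 //; move: k0; clear; lra].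
      apply: le_trans Nup _; apply: (@le_trans _ _ (k * n%:R)); first by rewrite ler_pM2l.
      by rewrite ler_pM2r //; clear; lra.
    rewrite lnM ?posrE //; last by move: k0; clear; lra.
    have -> : lk * L = 2 * ln (k + 1) * L + L by rewrite /lk; ring.
    rewrite -/L lerD2r; have := ler_wpM2l lk0 L0; clear; lra.
  have v4 : ln N%:R / N%:R <= lk / (A * (c / 2) ^+ d) * (L * n%:R `^ (- tau)).
    have -> : lk / (A * (c / 2) ^+ d) * (L * n%:R `^ (- tau)) =
       (lk * L) * (A * (c / 2) ^+ d * n%:R `^ tau)^-1.
      by rewrite powRN; set AA := A * _; rewrite (invfM AA); ring.
    apply: ler_pM => //; rewrite ?ln_ge0 ?invr_ge0 //.
    have N0' : 0 < N%:R :> R := lt_le_trans ltr01 N1.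
    have AA0 : 0 < A * (c / 2) ^+ d * n%:R `^ tau by rewrite mulr_gt0.
    by rewrite lef_pV2 ?posrE.
  have lnN0 : 0 <= ln N%:R :> R by rewrite ln_ge0.
  have w1 : M ^+ 2 * (m%:R ^+ 3)^-1 <= m2 ^+ 2 * n%:R `^ (mu *+ 2) * ((2 / c) ^+ 3 * n%:R `^ (- (3 / s))).
    by apply: ler_pM => //; rewrite ?sqr_ge0 ?invr_ge0 ?exprn_ge0.
  have w2 : (M ^+ 2 * (m%:R ^+ 3)^-1) * (ln N%:R / N%:R) <=
     (m2 ^+ 2 * n%:R `^ (mu *+ 2) * ((2 / c) ^+ 3 * n%:R `^ (- (3 / s)))) *
     (lk / (A * (c / 2) ^+ d) * (L * n%:R `^ (- tau))).
    apply: ler_pM => //; last by rewrite divr_ge0.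
    by rewrite mulr_ge0 ?sqr_ge0 ?invr_ge0 ?exprn_ge0.
  have w3 := ler_wpM2l (mulr_ge0 Cd0 (ler0n R 4)) w2.
  have -> : Cd * M ^+ 2 / m%:R ^+ 3 * (4 * (ln N%:R / N%:R)) =
     Cd * 4 * (M ^+ 2 * (m%:R ^+ 3)^-1 * (ln N%:R / N%:R)) by ring.
  apply: le_trans w3 _; rewrite -expo !pwD /Ss le_eqVlt; apply/orP; left; apply/eqP.
  by ring.
have b2 : eps ^+ 2 <= 2 * C0 ^+ 2 * (n%:R `^ (- rho) * L).
  by rewrite epsr; have := ler_wpM2l (sqr_ge0 C0) nrL; clear; lra.
have b3 : (t + 1) / n%:R <= (T + 2) * (n%:R `^ (- rho) * L).
  have nE : n%:R `^ tau / n%:R = n%:R `^ (- rho) :> R.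
    rewrite -{2}[n%:R]powRr1 ?ltW // -powRN -pwD; congr (_ `^ _); move: tr; clear; lra.
  have -> : (t + 1) / n%:R = T * (n%:R `^ tau / n%:R * L) + n%:R^-1 by rewrite /t; ring.
  rewrite nE (mulrDl T 2) lerD2l.
  have : n%:R^-1 <= n%:R `^ (- rho) :> R.
    have -> : n%:R^-1 = n%:R `^ (-1) :> R by rewrite powRN powRr1 // ltW.
    by apply: pw; move: tr tau0; clear; lra.
  by move: nrL; clear; lra.
rewrite -[leRHS]mulrA -[leRHS]mulrA; apply: ler_pM.
- apply: mulr_ge0; [exact: ltW|exact: sqr_ge0].
- by rewrite !addr_ge0 ?sparse_cost_ge0 ?sqr_ge0 // divr_ge0 // ?addr_ge0 // ltW.
- by apply: ler_wpM2l; [exact: ltW|apply: lerXn2r; rewrite ?nnegrE; move: B0 b0 C00 eps0 epsC; clear; lra].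
- by move: b1 b2 b3; clear; move: (n%:R `^ (- rho) * L) => W; lra.
Qed.

End Rate.

(** * The class F_sigma *)

Section Barron.
Variable R : realType.

Lemma relu_dotv_le (d : nat) (x : 'rV[R]_d) (w : 'rV[R]_d.+1) : unit_ball d x ->
  `|relu (dotv (ext x) w)| <= d.+1%:R * enorm w.
Proof.
move=> xb; rewrite -[relu _]subr0 -(relu_neg (lexx 0)) (le_trans (relu_lip _ _)) // subr0.
rewrite -[enorm w]mul1r; apply: dotv_le_coord => j; first exact: ext_coord_le1.
exact: coord_le_enorm.
Qed.

Lemma NN_bound (d N : nat) (M : R) f x : NN d N M f -> unit_ball d x ->
  `|f x| <= d.+1%:R * M.
Proof.
move=> [a [w [kM ->]]] xb; rewrite /nn_fun (le_trans (ler_norm_sum _ _ _)) //.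
apply: (@le_trans _ _ (\sum_i d.+1%:R * (`|a i| * enorm (w i)))); last first.
  by rewrite -mulr_sumr ler_wpM2l.
by apply: ler_sum => i _; rewrite normrM mulrCA ler_wpM2l // relu_dotv_le.
Qed.

Lemma NN_scale (d N : nat) (M c : R) f : 0 <= c -> NN d N M f ->
  NN d N (c * M) (fun x => c * f x).
Proof.
move=> c0 [a [w [kM ->]]]; exists (fun i => c * a i), w; split.
  rewrite /kappa; under eq_bigr do rewrite normrM (ger0_norm c0) -mulrA.
  by rewrite -mulr_sumr ler_wpM2l.
by apply/funext => x; rewrite /nn_fun mulr_sumr; apply: eq_bigr => i _; rewrite mulrA.
Qed.

Definition scell (d k : nat) (u : {ffun 'I_d.+1 -> 'I_(2 * k).+1}) : set (@Rvec R d.+1) :=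
  unit_sphere d `&` \bigcap_j (fun x : @Rvec R d.+1 => (x 0 j + 1) * k%:R) @^-1`
    `[(u j)%:R, (u j).+1%:R[%classic.

Lemma measurable_unit_sphere (d : nat) : measurable (unit_sphere d : set (@Rvec R d.+1)).
Proof.
have -> : (unit_sphere d : set (@Rvec R d.+1)) =
    setT `&` (fun x : @Rvec R d.+1 => dotv x x) @^-1` [set 1].
  rewrite setTI; apply/seteqP; split => x; rewrite /unit_sphere /= -sqr_enorm.
    by move=> ->; rewrite expr1n.
  by move=> /eqP; rewrite sqrp_eq1 ?enorm_ge0 // => /eqP.
have m : measurable_fun setT (fun x : @Rvec R d.+1 => dotv x x).
  by apply: measurable_sum => j; apply: measurable_funM; exact: measurable_coord.
by apply: m.
Qed.

Lemma measurable_scell d k u : measurable (@scell d k u).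
Proof.
apply: measurableI; first exact: measurable_unit_sphere.
apply: (fin_bigcap_measurable finite_finset) => j _; rewrite -[X in measurable X]setTI.
have m : measurable_fun setT (fun x : @Rvec R d.+1 => (x 0 j + 1) * k%:R).
  apply: measurable_funM; last exact: measurable_cst.
  by apply: measurable_funD; [exact: measurable_coord|exact: measurable_cst].
by apply: m.
Qed.

Lemma scell_disj d k (u u' : {ffun 'I_d.+1 -> 'I_(2 * k).+1}) x : scell u x -> scell u' x -> u = u'.
Proof.
move=> [_ h] [_ h']; apply/ffunP => j.
by have /= := h j I; have /= := h' j I; rewrite !in_itv /= => a b; exact: (grid_index_unique b a).
Qed.

Lemma scell_cover d k (x : 'rV[R]_d.+1) : (0 < k)%N -> unit_sphere d x ->
  exists u : {ffun 'I_d.+1 -> 'I_(2 * k).+1}, scell u x.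
Proof.
move=> k0 xs.
have xj j : `|x 0 j| <= 1 by rewrite -[leRHS]xs; exact: coord_le_enorm.
have [u hu] := choice (fun j => grid_index k0 (xj j)).
exists [ffun j => u j]; split => // j _ /=; rewrite in_itv /= !ffunE; exact: hu.
Qed.

Lemma integral_scells (d k : nat) (mu : {finite_measure set (@Rvec R d.+1) -> \bar R})
    (x : 'rV[R]_d) (v : {ffun 'I_d.+1 -> 'I_(2 * k).+1} -> 'rV[R]_d.+1) :
  (0 < k)%N -> unit_ball d x ->
  (forall u, (exists z, scell u z) -> scell u (v u)) ->
  `|fine (\int[mu]_(z in unit_sphere d) (relu (dotv (ext x) z))%:E) -
    \sum_u fine (mu (scell u)) * relu (dotv (ext x) (v u))|
   <= d.+1%:R / k%:R * \sum_u fine (mu (@scell d k u)).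
Proof.
move=> k0 xb hv.
have kR : 0 < k%:R :> R by rewrite ltr0n.
have mr : measurable_fun setT (fun z : @Rvec R d.+1 => relu (dotv (ext x) z)).
  apply: measurable_maxr; last exact: measurable_cst.
  apply: (eq_measurable_fun (fun z : @Rvec R d.+1 => dotv z (ext x))); last exact: measurable_fun_dotv.
  by move=> z _; rewrite dotvC.
have cell u := @integral_near_cst R _ _ mu (@scell d k u) (fun z => relu (dotv (ext x) z))
  (relu (dotv (ext x) (v u))) (d.+1%:R / k%:R) (measurable_scell u) (measurable_funTS mr).
have close u z : @scell d k u z -> `|relu (dotv (ext x) z) - relu (dotv (ext x) (v u))| <= d.+1%:R / k%:R.
  move=> hz; have hv' : scell u (v u) by apply: hv; exists z.
  rewrite (le_trans (relu_lip _ _)) // -dotvBr -[k%:R^-1]mul1r.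
  apply: dotv_le_coord => j; first exact: ext_coord_le1.
  rewrite !mxE; case: hz hv' => _ h [_ h'].
  by have /= := h j I; have /= := h' j I; rewrite !in_itv /= => a b; exact: (grid_close k0 b a).
have DE : unit_sphere d = \big[setU/set0]_(u <- index_enum {ffun 'I_d.+1 -> 'I_(2 * k).+1}) @scell d k u.
  rewrite -bigcup_seq; apply/seteqP; split => [z /(scell_cover k0)[u hu]|z [u _ []//]].
  by exists u => //=; rewrite mem_index_enum.
have uI := index_enum_uniq {ffun 'I_d.+1 -> 'I_(2 * k).+1}.
have tF : trivIset [set` index_enum {ffun 'I_d.+1 -> 'I_(2 * k).+1}] (@scell d k).
  apply/trivIsetP => u u' _ _ uu'; apply/seteqP; split => // z [a b].
  by have /eqP := scell_disj a b; rewrite (negPf uu').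
have -> : fine (\int[mu]_(z in unit_sphere d) (relu (dotv (ext x) z))%:E) =
   \sum_u fine (\int[mu]_(z in @scell d k u) (relu (dotv (ext x) z))%:E).
  rewrite [in LHS]DE integral_bigsetU_EFin //; first last.
  - by apply/measurable_EFinP; exact: measurable_funTS.
  - by move=> u; exact: measurable_scell.
  apply: EFin_inj; rewrite -sumEFin fineK.
    by apply: eq_bigr => u _; rewrite fineK //; case: (cell u (close u)).
  by apply/sum_fin_numP => u _ _; case: (cell u (close u)).
rewrite -sumrB (le_trans (ler_norm_sum _ _ _)) // mulr_sumr; apply: ler_sum => u _.
by rewrite [fine (mu _) * _]mulrC; case: (cell u (close u)).
Qed.

(** The infimum defining the norm provides measures of variation at most [1 + e] only. The Riemann
    sum inherits this mass and is divided by [1 + e] to reach mass exactly [1]; since a network of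
    mass [1] is at most [d.+1], the division costs [e * d.+1]. *)
Lemma Fsigma_ball_NN (d : nat) (f : 'rV[R]_d -> R) (eps : R) :
  Fsigma_ball d 1 f -> 0 < eps ->
  exists N g, NN d N 1 g /\ forall x, unit_ball d x -> `|g x - f x| <= eps.
Proof.
move=> Ff eps0.
pose D : R := d.+1%:R.
have D1 : 1 <= D by rewrite /D ler1n.
pose e : R := eps / (2 * D).
have e0 : 0 < e by rewrite divr_gt0 //; lra.
have [mu1 [mu2 [_ _ fE fvar]]] := Ff e e0.
(* The pair [mu1], [mu2] may have common parts, so [W] can exceed the variation. It only governs the
   mesh; the mass of the network comes from the differences [c u]. *)
pose W := fine (mu1 (unit_sphere d)) + fine (mu2 (unit_sphere d)).
have [k k0 hk] := exists_nat_ge (2 * D * W / eps).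
have kR : 0 < k%:R :> R by rewrite ltr0n.
pose U := {ffun 'I_d.+1 -> 'I_(2 * k).+1}.
have ex_v (u : U) : exists v : 'rV[R]_d.+1, enorm v = 1 /\ ((exists z, scell u z) -> scell u v).
  case: (pselect (exists z, scell (d := d) u z)) => [[z hz]|hn].
    by exists z; split => //; case: hz.
  exists (delta_mx 0 ord0); split => //; rewrite /enorm /dotv (bigD1 ord0) //= mxE !eqxx mul1r.
  rewrite big1 ?addr0 ?sqrtr1 // => j j0; rewrite mxE eqxx (negPf j0) mul0r //.
have [v hv] := choice ex_v.
have hv2 u : (exists z, scell u z) -> scell u (v u) by case: (hv u).
pose c (u : U) := fine (mu1 (scell u)) - fine (mu2 (scell u)).
have DE : unit_sphere d = \bigcup_(u in [set u : U | xpredT u]) @scell d k u.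
  apply/seteqP; split => [z /(scell_cover k0)[u hu]|z [u _ []//]].
  by exists u.
have tF : trivIset setT (@scell d k).
  apply/trivIsetP => u u' _ _ uu'; apply/seteqP; split => // z [a b].
  by have /eqP := scell_disj a b; rewrite (negPf uu').
have muE (mu : {finite_measure set (@Rvec R d.+1) -> \bar R}) :
    \sum_u fine (mu (@scell d k u)) = fine (mu (unit_sphere d)).
  rewrite DE measure_bigcup_finType //; last by move=> u; exact: measurable_scell.
  apply: EFin_inj; rewrite -sumEFin fineK.
    by apply: eq_bigr => u _; rewrite fineK // fin_num_measure //; exact: measurable_scell.
  by apply/sum_fin_numP => u _ _; rewrite fin_num_measure //; exact: measurable_scell.
pose s := [seq (c u, v u) | u <- index_enum U].
have mass : seq_mass s <= 1 + e.
  rewrite /seq_mass big_map /=; under eq_bigr do rewrite (hv _).1 mulr1.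
  have := fvar #|U| (fun i => @scell d k (enum_val i)) (fun i => measurable_scell _).
  have -> : \sum_(i < #|U|) `|fine (mu1 (scell (enum_val i))) - fine (mu2 (scell (enum_val i)))| = \sum_u `|c u|.
    by rewrite [RHS](reindex_onto (enum_val (A := U)) enum_rank) /=;
      [apply: eq_bigl => i; rewrite enum_valK eqxx|move=> u _; exact: enum_rankK].
  apply.
    apply/trivIsetP => i i' _ _ ii'; apply/seteqP; split => // z [a b].
    by have /eqP := scell_disj a b; rewrite (inj_eq enum_val_inj) (negPf ii').
  rewrite DE; apply/seteqP; split => z [u _ hu]; first by exists (enum_val u).
  by exists (enum_rank u) => //; rewrite enum_rankK.
have e1 : 0 < 1 + e by lra.
have sN : NN d (size s) (1 + e) (seq_net s) by exact: seq_net_NN.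
have i1 : 0 <= (1 + e)^-1 by rewrite invr_ge0 ltW.
have gN := NN_scale i1 sN; rewrite mulVf ?gt_eqF // in gN.
exists (size s), (fun x => (1 + e)^-1 * seq_net s x); split => // x xb.
have n1 : `|seq_net s x - f x| <= eps / 2.
  have h1 := integral_scells mu1 k0 xb hv2; have h2 := integral_scells mu2 k0 xb hv2.
  rewrite fE // /seq_net big_map /=.
  rewrite !muE in h1 h2.
  have -> : \sum_u c u * relu (dotv (ext x) (v u)) =
     \sum_u fine (mu1 (scell u)) * relu (dotv (ext x) (v u)) -
     \sum_u fine (mu2 (scell u)) * relu (dotv (ext x) (v u)).
    by rewrite -sumrB; apply: eq_bigr => u _; rewrite mulrBl.
  have hW : D / k%:R * W <= eps / 2.
    rewrite mulrAC ler_pdivrMr //; move: hk; rewrite ler_pdivrMr // => hk.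
    by move: hk; rewrite /D; lra.
  move: h1 h2 hW; rewrite /W -/D mulrDr.
  set I1 := fine _; set I2 := fine _; set s1 := \sum_u _; set s2 := \sum_u _.
  rewrite !ler_norml => /andP[? ?] /andP[? ?] ?; apply/andP; split; lra.
have n2 : `|(1 + e)^-1 * seq_net s x - seq_net s x| <= eps / 2.
  have -> : (1 + e)^-1 * seq_net s x - seq_net s x = - (e * ((1 + e)^-1 * seq_net s x)).
    by field; rewrite gt_eqF.
  rewrite normrN normrM (gtr0_norm e0).
  have := NN_bound gN xb; rewrite mulr1 => /(ler_wpM2l (ltW e0)) h.
  by rewrite (le_trans h) // /e -/D; rewrite le_eqVlt; apply/orP; left; apply/eqP; field; lra.
have -> : (1 + e)^-1 * seq_net s x - f x =
  ((1 + e)^-1 * seq_net s x - seq_net s x) + (seq_net s x - f x) by ring.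
by rewrite (le_trans (ler_normD _ _)) //; lra.
Qed.

Lemma NN_limit_bound (d : nat) (M : R) (f : 'rV[R]_d -> R) :
  (forall e : R, 0 < e -> exists N g, NN d N M g /\
     forall x, unit_ball d x -> `|g x - f x| <= e) ->
  forall x, unit_ball d x -> `|f x| <= d.+1%:R * M + 1.
Proof.
move=> hf x xb; have [N [g [gN gf]]] := hf 1 ltr01.
have := NN_bound gN xb; have := gf x xb.
by rewrite !ler_norml => /andP[? ?] /andP[? ?]; apply/andP; split; lra.
Qed.

Lemma NN_limit_unif_cont (d : nat) (M : R) (f : 'rV[R]_d -> R) : 0 <= M ->
  (forall e : R, 0 < e -> exists N g, NN d N M g /\
     forall x, unit_ball d x -> `|g x - f x| <= e) ->
  forall e : R, 0 < e -> exists2 del : R, 0 < del & forall x x',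
     unit_ball d x -> unit_ball d x' -> (forall j, `|x 0 j - x' 0 j| <= del) ->
     `|f x - f x'| <= e.
Proof.
move=> M0 hf e e0; have [N [g [gN gf]]] := hf (e / 3) ltac:(lra).
have dM0 : 0 <= d%:R * M by rewrite mulr_ge0.
pose del := e / 3 / (d%:R * M + 1).
have del0 : 0 < del by rewrite !divr_gt0 //; lra.
exists del => // x x' xb x'b hx.
have h1 := nn_fun_lip gN (ltW del0) hx.
have h2 : d%:R * del * M <= e / 3.
  rewrite (_ : d%:R * del * M = del * (d%:R * M)); last by ring.
  rewrite /del mulrAC ler_pdivrMr; last lra.
  by rewrite ler_pM2l; lra.
have := gf x xb; have := gf x' x'b; move: h1 h2.
by rewrite !ler_norml => /andP[? ?] ? /andP[? ?] /andP[? ?]; apply/andP; split; lra.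
Qed.

Lemma Fsigma_erm_rate (d : nat) (B M k : R) :
  (1 <= d)%N -> 0 < B -> 1 <= M -> 0 < k ->
  exists C c1 c2 : R, [/\ 0 < C, 0 < c1, 0 < c2 &
    erm_rate d B (Fsigma_ball d 1) (fun n Mn => Mn = M)
      (fun n Nn => k * n%:R `^ (d%:R / (2 * d%:R + 3)) <= Nn%:R)
      ((d%:R + 3) / (2 * d%:R + 3)) (d%:R / (2 * d%:R + 3)) C c1 c2].
Proof.
move=> d1 B0 M1 k0.
have dR : 1 <= d%:R :> R by rewrite ler1n.
pose al : R := (d%:R + 3) / 2.
have app f : Fsigma_ball d 1 f -> forall e : R, 0 < e -> exists N g, NN d N 1 g /\
     forall x, unit_ball d x -> `|g x - f x| <= e.
  by move=> Ff e; exact: Fsigma_ball_NN.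
have := @erm_rate_of_approximation R d B al M k (d.+1%:R + 1) 1 (Fsigma_ball d 1)
  (fun n Mn => Mn = M) d1 B0.
have -> : d%:R + 3 - 2 * al = 0 by rewrite /al; lra.
have -> : d%:R + 2 * al = 2 * d%:R + 3 by rewrite /al; lra.
have -> : 2 * al = d%:R + 3 by rewrite /al; lra.
apply => //; try lra.
- by rewrite /al; lra.
- by move=> n Mn ->; rewrite mul0r powRr0 mulr1 lexx andbT; lra.
- by move=> h Hh x xb; have := NN_limit_bound (app h Hh) xb; rewrite mulr1.
- by move=> h Hh; exact: NN_limit_unif_cont ler01 (app h Hh).
- move=> h n Mn Hh n2 ->.
  have np : 0 < n%:R :> R by rewrite ltr0n (leq_trans _ n2).
  have [N [g [[a [w [ka gE]]] gh]]] := app h Hh _ (powR_gt0 (- (al / (2 * d%:R + 3))) np).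
  exists N, g; split; last by move=> x xb; rewrite mul1r; exact: gh.
  by exists a, w; split => //; exact: le_trans M1.
Qed.

End Barron.

(** * Ridge interpolation and discrete Fourier analysis *)

Section Ridge.
Variable R : realType.

Lemma enorm_le_l1 n (u : 'rV[R]_n) : enorm u <= \sum_j `|u 0 j|.
Proof.
have s0 : 0 <= \sum_j `|u 0 j| by apply: sumr_ge0.
rewrite -(@ler_pXn2r _ 2) ?nnegrE ?enorm_ge0 // sqr_enorm expr2 mulr_suml.
apply: ler_sum => j _; rewrite -expr2 -real_normK ?num_real // expr2 ler_wpM2l //.
by rewrite (bigD1 j) //= lerDl sumr_ge0.
Qed.

Definition fdiff (g : nat -> R) (i : nat) : R := g i.+1 - g i.

Lemma fdiff_sum_bound (g : nat -> R) (T t : nat) : (t <= T)%N ->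
  `|g 0%N| <= `|g t| + \sum_(i < T) `|fdiff g i|.
Proof.
move=> tT.
have h k : (k <= t)%N -> `|g 0%N| <= `|g k| + \sum_(i < k) `|fdiff g i|.
  elim: k => [|k IH] kt; first by rewrite big_ord0 addr0.
  apply: le_trans (IH (ltnW kt)) _; rewrite big_ord_recr /=.
  have h : `|g k| <= `|g k.+1| + `|fdiff g k|.
    by rewrite -{1}[g k](subKr (g k.+1)) (le_trans (ler_normB _ _)).
  by move: h; set S := \sum_(i < k) _; clear; lra.
apply: le_trans (h t (leqnn t)) _; rewrite lerD2l.
rewrite -!(big_mkord xpredT (fun i => `|fdiff g i|)) [leRHS](@big_cat_nat _ _ _ t) //=.
by rewrite lerDl sumr_ge0.
Qed.

(** A discrete Sobolev inequality. It replaces the initial values of [g] and [fdiff g] by sums over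
    the whole range, which orthogonality can estimate. *)
Lemma fdiff_avg_bound (g : nat -> R) (T : nat) : (0 < T)%N ->
  `|g 0%N| <= T%:R^-1 * (\sum_(i < T) `|g i|) + \sum_(i < T) `|fdiff g i|.
Proof.
move=> T0; have TR : 0 < T%:R :> R by rewrite ltr0n.
rewrite -(ler_pM2l TR) mulrDr mulrA divff ?gt_eqF // mul1r.
have -> : T%:R * `|g 0%N| = \sum_(i < T) `|g 0%N|.
  by rewrite sumr_const card_ord mulr_natl.
have -> : T%:R * (\sum_(i < T) `|fdiff g i|) = \sum_(j < T) \sum_(i < T) `|fdiff g i|.
  by rewrite sumr_const card_ord mulr_natl.
rewrite -big_split; apply: ler_sum => i _ /=.
by apply: fdiff_sum_bound; exact: ltnW.
Qed.

(* Piecewise linear interpolation at the integers: the coefficient of the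
   neuron with its kink at [i + 1] is the second difference at [i]. *)
Lemma second_difference_expansion (g : nat -> R) (T t : nat) : (t <= T)%N ->
  g t = g 0%N + fdiff g 0 * t%:R + \sum_(i < T) fdiff (fdiff g) i * relu (t%:R - i.+1%:R).
Proof.
elim: t => [|t IH] tT.
  rewrite mulr0 addr0 big1 ?addr0 // => i _; rewrite relu_neg ?mulr0 //.
have -> : g t.+1 = g t + fdiff g t by rewrite /fdiff addrC subrK.
rewrite IH; last exact: ltnW.
have -> : fdiff g t = fdiff g 0 + \sum_(i < T) fdiff (fdiff g) i * (i < t)%N%:R.
  have hk k : (k <= T)%N -> fdiff g k = fdiff g 0 + \sum_(i < k) fdiff (fdiff g) i.
    elim: k => [|k IHk] kT; first by rewrite big_ord0 addr0.
    by rewrite big_ord_recr /= addrA -IHk ?(ltnW kT) // {2}/fdiff addrC subrK.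
  rewrite hk; last exact: ltnW.
  congr (_ + _); rewrite (big_ord_widen T (fun i => fdiff (fdiff g) i)); last exact: ltnW.
  by rewrite big_mkcond /=; apply: eq_bigr => i _; case: (i < t)%N; rewrite ?mulr1 ?mulr0.
rewrite -natr1 mulrDr mulr1.
have -> : \sum_(i < T) fdiff (fdiff g) i * relu (t%:R + 1 - i.+1%:R) =
  \sum_(i < T) fdiff (fdiff g) i * relu (t%:R - i.+1%:R) + \sum_(i < T) fdiff (fdiff g) i * (i < t)%N%:R.
  rewrite -big_split; apply: eq_bigr => i _ /=; rewrite -mulrDr; congr (_ * _).
  case: (ltnP i t) => it.
    have h : i.+1%:R <= t%:R :> R by rewrite ler_nat.
    have h1 : relu (t%:R + 1 - i.+1%:R) = t%:R + 1 - i.+1%:R :> R by apply: relu_pos; lra.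
    have h2 : relu (t%:R - i.+1%:R) = t%:R - i.+1%:R :> R by apply: relu_pos; lra.
    by rewrite h1 h2 /= mulr1n; ring.
  have h : t%:R + 1 <= i.+1%:R :> R by rewrite natr1 ler_nat.
  by rewrite /= !relu_neg ?addr0 //; lra.
by ring.
Qed.

(** The neurons are the constant [el], the linear [w0], which is never cut because its value [t] is
    nonnegative, and one kink at each integer. The arguments of the ridge function are shifted in
    advance to natural numbers up to [T]. *)
Lemma ridge_net (d : nat) (g : nat -> R) (T : nat) (w0 : 'rV[R]_d.+1) :
  (0 < T)%N -> \sum_j `|w0 0 j| <= T%:R ->
  exists s : seq (R * 'rV[R]_d.+1),
    seq_mass s <= T%:R^-1 * (\sum_(i < T) `|g i|) + 2 * (\sum_(i < T) `|fdiff g i|)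
      + 3 * T%:R * (\sum_(i < T) `|fdiff (fdiff g) i|) /\
    forall x (t : nat), (t <= T)%N -> dotv (ext x) w0 = t%:R -> seq_net s x = g t.
Proof.
move=> T0 hw; have TR : 0 < T%:R :> R by rewrite ltr0n.
pose el : 'rV[R]_d.+1 := delta_mx 0 ord_max.
have dot_el (x : 'rV[R]_d) : dotv (ext x) el = 1.
  rewrite /dotv (bigD1 ord_max) //= /ext !mxE !eqxx unlift_none mulr1 big1 ?addr0 //.
  by move=> j jm; rewrite !mxE (negPf jm) mulr0.
have l1_el : \sum_j `|el 0 j| = 1.
  rewrite (bigD1 ord_max) //= mxE !eqxx normr1 big1 ?addr0 // => j jm.
  by rewrite mxE (negPf jm) normr0.
pose s := (g 0%N, el) :: (fdiff g 0, w0) ::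
   [seq (fdiff (fdiff g) i, w0 - i.+1%:R *: el) | i : 'I_T <- index_enum 'I_T].
exists s; split; last first.
  move=> x t tT xt; rewrite /seq_net !big_cons big_map /= dot_el xt.
  rewrite (@second_difference_expansion g T t) // (relu_pos ler01) mulr1 (relu_pos (ler0n _ _)) addrA.
  by congr (_ + _); apply: eq_bigr => i _; rewrite dotvBr dotvZr dot_el mulr1 xt.
rewrite /seq_mass !big_cons big_map /=.
have b1 : `|g 0%N| * enorm el <= `|g 0%N|.
  by rewrite ler_piMr // (le_trans (enorm_le_l1 _)) // l1_el.
have b2 : `|fdiff g 0| * enorm w0 <= \sum_(i < T) `|fdiff g i| + T%:R * \sum_(i < T) `|fdiff (fdiff g) i|.
  apply: (@le_trans _ _ (`|fdiff g 0| * T%:R)).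
    by rewrite ler_wpM2l // (le_trans (enorm_le_l1 _)).
  have := fdiff_avg_bound (fdiff g) T0; rewrite -(ler_pM2l TR) mulrDr mulrA divff ?gt_eqF // mul1r.
  by rewrite mulrC.
have b3 : \sum_(i < T) `|fdiff (fdiff g) i| * enorm (w0 - i.+1%:R *: el) <=
   2 * T%:R * \sum_(i < T) `|fdiff (fdiff g) i|.
  rewrite mulr_sumr; apply: ler_sum => i _; rewrite mulrC ler_wpM2r //.
  apply: le_trans (enorm_le_l1 _) _.
  apply: (@le_trans _ _ (\sum_j (`|w0 0 j| + i.+1%:R * `|el 0 j|))).
    apply: ler_sum => j _; rewrite !mxE (le_trans (ler_normB _ _)) // lerD2l.
    by rewrite normrM ger0_norm.
  rewrite big_split /= -mulr_sumr l1_el mulr1.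
  have : i.+1%:R <= T%:R :> R by rewrite ler_nat.
  by move: hw; clear; lra.
have b4 := fdiff_avg_bound g T0.
move: b1 b2 b3 b4; set e1 := _ * enorm el; set e2 := _ * enorm w0; set e3 := \sum_(i < T) _ * _.
set s0 := T%:R^-1 * _; set s1 := \sum_(i < T) `|fdiff g i|; set s2 := \sum_(i < T) `|fdiff (fdiff g) i|.
move: (T%:R * s2) (mulrA 2 T%:R s2) (mulrA 3 T%:R s2) => u <- <-; clear; lra.
Qed.

End Ridge.

(** * Complex exponentials and orthogonality *)

Section Fourier.
Variable R : realType.
Local Notation C := (complex R).

Definition n2 (z : C) : R := complex.Re z ^+ 2 + complex.Im z ^+ 2.

Lemma n2_ge0 z : 0 <= n2 z.
Proof. by rewrite /n2 addr_ge0 ?sqr_ge0. Qed.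

Lemma n2M z w : n2 (z * w) = n2 z * n2 w.
Proof. by case: z => a b; case: w => c d; rewrite /n2 /=; ring. Qed.

Lemma n20 : n2 0 = 0.
Proof. by rewrite /n2 /= expr0n addr0. Qed.

Lemma n21 : n2 1 = 1.
Proof. by rewrite /n2 /= expr1n expr0n addr0. Qed.

Lemma n2N z : n2 (- z) = n2 z.
Proof. by case: z => a b; rewrite /n2 /= !sqrrN. Qed.

Lemma n2X z k : n2 (z ^+ k) = n2 z ^+ k.
Proof. by elim: k => [|k IH]; rewrite ?expr0 ?n21 // !exprS n2M IH. Qed.

Lemma mul_conjc_n2 (z : C) : z * conjc z = (real_complex R (n2 z)).
Proof. by case: z => a b; rewrite /n2; apply/eqP; rewrite eq_complex /=; apply/andP; split; apply/eqP; ring. Qed.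

Lemma Re_le_n2 z : complex.Re z ^+ 2 <= n2 z.
Proof. by rewrite /n2 lerDl sqr_ge0. Qed.

Lemma n2_real (x : R) : n2 (real_complex R x) = x ^+ 2.
Proof. by rewrite /n2 /= expr0n addr0. Qed.

Lemma Re_sum (I : Type) (r : seq I) (P : pred I) (F : I -> C) :
  complex.Re (\sum_(i <- r | P i) F i) = \sum_(i <- r | P i) complex.Re (F i).
Proof. by apply: (big_morph (@complex.Re R)) => // -[a b] [c d]. Qed.

Lemma Im_sum (I : Type) (r : seq I) (P : pred I) (F : I -> C) :
  complex.Im (\sum_(i <- r | P i) F i) = \sum_(i <- r | P i) complex.Im (F i).
Proof. by apply: (big_morph (@complex.Im R)) => // -[a b] [c d]. Qed.

Lemma sqr_sum_le (I : finType) (P : pred I) (x : I -> R) :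
  (\sum_(i | P i) x i) ^+ 2 <= #|P|%:R * \sum_(i | P i) x i ^+ 2.
Proof.
have h : 0 <= \sum_(i | P i) \sum_(j | P j) (x i - x j) ^+ 2.
  by apply: sumr_ge0 => i _; apply: sumr_ge0 => j _; exact: sqr_ge0.
have e : \sum_(i | P i) \sum_(j | P j) (x i - x j) ^+ 2 =
   2 * (#|P|%:R * \sum_(i | P i) x i ^+ 2) - 2 * (\sum_(i | P i) x i) ^+ 2.
  have -> : (\sum_(i | P i) x i) ^+ 2 = \sum_(i | P i) \sum_(j | P j) x i * x j.
    by rewrite expr2 mulr_suml; apply: eq_bigr => i _; rewrite mulr_sumr.
  have c1 : \sum_(i | P i) \sum_(j | P j) x i ^+ 2 = #|P|%:R * \sum_(i | P i) x i ^+ 2.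
    rewrite mulr_sumr; apply: eq_bigr => i _.
    by rewrite sumr_const mulr_natl.
  have c2 : \sum_(i | P i) \sum_(j | P j) x j ^+ 2 = #|P|%:R * \sum_(i | P i) x i ^+ 2.
    by rewrite exchange_big.
  rewrite (_ : 2 * (_ * _) = \sum_(i | P i) \sum_(j | P j) x i ^+ 2 + \sum_(i | P i) \sum_(j | P j) x j ^+ 2); last first.
    by rewrite c1 c2; ring.
  rewrite mulr_sumr -big_split -sumrB; apply: eq_bigr => i _ /=.
  rewrite mulr_sumr -big_split -sumrB; apply: eq_bigr => j _ /=.
  by ring.
rewrite e in h; move: h; clear; lra.
Qed.

Lemma n2_sum_le (I : finType) (P : pred I) (z : I -> C) :
  n2 (\sum_(i | P i) z i) <= #|P|%:R * \sum_(i | P i) n2 (z i).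
Proof.
rewrite /n2 Re_sum Im_sum big_split mulrDr lerD //; exact: sqr_sum_le.
Qed.

Lemma n2B_le z w : n2 (z - w) <= 2 * (n2 z + n2 w).
Proof.
case: z => a b; case: w => c d; rewrite /n2 /=.
have := sqr_ge0 (a + c); have := sqr_ge0 (b + d); rewrite !expr2; clear; lra.
Qed.

Definition cexp (t : R) : C := Complex (cos (pi *+ 2 * t)) (sin (pi *+ 2 * t)).

Lemma cexpD s t : cexp (s + t) = cexp s * cexp t.
Proof.
apply/eqP; rewrite eq_complex /= mulrDr cosD sinD; apply/andP; split; apply/eqP => //.
by rewrite addrC; congr (_ + _); rewrite mulrC.
Qed.

Lemma cexp0 : cexp 0 = 1.
Proof. by apply/eqP; rewrite eq_complex /= mulr0 cos0 sin0 !eqxx. Qed.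

Lemma cexpN t : cexp (- t) = conjc (cexp t).
Proof. by apply/eqP; rewrite eq_complex /= mulrN cosN sinN !eqxx. Qed.

Lemma n2_cexp t : n2 (cexp t) = 1.
Proof. by rewrite /n2 /= cos2Dsin2. Qed.

Lemma cexp_mulrn t k : cexp (t * k%:R) = cexp t ^+ k.
Proof.
elim: k => [|k IH]; first by rewrite mulr0 cexp0.
by rewrite -natr1 mulrDr mulr1 cexpD IH exprSr.
Qed.

Lemma cexp1 : cexp 1 = 1.
Proof. by apply/eqP; rewrite eq_complex /= mulr1 cos2pi sin2pi !eqxx. Qed.

Lemma cexp_int (k : int) : cexp k%:~R = 1.
Proof.
have h (j : nat) : cexp j%:R = 1 by rewrite -[j%:R]mul1r cexp_mulrn cexp1 expr1n.
case: k => j; first exact: h.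
by rewrite NegzE mulrNz cexpN -pmulrn h; apply/eqP; rewrite eq_complex /= oppr0 !eqxx.
Qed.

Lemma n2_cexp_sub1 t : n2 (cexp t - 1) = 2 - 2 * cos (pi *+ 2 * t).
Proof.
rewrite /n2 /= subr0; have := cos2Dsin2 (pi *+ 2 * t); set a := cos _; set b := sin _.
move=> h; have -> : (a - 1) ^+ 2 + b ^+ 2 = (a ^+ 2 + b ^+ 2) + 1 - 2 * a by ring.
by rewrite h.
Qed.

Lemma two_pi_mul (t : R) : pi *+ 2 * t = pi * t + pi * t.
Proof. by rewrite mulr2n mulrDl. Qed.

Lemma sin_le_abs (x : R) : sin x ^+ 2 <= x ^+ 2.
Proof.
wlog x0 : x / 0 < x.
  move=> hw; case: (ltgtP x 0) => h; last by rewrite h sin0.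
    by rewrite -[x in leRHS]opprK sqrrN -[sin x ^+ 2]sqrrN -sinN hw // oppr_gt0.
  exact: hw.
have [c _] := @MVT R sin cos 0 x x0 (fun y _ => is_derive_sin y)
  (continuous_subspaceT (@continuous_sin R)).
rewrite sin0 !subr0 => ->; rewrite exprMn -[leRHS]mul1r ler_wpM2r ?sqr_ge0 //.
Qed.

Lemma n2_cexp_sub1_le t : n2 (cexp t - 1) <= 64 * t ^+ 2.
Proof.
rewrite n2_cexp_sub1 two_pi_mul cosD.
have -> : 2 - 2 * (cos (pi * t) * cos (pi * t) - sin (pi * t) * sin (pi * t)) = 4 * sin (pi * t) ^+ 2.
  by have := cos2Dsin2 (pi * t); rewrite !expr2; lra.
have h := sin_le_abs (pi * t).
have p4 : pi ^+ 2 <= 16 :> R.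
  have p0 := pi_ge0 R; have := pihalf_lt2 R => p1.
  have -> : 16 = 4 ^+ 2 :> R by ring.
  by rewrite lerXn2r ?nnegrE //; lra.
have := ler_wpM2r (sqr_ge0 t) p4; rewrite -exprMn; lra.
Qed.

Lemma n2_cexpB_le s t : n2 (cexp s - cexp t) <= 64 * (s - t) ^+ 2.
Proof.
have -> : cexp s - cexp t = cexp t * (cexp (s - t) - 1).
  by rewrite mulrBr mulr1 -cexpD [t + _]addrC subrK.
by rewrite n2M n2_cexp mul1r n2_cexp_sub1_le.
Qed.

(** Between a quarter and half a turn the cosine is nonpositive. This is how a difference of
    suitable step detects a dyadic block of frequencies. *)
Lemma n2_cexp_sub1_ge t : 1 / 4 <= `|t| <= 1 / 2 -> 2 <= n2 (cexp t - 1).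
Proof.
move=> /andP[t1 t2]; rewrite n2_cexp_sub1.
have -> : cos (pi *+ 2 * t) = cos (pi *+ 2 * `|t|).
  case: (leP 0 t) => h; first by rewrite ger0_norm.
  by rewrite ltr0_norm // mulrN cosN.
suff : cos (pi *+ 2 * `|t|) <= 0 by lra.
have p0 := pi_gt0 R.
have -> : pi *+ 2 * `|t| = (pi *+ 2 * `|t| - pi) + pi by rewrite subrK.
rewrite cosDpi oppr_le0; apply: cos_ge0_pihalf; rewrite two_pi_mul.
have h1 := ler_wpM2l (ltW p0) t1; have h2 := ler_wpM2l (ltW p0) t2.
by apply/andP; split; lra.
Qed.

Lemma n2_cexp_sub1_doubling t (i : nat) :
  n2 (cexp (t * (2 ^ i)%:R) - 1) <= 4 ^+ i * n2 (cexp t - 1).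
Proof.
elim: i => [|i IH]; first by rewrite expn0 mulr1 mul1r.
have -> : t * (2 ^ i.+1)%:R = t * (2 ^ i)%:R + t * (2 ^ i)%:R.
  by rewrite expnS natrM; ring.
set u := t * _ in IH *.
have -> : cexp (u + u) - 1 = (cexp u - 1) * (cexp u - - 1).
  by rewrite cexpD opprK; ring.
rewrite n2M exprS -mulrA mulrC; apply: ler_pM; rewrite ?n2_ge0 //.
by rewrite (le_trans (n2B_le _ _)) // n2_cexp n2N n21; lra.
Qed.

Lemma cexp_neq1 t : 0 < `|t| < 1 -> cexp t != 1.
Proof.
move=> /andP[t0 t1]; apply/eqP => h.
have : n2 (cexp t - 1) = 0 by rewrite h subrr n20.
rewrite n2_cexp_sub1.
have -> : cos (pi *+ 2 * t) = cos (pi *+ 2 * `|t|).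
  case: (leP 0 t) => h'; first by rewrite ger0_norm.
  by rewrite ltr0_norm // mulrN cosN.
rewrite two_pi_mul cosD.
have p0 := pi_gt0 R.
have s0 : 0 < sin (pi * `|t|).
  apply: sin_gt0_pi; rewrite mulr_gt0 //=.
  by rewrite -[ltRHS]mulr1 ltr_pM2l.
have := cos2Dsin2 (pi * `|t|); have : 0 < sin (pi * `|t|) ^+ 2 by rewrite exprn_gt0.
by rewrite !expr2; lra.
Qed.

Lemma cexp_orth (N : nat) (k : int) : (0 < N)%N -> (`|k| < N)%N ->
  \sum_(z < N) cexp (k%:~R * z%:R / N%:R) = if k == 0 then N%:R else 0.
Proof.
move=> N0 kN; have NR : 0 < N%:R :> R by rewrite ltr0n.
have e z : cexp (k%:~R * z%:R / N%:R) = cexp (k%:~R / N%:R) ^+ z.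
  by rewrite -cexp_mulrn mulrAC.
under eq_bigr do rewrite e.
case: eqP => [->|/eqP k0].
  rewrite mul0r cexp0; under eq_bigr do rewrite expr1n.
  by rewrite sumr_const card_ord.
set q := cexp _.
have q1 : q != 1.
  apply: cexp_neq1; rewrite normrM normfV (gtr0_norm NR) -intr_norm.
  rewrite divr_gt0 //=; last by rewrite ltr0z normr_gt0.
  by rewrite ltr_pdivrMr // mul1r -[N%:R]/((N%:Z)%:~R) ltr_int -abszE ltz_nat.
have qN : q ^+ N = 1.
  by rewrite /q -cexp_mulrn divfK ?gt_eqF // cexp_int.
have : (q - 1) * \sum_(z < N) q ^+ z = 0 by rewrite -subrX1 qN subrr.
by move/eqP; rewrite mulf_eq0 subr_eq0 (negPf q1) => /eqP.
Qed.

Section Orthogonal.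
Variables (A K : finType) (E : K -> A -> C) (N : R).
Hypothesis orthE : forall k k', \sum_a E k a * conjc (E k' a) =
  if k == k' then real_complex R N else 0.

Lemma parseval (b : K -> C) :
  \sum_a n2 (\sum_k b k * E k a) = N * \sum_k n2 (b k).
Proof.
apply: (@complexI R); rewrite rmorphM !rmorph_sum /=.
transitivity (\sum_a \sum_k \sum_k' (b k * conjc (b k')) * (E k a * conjc (E k' a))).
  apply: eq_bigr => a _; rewrite -mul_conjc_n2 rmorph_sum mulr_suml; apply: eq_bigr => k _.
  by rewrite mulr_sumr; apply: eq_bigr => k' _; rewrite rmorphM /=; ring.
rewrite exchange_big /= mulr_sumr; apply: eq_bigr => k _.
rewrite exchange_big /= (bigD1 k) //= -mulr_sumr orthE eqxx mul_conjc_n2.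
rewrite big1 ?addr0; last first.
  by move=> k' kk'; rewrite -mulr_sumr orthE eq_sym (negPf kk') mulr0.
by rewrite mulrC.
Qed.

End Orthogonal.
End Fourier.

(** * Finite differences, discrete and directional *)

Section Differences.
Variable R : realType.

Definition dsh (s : nat) (g : nat -> R) (t : nat) : R := g (t + s)%N - g t.
(** The steps may differ from one difference to the next, because the error of a box average is an
    average of differences with many steps. *)
Fixpoint dseq (l : seq nat) (g : nat -> R) : nat -> R :=
  if l is s :: l' then dseq l' (dsh s g) else g.

Lemma dseq_eq (l : seq nat) (u v : nat -> R) (T t : nat) :
  (forall i, (i <= T)%N -> u i = v i) -> (t + sumn l <= T)%N -> dseq l u t = dseq l v t.
Proof.
elim: l u v T => [|s l IH] u v T uv /=; first by rewrite addn0; exact: uv.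
rewrite addnA addnAC => h; apply: (IH _ _ (T - s)%N) => [i iT|]; last by lia.
by rewrite /dsh !uv //; lia.
Qed.

Lemma dseqD (l : seq nat) (u v : nat -> R) t :
  dseq l (fun i => u i + v i) t = dseq l u t + dseq l v t.
Proof.
elim: l u v => //= s l IH u v; rewrite -IH; congr (dseq l _ t); apply/funext => i.
by rewrite /dsh; ring.
Qed.

Lemma dseqZ (l : seq nat) (c : R) (u : nat -> R) t :
  dseq l (fun i => c * u i) t = c * dseq l u t.
Proof.
elim: l u => //= s l IH u; rewrite -IH; congr (dseq l _ t); apply/funext => i.
by rewrite /dsh; ring.
Qed.

Lemma dseq_shift (l : seq nat) (u : nat -> R) s t :
  dseq l (fun i => u (i + s)%N) t = dseq l u (t + s)%N.
Proof.
elim: l u => //= s' l IH u; rewrite -IH; congr (dseq l _ t); apply/funext => i.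
by rewrite /dsh addnAC.
Qed.

Lemma leibniz_bound (S : nat) (c : R) (l : seq nat) (u v : nat -> R) :
  all (fun s => s <= S)%N l ->
  (forall l1 l2, (size l1 + size l2 = size l)%N -> all (fun s => s <= S)%N l1 ->
     all (fun s => s <= S)%N l2 -> forall a b, `|dseq l1 u a| * `|dseq l2 v b| <= c) ->
  forall t, `|dseq l (fun i => u i * v i) t| <= 2 ^+ size l * c.
Proof.
elim: l u v => [|s l IH] u v /= hl hc t.
  by rewrite normrM mul1r; exact: (hc [::] [::]).
case/andP: hl => sS hl.
have -> : dsh s (fun i => u i * v i) = (fun i => dsh s u i * v (i + s)%N + u i * dsh s v i).
  by apply/funext => i; rewrite /dsh; ring.
rewrite dseqD (le_trans (ler_normD _ _)) // exprS -mulrA mulr2n mulrDl mul1r lerD //.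
  apply: (IH (dsh s u) (fun i => v (i + s)%N)) => // l1 l2 e h1 h2 a b.
  rewrite dseq_shift; apply: (hc (s :: l1) l2) => //=; first by rewrite addSn e.
  by rewrite sS h1.
apply: (IH u (dsh s v)) => // l1 l2 e h1 h2 a b.
apply: (hc l1 (s :: l2)) => //=; first by rewrite addnS e.
by rewrite sS h2.
Qed.

Definition mavg (w : nat) (g : nat -> R) (t : nat) : R := w%:R^-1 * \sum_(i < w) g (t + i)%N.

Lemma mavg_dsh w s g : mavg w (dsh s g) = dsh s (mavg w g).
Proof.
apply/funext => t; rewrite /mavg /dsh -mulrBr -sumrB; congr (_ * _).
by apply: eq_bigr => i _; rewrite addnAC.
Qed.

Lemma iter_mavg_dsh w s k g : iter k (mavg w) (dsh s g) = dsh s (iter k (mavg w) g).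
Proof. by elim: k => //= k ->; rewrite mavg_dsh. Qed.

Lemma mavg_bound w g (c : R) : (0 < w)%N -> (forall t, `|g t| <= c) ->
  forall t, `|mavg w g t| <= c.
Proof.
move=> w0 gc t; have wR : 0 < w%:R :> R by rewrite ltr0n.
rewrite /mavg normrM normfV (gtr0_norm wR) mulrC ler_pdivrMr //.
rewrite (le_trans (ler_norm_sum _ _ _)) // (le_trans (y := \sum_(i < w) c)) //.
  by apply: ler_sum.
by rewrite sumr_const card_ord mulr_natr.
Qed.

Lemma dsh_mavg_bound w s g (c : R) : (0 < w)%N -> (forall t, `|g t| <= c) ->
  forall t, `|dsh s (mavg w g) t| <= s%:R * (2 * c / w%:R).
Proof.
move=> w0 gc; have wR : 0 < w%:R :> R by rewrite ltr0n.
have h1 t : `|mavg w g t.+1 - mavg w g t| <= 2 * c / w%:R.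
  have -> : mavg w g t.+1 - mavg w g t = w%:R^-1 * (g (t + w)%N - g t).
    have tel k : \sum_(i < k) g (t.+1 + i)%N - \sum_(i < k) g (t + i)%N = g (t + k)%N - g t.
      elim: k => [|k IH]; first by rewrite !big_ord0 addn0 !subrr.
      by rewrite !big_ord_recr /= opprD addrACA IH addnS; ring.
    by rewrite /mavg -mulrBr tel.
  rewrite normrM normfV (gtr0_norm wR) mulrC ler_pM2r ?invr_gt0 //.
  by rewrite (le_trans (ler_normB _ _)) //; have := gc (t + w)%N; have := gc t; lra.
move=> t; elim: s => [|s IH]; first by rewrite /dsh addn0 subrr normr0 mul0r.
have -> : dsh s.+1 (mavg w g) t = dsh s (mavg w g) t + (mavg w g (t + s).+1 - mavg w g (t + s)).
  by rewrite /dsh addnS; ring.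
by rewrite (le_trans (ler_normD _ _)) // -natr1 mulrDl mul1r lerD.
Qed.

(** Each difference is absorbed by one of the [k] averages: a unit shift of a box average of width
    [w] telescopes to two boundary terms, so a step [s] gains the factor [2 * s / w]. *)
Lemma dseq_iter_mavg_bound w k (l : seq nat) g (c del : R) : (0 < w)%N -> (size l <= k)%N ->
  (forall s, s \in l -> s%:R / w%:R <= del) -> 0 <= del ->
  (forall t, `|g t| <= c) -> forall t, `|dseq l (iter k (mavg w) g) t| <= (2 * del) ^+ size l * c.
Proof.
move=> w0; elim: l k g c => [|s l IH] k g c /= lk ls del0 gc t.
  rewrite mul1r; elim: k lk t => [|k IHk] _ t; first exact: gc.
  by rewrite iterS; apply: mavg_bound => // t'; exact: IHk.
case: k lk => // k lk.
have -> : dsh s (iter k.+1 (mavg w) g) = iter k (mavg w) (dsh s (mavg w g)).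
  by rewrite iterSr iter_mavg_dsh.
rewrite exprSr -mulrA; apply: IH => //; first by move=> s' s'l; apply: ls; rewrite inE s'l orbT.
move=> t'; apply: le_trans (dsh_mavg_bound s w0 gc t') _.
have c0 : 0 <= c := le_trans (normr_ge0 _) (gc 0%N).
have -> : s%:R * (2 * c / w%:R) = 2 * (s%:R / w%:R) * c by ring.
by rewrite ler_wpM2r // ler_wpM2l // ls // inE eqxx.
Qed.

Section Directional.
Variables (d : nat) (j : 'I_d).
Let e : 'rV[R]_d := delta_mx 0 j.

Definition dirdiff (h : R) (G : 'rV[R]_d -> R) (y : 'rV[R]_d) : R := G (y + h *: e) - G y.
Fixpoint dirseq (hs : seq R) (G : 'rV[R]_d -> R) : 'rV[R]_d -> R :=
  if hs is h :: hs' then dirseq hs' (dirdiff h G) else G.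

Definition line_derive (G G' : 'rV[R]_d -> R) :=
  forall y t, is_derive (t : R) (1 : R) (fun s : R => G (y + s *: e)) (G' (y + t *: e)).

Lemma line_derive_dirdiff h G G' : line_derive G G' -> line_derive (dirdiff h G) (dirdiff h G').
Proof.
move=> GG' y t; rewrite /dirdiff.
have -> : (fun s : R => G (y + s *: e + h *: e) - G (y + s *: e)) =
  (fun s : R => G (y + h *: e + s *: e)) \- (fun s : R => G (y + s *: e)).
  by apply/funext => s /=; rewrite addrAC.
by rewrite addrAC; apply: is_deriveB.
Qed.

Lemma line_derive_dirseq hs G G' : line_derive G G' -> line_derive (dirseq hs G) (dirseq hs G').
Proof. by elim: hs G G' => //= h hs IH G G' GG'; apply: IH; exact: line_derive_dirdiff. Qed.

Lemma dirseq_rcons_dirdiff hs h G y :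
  dirseq hs (dirdiff h G) y = dirseq hs G (y + h *: e) - dirseq hs G y.
Proof.
elim: hs G => //= h' hs IH G; rewrite -IH; congr (dirseq hs _ y); apply/funext => z.
by rewrite /dirdiff (addrAC z); ring.
Qed.

Lemma dirdiff_mvt h hs G G' (c : R) y : 0 <= h -> line_derive G G' ->
  (forall z, `|dirseq hs G' z| <= c) -> `|dirseq (h :: hs) G y| <= h * c.
Proof.
move=> h0 GG' hc /=; rewrite dirseq_rcons_dirdiff.
have [->|hn] := eqVneq h 0; first by rewrite scale0r addr0 subrr normr0 mul0r.
have hp : 0 < h by rewrite lt_neqAle eq_sym hn.
have ld := line_derive_dirseq hs GG'.
have [t _] := @MVT R (fun s => dirseq hs G (y + s *: e)) (fun s => dirseq hs G' (y + s *: e)) 0 h hp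
  (fun s _ => ld y s)
  ltac:(apply: derivable_within_continuous => s _; exact: @ex_derive _ _ _ _ _ _ _ (ld y s)).
rewrite scale0r addr0 subr0 => ->; rewrite normrM (gtr0_norm hp) mulrC ler_wpM2l //.
Qed.

Lemma line_derive_pdiff G : (forall x, differentiable G x) -> line_derive G (pdiff j G).
Proof.
move=> dG y t.
have dv : derivable G (y + t *: e) e by exact: diff_derivable.
have eqf : (fun h : R => h^-1 *: ((fun s : R => G (y + s *: e)) (h *: (1 : R) + t) - (fun s : R => G (y + s *: e)) t)) =
   (fun h : R => h^-1 *: (G (h *: e + (y + t *: e)) - G (y + t *: e))).
  apply/funext => h; congr (_ *: (G _ - _)).
  by rewrite /GRing.scale /= mulr1 -/(GRing.scale _ _) scalerDl addrCA.
split; first by rewrite /derivable eqf; exact: dv.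
by rewrite /derive eqf.
Qed.

(** The mean value theorem trades a difference for a derivative as long as the order is below [r];
    the difference left over at order [r] is estimated by the Hoelder clause, whence the factor with
    [beta]. Quantifying over [s] lets the induction on [hs] pass to [j :: s]. *)
Lemma dpart_dirseq_bound (r : nat) (beta c del : R) (F : 'rV[R]_d -> R) :
  0 < beta <= 1 -> holder_norm_le r beta F c -> 0 <= del ->
  forall hs : seq R, all (fun h => 0 <= h <= del) hs ->
  forall s : seq 'I_d,
  ((size s + size hs <= r)%N -> forall y, `|dirseq hs (dpart s F) y| <= c * del ^+ size hs) /\
  (hs != [::] -> (size s + size hs = r.+1)%N ->
     forall y, `|dirseq hs (dpart s F) y| <= c * (del ^+ (size hs).-1 * del `^ beta)).
Proof.
move=> /andP[b0 b1] [hd hb hh] del0; elim=> [|h hs IH] /=.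
  by move=> _ s; split => // sr y; rewrite mulr1 hb //; move: sr; rewrite addn0.
move=> /andP[/andP[h0 hdel] hhs] s; split.
  move=> sz y.
  have ss : (size s < r)%N by rewrite (leq_trans _ sz) // addnS ltnS leq_addr.
  have [IH1 _] := IH hhs (j :: s).
  have bd := dirdiff_mvt y h0 (line_derive_pdiff (hd s ss)) (IH1 ltac:(by rewrite /= addSnnS)).
  have c0 : 0 <= c * del ^+ size hs.
    by apply: le_trans (normr_ge0 _) (IH1 _ y); rewrite /= addSnnS.
  by apply: le_trans bd _; rewrite exprS [leRHS]mulrCA ler_wpM2r.
move=> _ sz y; case: hs IH hhs sz => [|h' hs] IH hhs sz.
  rewrite /= expr0 mul1r /dirdiff.
  have [->|hn] := eqVneq h 0.
    rewrite scale0r addr0 subrr normr0 mulr_ge0 ?powR_ge0 //.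
    by rewrite (le_trans _ (hb [::] _ y)).
  have hp : 0 < h by rewrite lt_neqAle eq_sym hn.
  have en : enorm (h *: e) = h.
    rewrite /enorm /dotv (bigD1 j) //= !mxE !eqxx mulr1 big1 ?addr0 ?sqrtr_sqr ?ger0_norm //.
    by move=> i ij; rewrite !mxE (negPf ij) andbF !mulr0.
  have ss : size s = r by move: sz => /=; rewrite addn1 => -[].
  have ne : y + h *: e != y.
    apply/eqP => /(congr1 (fun v => enorm (v - y))).
    rewrite addrAC subrr add0r en => h00.
    by move: hn; rewrite h00 /enorm /dotv big1 ?sqrtr0 ?eqxx // => i _; rewrite mxE mul0r.
  apply: le_trans (hh s ss _ _ ne) _; rewrite addrAC subrr add0r en.
  rewrite ler_wpM2l //; first by rewrite (le_trans _ (hb [::] _ y)).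
  by apply: ge0_ler_powR => //; rewrite ?nnegrE // ltW.
have ss : (size s < r)%N by move: sz => /=; rewrite !addnS => -[] <-; rewrite ltnS leq_addr.
have [_ IH2] := IH hhs (j :: s).
have bd := dirdiff_mvt y h0 (line_derive_pdiff (hd s ss)) (IH2 isT ltac:(by rewrite /= -sz addSnnS)).
have c0 : 0 <= c by rewrite (le_trans _ (hb [::] _ y)).
apply: le_trans bd _; rewrite /= exprS -[X in _ <= _ * X]mulrA [leRHS]mulrCA ler_wpM2r //.
by rewrite mulr_ge0 // mulr_ge0 ?powR_ge0 ?exprn_ge0.
Qed.

Lemma dseq_line (Q : R) (G : 'rV[R]_d -> R) (x : 'rV[R]_d) (l : seq nat) (t : nat) :
  dseq l (fun i => G (x + (i%:R / Q) *: e)) t =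
  dirseq [seq s%:R / Q | s <- l] G (x + (t%:R / Q) *: e).
Proof.
elim: l G => //= s l IH G; rewrite -IH; congr (dseq l _ t); apply/funext => i.
by rewrite /dsh /dirdiff -addrA -scalerDl -mulrDl -natrD.
Qed.

End Directional.
End Differences.

(** * Fourier analysis on the discrete torus *)

Section Torus.
Variable R : realType.
Local Notation C := (complex R).
Variables (d H : nat).
Local Notation n := (H.*2.+1).
Local Notation G := {ffun 'I_d -> 'I_H.*2.+1}.

(** The representative of the frequency in [[-H, H]]. The period is odd so that this range is
    symmetric. *)
Definition kap (y : 'I_n) : int := if (y <= H)%N then y%:Z else y%:Z - n%:Z.

Lemma absz_kap (y : 'I_n) : (`|kap y| <= H)%N.
Proof. by rewrite /kap; have := ltn_ord y; move: (nat_of_ord y) => i iy; case: ifP => h; lia. Qed.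

Lemma kap_inj : injective kap.
Proof.
move=> y y'; rewrite /kap; have := ltn_ord y; have := ltn_ord y'.
move=> a b e; apply: val_inj => /=; move: a b e; move: (nat_of_ord y) (nat_of_ord y') => i i'.
by case: ifP => h; case: ifP => h' a b e; lia.
Qed.

Lemma nR_gt0 : 0 < n%:R :> R. Proof. by rewrite ltr0n. Qed.

Definition chi (k a : G) : C := \prod_l cexp ((kap (k l))%:~R * (a l)%:R / n%:R).

Lemma conjc_prod (I : finType) (z : I -> C) : conjc (\prod_i z i) = \prod_i conjc (z i).
Proof. exact: rmorph_prod. Qed.

Lemma prod_delta (k k' : G) :
  \prod_l (if k l == k' l then n%:R else 0) = if k == k' then real_complex R (n%:R ^+ d) else 0 :> C.
Proof.
case: eqP => [->|/eqP kk'].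
  rewrite (eq_bigr (fun=> n%:R)) => [|l _]; last by rewrite eqxx.
  by rewrite prodr_const card_ord rmorphXn /= rmorph_nat.
have [l kl] : exists l, k l != k' l.
  apply/existsP; rewrite -negb_forall; apply: contra kk' => /forallP h.
  by apply/eqP/ffunP => l; apply/eqP/h.
by rewrite (bigD1 l) //= (negPf kl) mul0r.
Qed.

Lemma chi_orth_pos (k k' : G) : \sum_a chi k a * conjc (chi k' a) =
  if k == k' then real_complex R (n%:R ^+ d) else 0.
Proof.
rewrite -prod_delta.
have -> : \sum_a chi k a * conjc (chi k' a) =
   \sum_(a : G) \prod_l cexp ((kap (k l) - kap (k' l))%:~R * (a l)%:R / n%:R).
  apply: eq_bigr => a _; rewrite /chi conjc_prod -big_split; apply: eq_bigr => l _; rewrite -cexpN /=.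
  by rewrite -cexpD -mulNr -mulNr -!mulrDl rmorphB.
rewrite -(bigA_distr_bigA (fun l (y : 'I_n) => cexp ((kap (k l) - kap (k' l))%:~R * y%:R / n%:R))).
apply: eq_bigr => l _; rewrite cexp_orth //.
  by rewrite subr_eq0 (inj_eq kap_inj).
by have := absz_kap (k l); have := absz_kap (k' l); move: (kap _) (kap _) => i i' a b; lia.
Qed.

Lemma cexp_kap (y : 'I_n) (b : int) :
  cexp ((kap y)%:~R * b%:~R / n%:R) = cexp (b%:~R * y%:R / n%:R) :> C.
Proof.
have nn := nR_gt0; rewrite /kap; case: ifP => _; first by rewrite [X in cexp (X / _)]mulrC.
rewrite rmorphB /=.
have -> : ((y%:Z)%:~R - (n%:Z)%:~R) * b%:~R / n%:R = b%:~R * y%:R / n%:R + (- b)%:~R :> R.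
  rewrite rmorphN /=; field; by rewrite gt_eqF.
by rewrite cexpD cexp_int mulr1.
Qed.

Lemma chi_orth_freq (a a' : G) : \sum_k chi k a * conjc (chi k a') =
  if a == a' then real_complex R (n%:R ^+ d) else 0.
Proof.
rewrite -prod_delta.
have -> : \sum_k chi k a * conjc (chi k a') =
   \sum_(k : G) \prod_l cexp (((a l)%:Z - (a' l)%:Z)%:~R * (k l)%:R / n%:R).
  apply: eq_bigr => k _; rewrite /chi conjc_prod -big_split; apply: eq_bigr => l _; rewrite -cexpN /=.
  by rewrite -[RHS]cexp_kap -cexpD rmorphB /= mulrBr mulrBl.
rewrite -(bigA_distr_bigA (fun l (y : 'I_n) => cexp (((a l)%:Z - (a' l)%:Z)%:~R * y%:R / n%:R))).
apply: eq_bigr => l _; rewrite cexp_orth //.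
  by rewrite subr_eq0 eqz_nat.
by have := ltn_ord (a l); have := ltn_ord (a' l); move: (nat_of_ord _) (nat_of_ord _) => i i' p q; lia.
Qed.

(** All the normalisation sits here: inversion has no factor, and the energy is the mean square of
    [f]. As [f] vanishes on most of the torus, that mean carries the small factor [n ^ - d]. *)
Definition hat (f : G -> R) (k : G) : C :=
  real_complex R (n%:R ^+ d)^-1 * \sum_a real_complex R (f a) * conjc (chi k a).

Lemma nRd_gt0 : 0 < n%:R ^+ d :> R. Proof. by rewrite exprn_gt0 // nR_gt0. Qed.

Lemma hat_inversion f a : \sum_k hat f k * chi k a = real_complex R (f a).
Proof.
transitivity (real_complex R (n%:R ^+ d)^-1 * \sum_a' real_complex R (f a') * \sum_k chi k a * conjc (chi k a')).
  rewrite mulr_sumr; under [RHS]eq_bigr do rewrite mulr_sumr mulr_sumr.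
  rewrite [RHS]exchange_big /=; apply: eq_bigr => k _.
  rewrite /hat -mulrA mulr_suml mulr_sumr; apply: eq_bigr => a' _.
  by congr (_ * _); rewrite -mulrA [conjc _ * _]mulrC.
rewrite (bigD1 a) //= chi_orth_freq eqxx big1 ?addr0; last first.
  by move=> a' aa'; rewrite chi_orth_freq eq_sym (negPf aa') mulr0.
rewrite mulrCA -rmorphM /= mulVf ?gt_eqF ?nRd_gt0 //.
by rewrite rmorph1 mulr1.
Qed.

Lemma hat_parseval f : \sum_k n2 (hat f k) = (n%:R ^+ d)^-1 * \sum_a f a ^+ 2.
Proof.
have := @parseval R _ _ chi (n%:R ^+ d) chi_orth_pos (hat f).
under eq_bigr do rewrite hat_inversion n2_real.
by move=> ->; rewrite mulrA mulVf ?gt_eqF ?nRd_gt0 // mul1r.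
Qed.

Lemma hatB f g k : hat (fun a => f a - g a) k = hat f k - hat g k.
Proof.
rewrite /hat -mulrBr -sumrB; congr (_ * _); apply: eq_bigr => a _.
by rewrite rmorphB mulrBl.
Qed.

Lemma hatZ c f k : hat (fun a => c * f a) k = real_complex R c * hat f k.
Proof.
rewrite /hat [RHS]mulrCA; congr (_ * _); rewrite mulr_sumr; apply: eq_bigr => a _.
by rewrite rmorphM mulrA.
Qed.

Lemma hat_sum (w : nat) (F : 'I_w -> G -> R) k :
  hat (fun a => \sum_(i < w) F i a) k = \sum_(i < w) hat (F i) k.
Proof.
rewrite /hat -[RHS]mulr_sumr; apply: congr1; rewrite [RHS]exchange_big; apply: eq_bigr => a _ /=.
by rewrite rmorph_sum mulr_suml.
Qed.

Definition ue (l : 'I_d) (s : nat) : G := [ffun j => if j == l then inZp s else 0].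

Lemma ueD l s t : ue l (s + t) = ue l s + ue l t.
Proof.
apply/ffunP => j; rewrite !ffunE; case: eqP => _; last by rewrite addr0.
by apply: val_inj; rewrite /= modnDm.
Qed.

Lemma ue0 l : ue l 0 = 0.
Proof. by apply/ffunP => j; rewrite !ffunE; case: eqP => // _; apply: val_inj. Qed.

Lemma chi_shift k a l s : chi k (a + ue l s) = chi k a * cexp ((kap (k l))%:~R * s%:R / n%:R).
Proof.
have nn := nR_gt0.
rewrite /chi (bigD1 l) //= [in RHS](bigD1 l) //= [RHS]mulrAC; congr (_ * _); last first.
  by apply: eq_bigr => j jl; rewrite !ffunE (negPf jl) addr0.
rewrite -cexpD !ffunE eqxx /=.
have e : ((a l + s %% n) %% n)%N = ((a l + s) %% n)%N by rewrite modnDmr.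
rewrite e; set q := ((a l + s) %/ n)%N; set r := ((a l + s) %% n)%N.
have -> : (kap (k l))%:~R * (a l)%:R / n%:R + (kap (k l))%:~R * s%:R / n%:R =
   (kap (k l))%:~R * r%:R / n%:R + (kap (k l) * q%:Z)%:~R :> R.
  have : (a l)%:R + s%:R = q%:R * n%:R + r%:R :> R by rewrite -natrD -natrM -natrD -divn_eq.
  move=> h; rewrite -mulrDl -mulrDr h rmorphM /=; field; by rewrite gt_eqF.
by rewrite cexpD cexp_int mulr1.
Qed.

Definition tsh (l : 'I_d) (s : nat) (f : G -> R) (a : G) : R := f (a + ue l s).

Lemma hat_tsh l s f k : hat (tsh l s f) k = cexp ((kap (k l))%:~R * s%:R / n%:R) * hat f k.
Proof.
rewrite /hat mulrCA; congr (_ * _); rewrite mulr_sumr.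
rewrite [RHS](reindex_inj (addIr (ue l s))) /=; apply: eq_bigr => a _.
rewrite /tsh chi_shift rmorphM /= mulrCA; congr (_ * _).
rewrite mulrCA -[LHS]mulr1; congr (_ * _).
by rewrite mul_conjc_n2 n2_cexp.
Qed.

Definition multiplier (Op : (G -> R) -> (G -> R)) (mu : G -> C) :=
  forall f k, hat (Op f) k = mu k * hat f k.

Lemma multiplier_iter Op mu m : multiplier Op mu ->
  multiplier (iter m Op) (fun k => mu k ^+ m).
Proof. by move=> h; elim: m => [|m IH] f k; rewrite ?mul1r // iterS h IH exprS mulrA. Qed.

Lemma multiplier_sub Op mu : multiplier Op mu ->
  multiplier (fun f a => f a - Op f a) (fun k => 1 - mu k).
Proof. by move=> h f k; rewrite hatB h mulrBl mul1r. Qed.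

Lemma multiplier_diff l s : multiplier (fun f a => tsh l s f a - f a)
  (fun k => cexp ((kap (k l))%:~R * s%:R / n%:R) - 1).
Proof. by move=> f k; rewrite hatB hat_tsh mulrBl mul1r. Qed.

Definition tavg (l : 'I_d) (w : nat) (f : G -> R) (a : G) : R :=
  w%:R^-1 * \sum_(i < w) tsh l i f a.

Definition avg_mult (w : nat) (y : 'I_n) : C :=
  real_complex R w%:R^-1 * \sum_(i < w) cexp ((kap y)%:~R * i%:R / n%:R).

Lemma multiplier_tavg l w : multiplier (tavg l w) (fun k => avg_mult w (k l)).
Proof.
move=> f k; rewrite /tavg hatZ hat_sum /avg_mult -mulrA; congr (_ * _).
by rewrite mulr_suml; apply: eq_bigr => i _; rewrite hat_tsh.
Qed.

Lemma n2_avg_mult_le1 w y : (0 < w)%N -> n2 (avg_mult w y) <= 1.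
Proof.
move=> w0; have wR : 0 < w%:R :> R by rewrite ltr0n.
rewrite /avg_mult n2M n2_real.
have := @n2_sum_le R 'I_w xpredT (fun i => cexp ((kap y)%:~R * i%:R / n%:R)).
under [X in _ <= _ * X]eq_bigr do rewrite n2_cexp.
rewrite sumr_const cardT size_enum_ord -expr2 => h.
rewrite exprVn mulrC ler_pdivrMr ?exprn_gt0 // mul1r.
exact: h.
Qed.

(** A box average is a geometric sum, whose numerator has squared modulus at most [4]. *)
Lemma n2_avg_mult_geom w y : (0 < w)%N ->
  n2 (cexp ((kap y)%:~R / n%:R) - 1) * w%:R ^+ 2 * n2 (avg_mult w y) <= 4.
Proof.
move=> w0; have wR : 0 < w%:R :> R by rewrite ltr0n.
rewrite /avg_mult n2M n2_real mulrA -[_ * w%:R ^+ 2 * _]mulrA exprVn divff ?gt_eqF ?exprn_gt0 // mulr1.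
rewrite -n2M; set q := cexp _.
have -> : \sum_(i < w) cexp ((kap y)%:~R * i%:R / n%:R) = \sum_(i < w) q ^+ i.
  by apply: eq_bigr => i _; rewrite -cexp_mulrn mulrAC.
rewrite -subrX1 (le_trans (n2B_le _ _)) // n2X n2_cexp n21 expr1n; lra.
Qed.

Lemma tline_tavg l w f a :
  (fun t => tavg l w f (a + ue l t)) = mavg w (fun t => f (a + ue l t)).
Proof.
apply/funext => t; rewrite /tavg /mavg; congr (_ * _); apply: eq_bigr => i _.
by rewrite /tsh ueD addrA.
Qed.

End Torus.

(** * Smoothing on the discrete torus *)

Section Smoothing.
Variable R : realType.
Local Notation C := (complex R).
Variables (d H : nat).
Local Notation n := (H.*2.+1).
Local Notation G := {ffun 'I_d -> 'I_H.*2.+1}.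

Definition tdiff (l : 'I_d) (s : nat) (f : G -> R) (a : G) : R := tsh l s f a - f a.

Lemma iter_tdiff_dseq l s m (f : G -> R) a :
  iter m (tdiff l s) f a = dseq (nseq m s) (fun t => f (a + ue H l t)) 0.
Proof.
elim: m f => [|m IH] f; first by rewrite /= ue0 addr0.
rewrite iterSr IH /=; congr (dseq _ _ _); apply/funext => t.
by rewrite /dsh /tdiff /tsh ueD addrA.
Qed.

(** Sums of squares are compared with the size of the support and not with that of the torus, which
    will be taken much larger. *)
Definition nsupp (f : G -> R) : nat := (\sum_a (f a != 0%R))%N.

Lemma nsupp_tdiff l s f : (nsupp (tdiff l s f) <= 2 * nsupp f)%N.
Proof.
rewrite mul2n -addnn /nsupp.
rewrite [X in (_ <= X + _)%N](reindex_inj (addIr (ue H l s))) /= -big_split /=.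
apply: leq_sum => a _; rewrite /tdiff /tsh.
case: (eqVneq (f (a + ue H l s)) 0) => [->|_]; last by case: (_ != 0).
by rewrite sub0r oppr_eq0.
Qed.

Lemma nsupp_iter_tdiff l s m f : (nsupp (iter m (tdiff l s) f) <= 2 ^ m * nsupp f)%N.
Proof.
elim: m => [|m IH]; first by rewrite mul1n.
by rewrite iterS (leq_trans (nsupp_tdiff _ _ _)) // expnS -mulnA leq_mul2l.
Qed.

Lemma sum_sqr_nsupp (f : G -> R) (c : R) : (forall a, f a ^+ 2 <= c) ->
  \sum_a f a ^+ 2 <= c * (nsupp f)%:R.
Proof.
move=> fc; rewrite /nsupp natr_sum mulr_sumr; apply: ler_sum => a _.
case: eqP => [->|_]; first by rewrite expr0n mulr0.
by rewrite mulr1.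
Qed.

(** The [m]-th difference multiplies the energy of the block by at least [2 ^ m] and the support by
    at most [2 ^ m], so the two factors cancel. *)
Lemma block_energy (l : 'I_d) (m s : nat) (f : G -> R) (c : R) : 0 <= c ->
  (forall a, iter m (tdiff l s) f a ^+ 2 <= c) ->
  \sum_(k : G | (2 : R) <= n2 (cexp ((kap (k l))%:~R * s%:R / n%:R) - 1)) n2 (hat f k) <=
  c * (nsupp f)%:R / n%:R ^+ d.
Proof.
move=> c0 fc; have nd := nRd_gt0 R d H.
have p2 : 0 < 2 ^+ m :> R by rewrite exprn_gt0.
rewrite -(ler_pM2l p2) mulr_sumr.
apply: (@le_trans _ _ (\sum_k n2 (hat (iter m (tdiff l s) f) k))).
  rewrite [leRHS](bigID (fun k : G => (2 : R) <= n2 (cexp ((kap (k l))%:~R * s%:R / n%:R) - 1))) /=.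
  rewrite ler_wpDr //; first by apply: sumr_ge0 => k _; exact: n2_ge0.
  apply: ler_sum => k h; rewrite (multiplier_iter m (multiplier_diff l s)) n2M n2X.
  by rewrite ler_wpM2r ?n2_ge0 // lerXn2r ?nnegrE // n2_ge0.
rewrite hat_parseval mulrC [leRHS]mulrA ler_pM2r ?invr_gt0 //.
apply: le_trans (sum_sqr_nsupp fc) _; rewrite mulrCA ler_wpM2l //.
by rewrite -natrX -natrM ler_nat nsupp_iter_tdiff.
Qed.

Variables (w p m : nat).

Definition bsm (l : 'I_d) (f : G -> R) (a : G) : R := f a - iter p (tavg l w) f a.
(** With [A] the [p]-fold average this is [1 - (1 - A) ^ m]. The discarded part [(1 - A) ^ m] is
    governed by [m]-th differences, so no order of approximation is lost; the kept part is divisible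
    by [A], so high frequencies decay like a [p]-th power. *)
Definition tsm (l : 'I_d) (f : G -> R) (a : G) : R := f a - iter m (bsm l) f a.
Definition smooth (f : G -> R) : G -> R := foldr tsm f (enum 'I_d).

Lemma multiplier_tsm l :
  multiplier (tsm l) (fun k => 1 - (1 - avg_mult R w (k l) ^+ p) ^+ m).
Proof.
apply: (multiplier_sub (multiplier_iter m _)).
by apply: (multiplier_sub (multiplier_iter p (multiplier_tavg _ _))).
Qed.

(** From [1 - (1 - z) ^ m = z * \sum_(i < m) (1 - z) ^ i]: [m] terms of squared modulus at most
    [4 ^ m], and Cauchy-Schwarz. *)
Definition smooth_const : R := m%:R ^+ 2 * 4 ^+ m.

Lemma n2_one_sub_pow (z : C) : n2 z <= 1 -> n2 (1 - (1 - z) ^+ m) <= smooth_const * n2 z.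
Proof.
move=> z1; set y := 1 - z.
have y4 : n2 y <= 4 by rewrite (le_trans (n2B_le _ _)) // n21; lra.
have -> : 1 - y ^+ m = z * \sum_(i < m) y ^+ i.
  by rewrite -[LHS]opprB subrX1 -mulNr /y; congr (_ * _); ring.
rewrite n2M mulrC ler_wpM2r ?n2_ge0 //.
apply: le_trans (n2_sum_le _ _) _; rewrite card_ord /smooth_const expr2 -mulrA ler_wpM2l //.
have -> : m%:R * 4 ^+ m = \sum_(i < m) 4 ^+ m :> R by rewrite sumr_const card_ord mulr_natl.
apply: ler_sum => i _.
rewrite n2X (le_trans (y := 4 ^+ i)) ?lerXn2r ?nnegrE ?n2_ge0 //.
apply: ler_weXn2l; first by rewrite ler1n.
by apply: ltnW; exact: ltn_ord.
Qed.

Lemma smooth_const_ge0 : 0 <= smooth_const.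
Proof. by rewrite mulr_ge0 ?exprn_ge0. Qed.

Hypothesis w0 : (0 < w)%N.

Lemma n2_hat_tsm l f k :
  n2 (hat (tsm l f) k) <= smooth_const * (n2 (avg_mult R w (k l)) ^+ p * n2 (hat f k)).
Proof.
have -> : hat (tsm l f) k = _ := multiplier_tsm l f k.
rewrite n2M mulrA ler_wpM2r ?n2_ge0 //.
rewrite -n2X; apply: n2_one_sub_pow; rewrite n2X.
by rewrite exprn_ile1 ?n2_ge0 // n2_avg_mult_le1.
Qed.

Lemma n2_avg_pow_le1 y : n2 (avg_mult R w (y : 'I_n)) ^+ p <= 1.
Proof. by rewrite exprn_ile1 ?n2_ge0 // n2_avg_mult_le1. Qed.

Lemma n2_hat_foldr_tsm (s : seq 'I_d) f k :
  n2 (hat (foldr tsm f s) k) <= smooth_const ^+ size s * n2 (hat f k).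
Proof.
elim: s => [|l s IH] /=; first by rewrite mul1r.
apply: le_trans (n2_hat_tsm _ _ _) _; rewrite exprS -mulrA ler_wpM2l ?smooth_const_ge0 //.
by apply: le_trans IH; rewrite -[leRHS]mul1r ler_wpM2r ?n2_ge0 // n2_avg_pow_le1.
Qed.

Lemma n2_hat_foldr_tsm_mem (s : seq 'I_d) l f k : l \in s ->
  n2 (hat (foldr tsm f s) k) <=
  smooth_const ^+ size s * (n2 (avg_mult R w (k l)) ^+ p * n2 (hat f k)).
Proof.
elim: s => // l' s IH; rewrite inE /= => h.
apply: le_trans (n2_hat_tsm _ _ _) _; rewrite exprS -mulrA ler_wpM2l ?smooth_const_ge0 //.
case/orP: h => [/eqP <-|ls].
  by rewrite mulrCA ler_wpM2l ?exprn_ge0 ?n2_ge0 // n2_hat_foldr_tsm.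
by apply: le_trans (IH ls); rewrite -[leRHS]mul1r ler_wpM2r ?n2_ge0 // n2_avg_pow_le1.
Qed.

Lemma n2_hat_smooth f k : n2 (hat (smooth f) k) <= smooth_const ^+ d * n2 (hat f k).
Proof. by have := n2_hat_foldr_tsm (enum 'I_d) f k; rewrite size_enum_ord. Qed.

Lemma n2_hat_smooth_avg l f k :
  n2 (hat (smooth f) k) <= smooth_const ^+ d * (n2 (avg_mult R w (k l)) ^+ p * n2 (hat f k)).
Proof.
by have := @n2_hat_foldr_tsm_mem (enum 'I_d) l f k; rewrite size_enum_ord mem_enum; apply.
Qed.

End Smoothing.

(** Growth like [x ^ j] up to [J] and halving afterwards: block [J] dominates. *)
Lemma two_sided_geom (R : realType) (x : R) (J N : nat) (u : nat -> R) : 1 < x ->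
  (forall j, 0 <= u j) -> (forall j, (j <= J)%N -> u j <= x ^+ j) ->
  (forall i, u (J + i)%N <= x ^+ J * 2^-1 ^+ i) ->
  \sum_(j < N) u j <= x ^+ J * ((x - 1)^-1 + 2).
Proof.
move=> x1 u0 u1 u2.
have geo1 K : (K <= J)%N -> \sum_(j < K) u j <= x ^+ K / (x - 1).
  move=> KJ; rewrite ler_pdivlMr ?subr_gt0 // mulrC.
  apply: (@le_trans _ _ ((x - 1) * \sum_(j < K) x ^+ j)).
    apply: ler_wpM2l; first by rewrite subr_ge0 ltW.
    apply: ler_sum => j _.
    by apply: u1; apply: leq_trans KJ; exact: ltnW.
  by rewrite -subrX1 lerBlDr lerDl.
have geo2 K : \sum_(i < K) u (J + i)%N <= x ^+ J * (2 - 2 * 2^-1 ^+ K).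
  elim: K => [|K IH]; first by rewrite big_ord0 mulr1 subrr mulr0.
  rewrite big_ord_recr /= (le_trans (lerD IH (u2 K))) // -mulrDr exprS.
  rewrite ler_wpM2l ?exprn_ge0 ?(le_trans _ (ltW x1)) //.
  by have : 0 <= 2^-1 ^+ K :> R; [rewrite exprn_ge0 // invr_ge0|]; clear; lra.
apply: (@le_trans _ _ (\sum_(j < J + N) u j)).
  by rewrite addnC big_split_ord /= lerDl sumr_ge0.
rewrite big_split_ord /= mulrDr lerD ?geo1 //.
apply: le_trans (geo2 N) _; rewrite ler_wpM2l ?exprn_ge0 ?(le_trans _ (ltW x1)) //.
by rewrite lerBlDr lerDl mulr_ge0 ?exprn_ge0 ?invr_ge0.
Qed.

Lemma dyadic_block (R : realType) (rho : R) (N : nat) : 1 <= rho -> rho < 2 ^+ N ->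
  exists2 j, (j < N)%N & 2 ^+ j <= rho < 2 ^+ j.+1.
Proof.
move=> r1; elim: N => [|N IH]; first by rewrite ltNge r1.
move=> rN; case: (ltP rho (2 ^+ N)) => h.
  by have [j jN hj] := IH h; exists j => //; exact: ltnW.
by exists N => //; rewrite h.
Qed.

(** * Weighted energy of the smoothed function *)

Section WeightedEnergy.
Variable R : realType.
Local Notation C := (complex R).
Variables (d H : nat).
Local Notation n := (H.*2.+1).
Local Notation G := {ffun 'I_d -> 'I_H.*2.+1}.

(** The frequency per unit length, as a unit of length contains [Q] grid steps. *)
Definition rfreq (Q : nat) (y : 'I_n) : R := `|kap y|%:R * Q%:R / n%:R.

Lemma rfreq_ge0 Q y : 0 <= rfreq Q y.
Proof. by rewrite /rfreq divr_ge0 // mulr_ge0. Qed.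

Lemma rfreq_lt Q y : (0 < Q)%N -> 2 * rfreq Q y < Q%:R.
Proof.
move=> Q0; have nn := nR_gt0 R H; have QR : 0 < Q%:R :> R by rewrite ltr0n.
rewrite /rfreq mulrA ltr_pdivrMr // mulrA [ltRHS]mulrC ltr_pM2r //.
rewrite -natrM ltr_nat; have := absz_kap y; lia.
Qed.

Lemma abs_kap_rfreq (q j : nat) (y : 'I_n) : (j.+2 <= q)%N ->
  `|(kap y)%:~R * (2 ^ (q - j.+2))%:R / n%:R| = rfreq (2 ^ q) y / 2 ^+ j.+2 :> R.
Proof.
move=> jq; have nn := nR_gt0 R H.
rewrite !normrM normfV (gtr0_norm nn) -intr_norm [`|_%:R|]ger0_norm //.
rewrite -abszE -pmulrn /rfreq !natrX.
have -> : 2 ^+ q = 2 ^+ (q - j.+2) * 2 ^+ j.+2 :> R by rewrite -exprD subnK.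
have : 2 ^+ j.+2 != 0 :> R by rewrite expf_neq0 // pnatr_eq0.
move: (2 ^+ j.+2 : R) (2 ^+ _ : R) => u v u0; field.
by rewrite u0 gt_eqF.
Qed.

(** The step [2 ^ (q - j.+2)] is the length [2 ^ - (j + 2)], over which a frequency between [2 ^ j]
    and [2 ^ j.+1] turns by a quarter to a half period. *)
Lemma block_cexp (q j : nat) (y : 'I_n) : (j.+2 <= q)%N ->
  2 ^+ j <= rfreq (2 ^ q) y < 2 ^+ j.+1 ->
  2 <= n2 (cexp ((kap y)%:~R * (2 ^ (q - j.+2))%:R / n%:R : R) - 1).
Proof.
move=> jq /andP[r1 r2]; apply: n2_cexp_sub1_ge; rewrite abs_kap_rfreq //.
have p0 : 0 < 2 ^+ j :> R by rewrite exprn_gt0.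
move: r1 r2; rewrite !exprS; move: (rfreq _ _) (2 ^+ j : R) p0 => r u p0 r1 r2.
have u4 : 0 < 2 * (2 * u) by rewrite !mulr_gt0.
by rewrite (ler_pdivlMr _ _ u4) (ler_pdivrMr _ _ u4); apply/andP; split; lra.
Qed.

(** The doubling bound carries the lower bound of [block_cexp] back to the unit step, where it is
    the denominator of the geometric sum. The decay per box average is [4 ^ - (j - J)]. *)
Lemma n2_avg_block (q J j : nat) (y : 'I_n) : (J <= q)%N -> (j.+2 <= q)%N ->
  2 ^+ j <= rfreq (2 ^ q) y < 2 ^+ j.+1 ->
  n2 (avg_mult R (2 ^ (q - J)) y) * 4 ^+ j <= 4 ^+ J.
Proof.
move=> Jq jq hb; have := block_cexp jq hb.
have p2 k : (0 < 2 ^ k)%N by rewrite expn_gt0.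
have := @n2_avg_mult_geom R H _ y (p2 (q - J)%N).
have := n2_cexp_sub1_doubling ((kap y)%:~R / n%:R : R) (q - j.+2).
rewrite mulrAC; set D := n2 (cexp _ - 1); set N := n2 (avg_mult _ _ _).
rewrite natrX -exprM mulnC exprM [(2 : R) ^+ 2](_ : _ = 4); last by ring.
set A := n2 _ => h1 h2 h3.
have N0 : 0 <= N := n2_ge0 _.
have pos k : 0 < 4 ^+ k :> R by rewrite exprn_gt0.
have e1 : 4 ^+ q = 4 ^+ (q - J) * 4 ^+ J :> R by rewrite -exprD subnK.
have e2 : 4 ^+ q = 4 ^+ (q - j.+2) * 4 ^+ j * 16 :> R.
  rewrite -mulrA (_ : 4 ^+ j * 16 = 4 ^+ j.+2); first by rewrite -exprD subnK.
  by rewrite !exprS; ring.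
have h4 : 2 <= 4 ^+ (q - j.+2) * A := le_trans h3 h1.
have h5 : 2 * (N * 4 ^+ (q - J)) <= 4 ^+ (q - j.+2) * 4.
  apply: (@le_trans _ _ (4 ^+ (q - j.+2) * A * (N * 4 ^+ (q - J)))).
    by rewrite ler_wpM2r // mulr_ge0 // ltW.
  rewrite -mulrA ler_wpM2l ?(ltW (pos _)) //; apply: le_trans h2.
  by rewrite mulrA mulrAC.
rewrite -(ler_pM2l (pos (q - J)%N)).
have h6 := ler_wpM2r (ltW (pos j)) h5.
have -> : 4 ^+ (q - J) * 4 ^+ J = 4 ^+ (q - j.+2) * 4 ^+ j * 16 :> R by rewrite -e1 e2.
have h7 : 0 < 4 ^+ (q - j.+2) * 4 ^+ j :> R by rewrite mulr_gt0.
have -> : 4 ^+ (q - J) * (N * 4 ^+ j) = N * 4 ^+ (q - J) * 4 ^+ j by ring.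
have h8 : 4 ^+ (q - j.+2) * 4 * 4 ^+ j = 4 ^+ (q - j.+2) * 4 ^+ j * 4 :> R by ring.
move: h6 h7; rewrite h8 -(mulrA 2) ; move: (N * _ * _) (4 ^+ (q - j.+2) * 4 ^+ j) => u v h6 h7.
by lra.
Qed.

Variables (q J m : nat).
Hypothesis Jq : (J <= q)%N.
Local Notation Q := (2 ^ q)%N.
Local Notation w := (2 ^ (q - J))%N.
Local Notation p := (d + 4)%N.

Definition energy_const (y : R) : R :=
  smooth_const R m ^+ d * (2 ^+ (d + 3) + 4 ^+ (d + 3) * ((2 ^+ (d + 3) * y - 1)^-1 + 2)).

(** Block [j] has energy of order [y ^ j] and weight of order [2 ^ (j * (d + 3))]. Up to [J] the
    products grow with ratio [x > 1]; beyond [J] the [d + 4] box averages gain more than the weight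
    loses. *)
Lemma weighted_energy (l : 'I_d) (f : G -> R) (y c : R) :
  0 < y <= 1 -> 1 < 2 ^+ (d + 3) * y -> 0 <= c ->
  (forall a, f a ^+ 2 <= c) ->
  (forall j, (j.+2 <= q)%N -> forall a, iter m (tdiff l (2 ^ (q - j.+2))) f a ^+ 2 <= c * y ^+ j) ->
  \sum_(k : G) (1 + rfreq Q (k l)) ^+ (d + 3) * n2 (hat (smooth w p m f) k) <=
  energy_const y * (c * (nsupp f)%:R / n%:R ^+ d) * (2 ^+ (d + 3) * y) ^+ J.
Proof.
move=> /andP[y0 y1] x1 c0 fc hdiff; have nd := nRd_gt0 R d H.
set x := 2 ^+ (d + 3) * y; set E := c * _ / _; set S := smooth_const R m ^+ d.
have S0 : 0 <= S by rewrite exprn_ge0 // smooth_const_ge0.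
have E0 : 0 <= E by rewrite divr_ge0 ?(ltW nd) // mulr_ge0.
have w0 : (0 < w)%N by rewrite expn_gt0.
(* The gain by smoothing on block [j]; none is claimed up to the scale [J]. *)
pose mj j : R := if (j <= J)%N then 1 else (4^-1 ^+ (j - J)) ^+ p.
have mj0 j : 0 <= mj j by rewrite /mj; case: ifP => // _; rewrite !exprn_ge0 // invr_ge0.
pose inB j (k : G) := 2 ^+ j <= rfreq Q (k l) < 2 ^+ j.+1.
have pt (k : G) : (1 + rfreq Q (k l)) ^+ (d + 3) * n2 (hat (smooth w p m f) k) <=
    S * (2 ^+ (d + 3) * n2 (hat f k) +
         \sum_(j < q.-1) (inB j k)%:R * (4 ^+ (d + 3) * (2 ^+ (d + 3)) ^+ j * mj j * n2 (hat f k))).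
  have r0 := rfreq_ge0 Q (k l); have f0 := n2_ge0 (hat f k).
  have t0 (j : nat) : 0 <= (inB j k)%:R * (4 ^+ (d + 3) * (2 ^+ (d + 3)) ^+ j * mj j * n2 (hat f k)).
    by rewrite mulr_ge0 // !mulr_ge0 // !exprn_ge0.
  case: (ltP (rfreq Q (k l)) 1) => h.
    apply: (@le_trans _ _ (S * (2 ^+ (d + 3) * n2 (hat f k)))); last first.
      by rewrite ler_wpM2l // lerDl sumr_ge0.
    rewrite mulrCA; apply: ler_pM; rewrite ?exprn_ge0 ?n2_ge0 ?addr_ge0 //.
      by rewrite lerXn2r ?nnegrE ?addr_ge0 //; lra.
    exact: n2_hat_smooth.
  have rq : rfreq Q (k l) < 2 ^+ q.-1.
    have := @rfreq_lt Q (k l); rewrite expn_gt0 => /(_ isT).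
    case: (posnP q) => [->|q0]; first by rewrite expn0; lra.
    by rewrite -[in Q%:R](prednK q0) expnS natrM natrX ltr_pM2l.
  have [j jq hj] := dyadic_block h rq.
  have jq2 : (j.+2 <= q)%N by move: jq; clear; lia.
  apply: (@le_trans _ _ (S * ((inB j k)%:R * (4 ^+ (d + 3) * (2 ^+ (d + 3)) ^+ j * mj j * n2 (hat f k))))); last first.
    rewrite ler_wpM2l // (bigD1 (Ordinal jq)) //= addrCA lerDl addr_ge0 //.
      by rewrite mulr_ge0 ?exprn_ge0.
    by apply: sumr_ge0.
  rewrite /inB hj mul1r -mulrA mulrCA.
  have -> : 4 ^+ (d + 3) * (2 ^+ (d + 3)) ^+ j = (4 * 2 ^+ j) ^+ (d + 3) :> R.
    by rewrite exprMn -!exprM mulnC.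
  apply: ler_pM; rewrite ?exprn_ge0 ?n2_ge0 ?addr_ge0 //.
    rewrite lerXn2r ?nnegrE ?addr_ge0 ?mulr_ge0 ?exprn_ge0 //.
    have : 1 <= 2 ^+ j :> R by rewrite exprn_ege1 // ler1n.
    by case/andP: hj => _; rewrite exprS; lra.
  rewrite /mj; case: ifP => jJ; first by rewrite mul1r n2_hat_smooth.
  apply: le_trans (n2_hat_smooth_avg p m w0 l f k) _.
  rewrite ler_wpM2l // ler_wpM2r // lerXn2r ?nnegrE ?n2_ge0 ?exprn_ge0 ?invr_ge0 //.
  have := n2_avg_block Jq jq2 hj.
  have -> : 4 ^+ j = 4 ^+ (j - J) * 4 ^+ J :> R by rewrite -exprD subnK // ltnW // ltnNge jJ.
  rewrite mulrA -[leRHS]mul1r ler_pM2r ?exprn_gt0 // exprVn.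
  by rewrite -ler_pdivlMr ?exprn_gt0 // mul1r.
apply: (@le_trans _ _ (S * (2 ^+ (d + 3) * E + \sum_(j < q.-1) 4 ^+ (d + 3) * E * (x ^+ j * mj j)))).
  apply: le_trans (ler_sum _ (fun k _ => pt k)) _.
  rewrite -mulr_sumr ler_wpM2l // big_split /= lerD //.
    rewrite -mulr_sumr ler_wpM2l ?exprn_ge0 // hat_parseval mulrC ler_pM2r ?invr_gt0 //.
    exact: sum_sqr_nsupp.
  rewrite exchange_big /=; apply: ler_sum => j _.
  have jq : (j.+2 <= q)%N by move: (ltn_ord j); clear; lia.
  apply: (@le_trans _ _ (4 ^+ (d + 3) * (2 ^+ (d + 3)) ^+ j * mj j *
     \sum_(k : G | (2 : R) <= n2 (cexp ((kap (k l))%:~R * (2 ^ (q - j.+2))%:R / n%:R) - 1)) n2 (hat f k))).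
    rewrite mulr_sumr [leRHS]big_mkcond /=; apply: ler_sum => k _.
    rewrite /inB; case: (boolP (_ <= _ < _)) => hb; first by rewrite mul1r block_cexp.
    by rewrite mul0r; case: ifP => // _; rewrite !mulr_ge0 ?exprn_ge0 ?n2_ge0.
  have hy : 0 <= c * y ^+ j by rewrite mulr_ge0 // exprn_ge0 // ltW.
  have := block_energy hy (hdiff j jq).
  have -> : c * y ^+ j * (nsupp f)%:R / n%:R ^+ d = E * y ^+ j by rewrite /E; ring.
  have -> : 4 ^+ (d + 3) * E * (x ^+ j * mj j) = 4 ^+ (d + 3) * (2 ^+ (d + 3)) ^+ j * mj j * (E * y ^+ j).
    by rewrite /x exprMn; ring.
  by apply: ler_wpM2l; rewrite !mulr_ge0 ?exprn_ge0.
have x0 : 0 < x by rewrite (lt_trans _ x1).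
have geo : \sum_(j < q.-1) x ^+ j * mj j <= x ^+ J * ((x - 1)^-1 + 2).
  apply: (@two_sided_geom R x J q.-1 (fun j => x ^+ j * mj j) x1) => [j|j jJ|i].
  - by apply: mulr_ge0 => //; rewrite exprn_ge0 // ltW.
  - by rewrite /mj jJ mulr1.
  rewrite exprD -mulrA ler_wpM2l ?exprn_ge0 ?(ltW x0) //.
  case: i => [|i]; first by rewrite /mj addn0 leqnn mul1r.
  have -> : mj (J + i.+1)%N = (4^-1 ^+ p) ^+ i.+1.
    by rewrite /mj ifF ?addKn -?exprM 1?mulnC //; clear; lia.
  rewrite -exprMn lerXn2r ?nnegrE ?mulr_ge0 ?exprn_ge0 ?invr_ge0 ?(ltW y0) //.
  apply: (@le_trans _ _ (2 ^+ (d + 3) * 4^-1 ^+ (d + 4))).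
    rewrite ler_wpM2r ?exprn_ge0 ?invr_ge0 // /x -[leRHS]mulr1 ler_wpM2l ?exprn_ge0 //.
  rewrite [(d + 4)%N]addnS exprSr mulrA -exprMn.
  have : (2 * 4^-1) ^+ (d + 3) <= 1 :> R by rewrite exprn_ile1 //; lra.
  by lra.
rewrite -mulr_sumr /energy_const -/S -/x.
have xJ : 1 <= x ^+ J by rewrite exprn_ege1 // ltW.
have -> : S * (2 ^+ (d + 3) + 4 ^+ (d + 3) * ((x - 1)^-1 + 2)) * E * x ^+ J =
  S * (2 ^+ (d + 3) * E * x ^+ J + 4 ^+ (d + 3) * E * (x ^+ J * ((x - 1)^-1 + 2))) by ring.
rewrite ler_wpM2l // lerD //; last by rewrite ler_wpM2l // mulr_ge0 ?exprn_ge0.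
by rewrite -[leLHS]mulr1 ler_wpM2l // mulr_ge0 ?exprn_ge0.
Qed.

End WeightedEnergy.

(** * Box averages on a line and the bump function *)

Section BoxAverages.
Variable R : realType.

Lemma dseq_mavg w (l : seq nat) (g : nat -> R) : dseq l (mavg w g) = mavg w (dseq l g).
Proof. by elim: l g => //= s l IH g; rewrite -mavg_dsh IH. Qed.

Lemma dseq_iter_mavg w k (l : seq nat) (g : nat -> R) :
  dseq l (iter k (mavg w) g) = iter k (mavg w) (dseq l g).
Proof. by elim: k => //= k IH; rewrite dseq_mavg IH. Qed.

Lemma dseq_dsh s (l : seq nat) (g : nat -> R) : dseq l (dsh s g) = dsh s (dseq l g).
Proof.
elim: l g => //= s' l IH g; rewrite -IH; congr (dseq l _); apply/funext => t.
by rewrite /dsh addnAC; ring.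
Qed.

Lemma mavg_near w (g : nat -> R) t (x c : R) : (0 < w)%N ->
  (forall i, (i < w)%N -> `|x - g (t + i)%N| <= c) -> `|x - mavg w g t| <= c.
Proof.
move=> w0 h; have wR : 0 < w%:R :> R by rewrite ltr0n.
have -> : x - mavg w g t = w%:R^-1 * \sum_(i < w) (x - g (t + i)%N).
  rewrite sumrB sumr_const card_ord /mavg mulrBr; congr (_ - _).
  by rewrite -[x *+ w]mulr_natl mulKf // gt_eqF.
rewrite normrM normfV (gtr0_norm wR) mulrC ler_pdivrMr //.
apply: le_trans (ler_norm_sum _ _ _) _.
apply: (@le_trans _ _ (\sum_(i < w) c)); first by apply: ler_sum => i _; exact: h.
by rewrite sumr_const card_ord mulr_natr.
Qed.

Definition nbsm w p (g : nat -> R) (t : nat) : R := g t - iter p (mavg w) g t.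

Lemma iter_mavg_near w p (phi : nat -> R) (c : R) : (0 < w)%N ->
  (forall s t, (s <= p * w)%N -> `|phi (t + s)%N - phi t| <= c) ->
  forall k t s, (k <= p)%N -> (s <= (p - k) * w)%N -> `|phi t - iter k (mavg w) phi (t + s)%N| <= c.
Proof.
move=> w0 h; elim=> [|k IH] t s kp hs.
  by rewrite distrC; apply: h; rewrite subn0 in hs.
rewrite iterS; apply: mavg_near => // i iw; rewrite -addnA; apply: IH; first exact: ltnW.
have -> : (p - k = (p - k.+1).+1)%N by rewrite -subSn // subSS.
by rewrite mulSn; lia.
Qed.

(** One factor [1 - A] is an average of negated differences with steps up to [p * w]. The hypothesis
    for all step lists of length [m] is stable under peeling off one such factor. *)
Lemma iter_nbsm_bound w p (c : R) m (g : nat -> R) : (0 < w)%N ->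
  (forall l, size l = m -> all (fun s => s <= p * w)%N l -> forall t, `|dseq l g t| <= c) ->
  forall t, `|iter m (nbsm w p) g t| <= c.
Proof.
move=> w0; elim: m g => [|m IH] g hl; first exact: (hl [::]).
rewrite iterSr; apply: IH => l sl al t.
have -> : dseq l (nbsm w p g) t = dseq l g t - iter p (mavg w) (dseq l g) t.
  rewrite -dseq_iter_mavg -[iter p _ g]/(iter p _ g) -[X in _ - X]mul1r -mulNr -dseqZ -dseqD.
  by congr (dseq l _ t); apply/funext => i; rewrite /nbsm mulN1r.
have := @iter_mavg_near w p (dseq l g) c w0 _ p t 0; rewrite addn0 subnn; apply => //.
move=> s t' hs; have := hl (s :: l); rewrite /= sl hs => /(_ erefl al t').
by rewrite dseq_dsh.
Qed.

Lemma iter_mavg_const k w (g : nat -> R) t (v : R) : (0 < w)%N ->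
  (forall i, (i <= k * w)%N -> g (t + i)%N = v) -> iter k (mavg w) g t = v.
Proof.
move=> w0; elim: k t => [|k IH] t h; first by rewrite -[t in LHS]addn0; exact: h.
rewrite iterS /mavg (eq_bigr (fun=> v)) => [|i _].
  by rewrite sumr_const card_ord -[v *+ w]mulr_natl mulKf // pnatr_eq0 -lt0n.
apply: IH => j hj; rewrite -addnA; apply: h; rewrite mulSn.
by have := ltn_ord i; lia.
Qed.

(** [mavg] looks forward, so the averages extend the indicator downwards by [m * Q]. The value is
    [1] from [(2 * m + 2) * Q] to [(2 * m + 6) * Q] and [0] below [(m + 2) * Q] and above
    [(3 * m + 6) * Q]; [m] averages allow for [m] differences. *)
Definition bump (m Q : nat) : nat -> R :=
  iter m (mavg Q) (fun p => ((2 * m + 2) * Q <= p <= (3 * m + 6) * Q)%N%:R).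

Lemma bump_dseq_bound m Q (l : seq nat) (del : R) : (0 < Q)%N -> (size l <= m)%N ->
  (forall s, s \in l -> s%:R / Q%:R <= del) -> 0 <= del ->
  forall t, `|dseq l (bump m Q) t| <= (2 * del) ^+ size l.
Proof.
move=> Q0 lm ls del0 t; rewrite -[leRHS]mulr1; apply: dseq_iter_mavg_bound => // i.
by case: (_ <= i <= _)%N; rewrite /= ?normr1 ?normr0.
Qed.

Lemma bump_le1 m Q t : (0 < Q)%N -> `|bump m Q t| <= 1.
Proof. by move=> Q0; have := @bump_dseq_bound m Q [::] 0 Q0; apply. Qed.

Lemma bump_eq1 m Q t : (0 < Q)%N -> ((2 * m + 2) * Q <= t)%N -> (t <= (2 * m + 6) * Q)%N ->
  bump m Q t = 1.
Proof.
move=> Q0 h1 h2; apply: iter_mavg_const => // i hi.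
have e : ((3 * m + 6) * Q = (2 * m + 6) * Q + m * Q)%N by ring.
by have -> : ((2 * m + 2) * Q <= t + i <= (3 * m + 6) * Q)%N by rewrite e; lia.
Qed.

Lemma bump_high m Q t : (0 < Q)%N -> ((3 * m + 6) * Q < t)%N -> bump m Q t = 0.
Proof.
move=> Q0 h; apply: iter_mavg_const => // i hi.
by have -> : ((2 * m + 2) * Q <= t + i <= (3 * m + 6) * Q)%N = false by lia.
Qed.

Lemma bump_low m Q t : (0 < Q)%N -> (t < (m + 2) * Q)%N -> bump m Q t = 0.
Proof.
move=> Q0 h; apply: iter_mavg_const => // i hi.
have e : ((2 * m + 2) * Q = (m + 2) * Q + m * Q)%N by ring.
by have -> : ((2 * m + 2) * Q <= t + i <= (3 * m + 6) * Q)%N = false by rewrite e; lia.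
Qed.

End BoxAverages.

Section SmoothingError.
Variable R : realType.
Variables (d H : nat).
Local Notation n := (H.*2.+1).
Local Notation G := {ffun 'I_d -> 'I_H.*2.+1}.
Variables (w p m : nat).
Hypothesis w0 : (0 < w)%N.

Definition lip_op (K : R) (Op : (G -> R) -> G -> R) := forall u v del,
  (forall a, `|u a - v a| <= del) -> forall a, `|Op u a - Op v a| <= K * del.

Lemma lip_op_iter K Op k : lip_op K Op -> lip_op (K ^+ k) (iter k Op).
Proof.
move=> h; elim: k => [|k IH] u v del uv a; first by rewrite mul1r; exact: uv.
by rewrite !iterS exprS -mulrA; apply: h => a'; exact: IH.
Qed.

Lemma lip_op_sub K Op : lip_op K Op -> lip_op (1 + K) (fun f a => f a - Op f a).
Proof.
move=> h u v del uv a.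
have -> : u a - Op u a - (v a - Op v a) = (u a - v a) - (Op u a - Op v a) by ring.
by rewrite (le_trans (ler_normB _ _)) // mulrDl mul1r lerD // ?uv // h.
Qed.

Lemma lip_op_tavg l : lip_op 1 (tavg l w).
Proof.
move=> u v del uv a; rewrite mul1r /tavg -mulrBr -sumrB.
have wR : 0 < w%:R :> R by rewrite ltr0n.
rewrite normrM normfV (gtr0_norm wR) mulrC ler_pdivrMr //.
apply: le_trans (ler_norm_sum _ _ _) _.
apply: (@le_trans _ _ (\sum_(i < w) del)); first by apply: ler_sum => i _; exact: uv.
by rewrite sumr_const card_ord mulr_natr.
Qed.

Lemma lip_op_tsm l : lip_op (1 + 2 ^+ m) (tsm w p m l).
Proof.
apply: lip_op_sub; apply: lip_op_iter.
have -> : 2 = 1 + 1 ^+ p :> R by rewrite expr1n.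
by apply: lip_op_sub; apply: lip_op_iter; exact: lip_op_tavg.
Qed.

(** A new direction adds the error [c] and enlarges the previous error by the sup-norm constant
    [1 + 2 ^ m] of [tsm]; together this is a factor of at most [2 + 2 ^ m] per direction. *)
Lemma smooth_error (f : G -> R) (c : R) : 0 <= c ->
  (forall l a, `|iter m (bsm w p l) f a| <= c) ->
  forall a, `|f a - smooth w p m f a| <= (2 + 2 ^+ m) ^+ d * c.
Proof.
move=> c0 h; rewrite /smooth -[in X in _ ^+ X](size_enum_ord d).
elim: (enum 'I_d) => [|l s IH] a /=; first by rewrite subrr normr0 mul1r.
set g := foldr _ _ _ in IH *.
have -> : f a - tsm w p m l g a = (f a - tsm w p m l f a) + (tsm w p m l f a - tsm w p m l g a) by ring.
apply: le_trans (ler_normD _ _) _.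
have h1 : `|f a - tsm w p m l f a| <= c by rewrite /tsm opprB addrC subrK h.
have h2 := lip_op_tsm l IH a.
apply: le_trans (lerD h1 h2) _; rewrite exprS.
set X := (2 + 2 ^+ m) ^+ size s.
have X1 : 1 <= X.
  by rewrite exprn_ege1 //; have : 0 <= 2 ^+ m :> R; [rewrite exprn_ge0|lra].
have -> : (2 + 2 ^+ m) * X * c = X * c + (1 + 2 ^+ m) * (X * c) by ring.
by rewrite lerD // -[leLHS]mul1r ler_wpM2r.
Qed.

Lemma iter_bsm_line l (f : G -> R) a k :
  (fun t => iter k (bsm w p l) f (a + ue H l t)) = iter k (nbsm w p) (fun t => f (a + ue H l t)).
Proof.
have e j (g : G -> R) : (fun t => iter j (tavg l w) g (a + ue H l t)) = iter j (mavg w) (fun t => g (a + ue H l t)).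
  by elim: j => //= j IH; rewrite tline_tavg IH.
elim: k => //= k IH; apply/funext => t; rewrite /nbsm -IH -e.
by rewrite /bsm.
Qed.

Lemma iter_bsm_bound l (f : G -> R) (c : R) :
  (forall a s, size s = m -> all (fun i => i <= p * w)%N s ->
     `|dseq s (fun t => f (a + ue H l t)) 0| <= c) ->
  forall a, `|iter m (bsm w p l) f a| <= c.
Proof.
move=> h a.
have -> : iter m (bsm w p l) f a = iter m (nbsm w p) (fun t => f (a + ue H l t)) 0.
  by rewrite -iter_bsm_line ue0 addr0.
apply: iter_nbsm_bound => // s sm sa t.
have := h (a + ue H l t) s sm sa.
have -> : (fun t0 => f (a + ue H l t + ue H l t0)) = (fun i => f (a + ue H l (i + t)%N)).
  by apply/funext => i; rewrite -addrA -ueD addnC.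
by rewrite (@dseq_shift _ s (fun i => f (a + ue H l i))) add0n.
Qed.

End SmoothingError.

Lemma card_ffun_forall (I T : finType) (F : I -> pred T) :
  #|[pred f : {ffun I -> T} | [forall i, F i (f i)]]| = (\prod_i #|F i|)%N.
Proof.
have <- : #|family F| = (\prod_i #|F i|)%N by rewrite (card_family F) foldrE big_image.
by apply: eq_card => f; rewrite [LHS]inE; apply/forallP/familyP.
Qed.

(** * The cut-off function on the torus *)

Section Cutoff.
Variable R : realType.
Variables (d H : nat).
Local Notation n := (H.*2.+1).
Local Notation G := {ffun 'I_d -> 'I_H.*2.+1}.
Variables (F : 'rV[R]_d -> R) (m Q : nat).
Hypothesis Q0 : (0 < Q)%N.
Local Notation c0 := ((2 * m + 4) * Q)%N.

(** The origin is put at the index [(2 * m + 4) * Q], the middle of the plateau of [bump]. The unit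
    ball, of radius [Q] in index units, then lies inside the plateau and away from the
    wrap-around. *)
Definition gridpt (a : G) : 'rV[R]_d := \row_j (((a j)%:R - c0%:R) / Q%:R).
Definition cutoff (a : G) : R := F (gridpt a) * \prod_j bump R m Q (a j).

Lemma cutoff_eq (a : G) : (forall j, ((2 * m + 2) * Q <= a j <= (2 * m + 6) * Q)%N) ->
  cutoff a = F (gridpt a).
Proof.
by move=> h; rewrite /cutoff big1 ?mulr1 // => j _; have /andP[] := h j; exact: bump_eq1.
Qed.

Lemma prod_bump_le1 (P : pred 'I_d) (a : G) : `|\prod_(j | P j) bump R m Q (a j)| <= 1.
Proof.
by rewrite normr_prod; apply: prodr_ile1 => j _; rewrite normr_ge0 bump_le1.
Qed.

Lemma cutoff_bound (c : R) : (forall x, `|F x| <= c) -> forall a, `|cutoff a| <= c.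
Proof.
move=> Fc a; rewrite /cutoff normrM -[leRHS]mulr1.
by apply: ler_pM => //; exact: prod_bump_le1.
Qed.

Lemma nsupp_cutoff : (nsupp cutoff <= ((3 * m + 6) * Q).+1 ^ d)%N.
Proof.
pose D := ((3 * m + 6) * Q)%N.
apply: (@leq_trans #|[pred a : G | [forall j, [pred y : 'I_n | (y <= D)%N] (a j)]]|).
  rewrite /nsupp -sum1_card [leqRHS]big_mkcond /=; apply: leq_sum => a _; rewrite inE.
  case: forallP => [_|h]; first by case: (_ != _).
  suff -> : cutoff a = 0 by rewrite eqxx.
  have [j hj] : exists j, (D < a j)%N.
    apply/existsP; apply: contra_notT h; rewrite negb_exists => /forallP h j.
    by rewrite /= leqNgt h.
  by rewrite /cutoff (bigD1 j) //= bump_high // mul0r mulr0.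
rewrite (card_ffun_forall (fun _ : 'I_d => [pred y : 'I_n | (y <= D)%N])); apply: (@leq_trans (\prod_(i < d) D.+1)%N).
  apply: leq_prod => j _.
  rewrite -[in leqRHS](card_ord D.+1).
  pose h (y : 'I_n) : 'I_D.+1 := inord y.
  apply: (@leq_card_in _ _ h) => y y'; rewrite !inE => hy hy' /(congr1 val) /=.
  by rewrite !inordK // => e; apply: val_inj.
by rewrite prod_nat_const card_ord.
Qed.

Lemma gridpt_line l (a : G) t : (a l + t < n)%N ->
  gridpt (a + ue H l t) = gridpt a + (t%:R / Q%:R) *: delta_mx 0 l.
Proof.
move=> h; apply/rowP => j; rewrite !mxE !ffunE eqxx andTb.
case: eqP => [->|_]; last by rewrite addr0 mulr0 addr0.
by rewrite /= modnDmr modn_small // natrD mulr1 -mulrDl; congr (_ / _); ring.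
Qed.

Lemma line_coord l (a : G) t : val ((a + ue H l t) l) = ((a l + t) %% n)%N.
Proof. by rewrite !ffunE eqxx /= modnDmr. Qed.

Lemma cutoff_line l (a : G) t : (a l + t < n)%N ->
  cutoff (a + ue H l t) = F (gridpt a + (t%:R / Q%:R) *: delta_mx 0 l) *
    ((\prod_(j | j != l) bump R m Q (a j)) * bump R m Q (t + a l)%N).
Proof.
move=> h; rewrite /cutoff gridpt_line //; congr (_ * _).
rewrite (bigD1 l) //= mulrC; congr (_ * _).
  by apply: eq_bigr => j jl; rewrite !ffunE (negPf jl) addr0.
by rewrite (line_coord l a t) modn_small // addnC.
Qed.

Variables (r : nat) (beta c : R).
Hypothesis mr : m = r.+1.
Hypothesis beta01 : 0 < beta <= 1.
Hypothesis Fholder : holder_norm_le r beta F c.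
Hypothesis nbig : ((4 * m + 6) * Q < n)%N.

(** The product rule shares the [r.+1] differences between [F] and the bump. One factor [2 ^ m] of
    [4 ^ m] counts the terms, the other comes from the differences of the bump. *)
Lemma cutoff_dseq l (a : G) (S : nat) (s : seq nat) : (0 < S <= Q)%N ->
  size s = m -> all (fun i => i <= S)%N s ->
  `|dseq s (fun t => cutoff (a + ue H l t)) 0| <=
  4 ^+ m * c * ((S%:R / Q%:R) ^+ r * (S%:R / Q%:R) `^ beta).
Proof.
move=> /andP[S0 SQ] sm sS.
have QR : 0 < Q%:R :> R by rewrite ltr0n.
have SR : 0 < S%:R :> R by rewrite ltr0n.
set del := S%:R / Q%:R.
have del0 : 0 < del by rewrite divr_gt0.
have del1 : del <= 1 by rewrite ler_pdivrMr // mul1r ler_nat.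
have c_ge0 : 0 <= c by case: Fholder => _ hb _; apply: le_trans (normr_ge0 _) (hb [::] isT 0).
have del_b : del <= del `^ beta by apply: ger1_powR; [rewrite del0|case/andP: beta01].
have rhs0 : 0 <= del ^+ r * del `^ beta by rewrite mulr_ge0 ?powR_ge0 // exprn_ge0 // ltW.
have ssum : (sumn s <= m * Q)%N.
  rewrite -sm; elim: s sS {sm} => //= i s IH /andP[iS sS].
  by rewrite mulSn leq_add ?IH // (leq_trans iS).
(* A line that wraps around within reach of the differences meets only zeros of the bump, at the top
   of the torus and again at the bottom. *)
case: (ltnP (a l + m * Q)%N n) => han; last first.
  have -> : dseq s (fun t => cutoff (a + ue H l t)) 0 = dseq s (fun=> 0 * 0) 0.
    apply: (@dseq_eq _ _ _ _ (m * Q)%N) => [t tm|]; last by rewrite add0n.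
    rewrite mulr0 /cutoff (bigD1 l) //= (line_coord l a t).
    suff -> : bump R m Q ((a l + t) %% n) = 0 by rewrite mul0r mulr0.
    have aln := ltn_ord (a l).
    have e1 : ((4 * m + 6) * Q = (3 * m + 6) * Q + m * Q)%N by ring.
    have e2 : ((m + 2) * Q = m * Q + 2 * Q)%N by ring.
    case: (ltnP (a l + t)%N n) => atn.
      by rewrite modn_small //; apply: bump_high => //; move: e1 han nbig; clear; lia.
    have -> : (a l + t = (a l + t - n) + n)%N by rewrite subnK.
    rewrite modnDr modn_small; last by move: tm aln nbig; clear; nia.
    by apply: bump_low => //; move: e2 tm aln nbig Q0; clear; lia.
  by rewrite dseqZ mul0r normr0 mulr_ge0 // mulr_ge0 // exprn_ge0.
pose u (i : nat) := F (gridpt a + (i%:R / Q%:R) *: delta_mx 0 l).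
pose v (i : nat) := (\prod_(j | j != l) bump R m Q (a j)) * bump R m Q (i + a l)%N.
have -> : dseq s (fun t => cutoff (a + ue H l t)) 0 = dseq s (fun i => u i * v i) 0.
  apply: (@dseq_eq _ _ _ _ (m * Q)%N) => [t tm|]; last by rewrite add0n.
  by rewrite cutoff_line //; apply: leq_ltn_trans han; rewrite leq_add2l.
have -> : 4 ^+ m * c * (del ^+ r * del `^ beta) =
    2 ^+ size s * (2 ^+ m * (c * (del ^+ r * del `^ beta))).
  have -> : 4 = 2 * 2 :> R by ring.
  by rewrite sm exprMn; ring.
apply: (@leibniz_bound _ S) => // l1 l2 sz a1 a2 i1 i2.
have al (l' : seq nat) : all (fun s => s <= S)%N l' -> forall s', s' \in l' -> s'%:R / Q%:R <= del.
  by move=> /allP h s' /h hs'; rewrite ler_pM2r ?invr_gt0 // ler_nat.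
have hv : `|dseq l2 v i2| <= (2 * del) ^+ size l2.
  rewrite dseqZ (@dseq_shift _ l2 (bump R m Q)) normrM -[leRHS]mul1r.
  apply: ler_pM => //; first exact: prod_bump_le1.
  apply: bump_dseq_bound; [exact: Q0| |exact: al|exact: ltW].
  by rewrite -sm -sz leq_addl.
have ahs : all (fun h => 0 <= h <= del) [seq s'%:R / Q%:R | s' <- l1].
  by apply/allP => h /mapP[s' hs' ->]; rewrite (al l1) // divr_ge0.
have [hu1 hu2] := dpart_dirseq_bound l beta01 Fholder (ltW del0) ahs [::].
rewrite /= add0n size_map in hu1 hu2.
have eu : dseq l1 u i1 = dirseq l [seq s'%:R / Q%:R | s' <- l1] F (gridpt a + (i1%:R / Q%:R) *: delta_mx 0 l).
  exact: dseq_line.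
(* If all differences fall on [F], the Hoelder clause applies. Otherwise the bump takes at least
   one, and the factor [del] obtained is at most [del] to the power [beta]. *)
case: l2 sz a2 hv => [|s2 l2] sz a2 hv.
  have s1 : size l1 = r.+1 by move: sz; rewrite /= addn0 sm mr.
  have := hu2 _ s1; case: (l1) s1 eu => //= b1 bs [s1] eu /(_ isT) h.
  rewrite s1 in h.
  apply: (@le_trans _ _ (c * (del ^+ r * del `^ beta) * 1)).
    by apply: ler_pM => //; rewrite eu.
  rewrite mulr1 -[leLHS]mul1r; apply: ler_wpM2r; first by rewrite mulr_ge0.
  by rewrite exprn_ege1 // ler1n.
have s1 : (size l1 + size l2 = r)%N by move: sz; rewrite /= addnS sm mr => -[].
apply: (@le_trans _ _ (c * del ^+ size l1 * (2 * del) ^+ (size l2).+1)).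
  by apply: ler_pM => //; rewrite eu; apply: hu1; rewrite -s1 leq_addr.
have -> : c * del ^+ size l1 * (2 * del) ^+ (size l2).+1 =
    2 ^+ (size l2).+1 * (c * (del ^+ r * del)).
  have key (x y : R) i j : y * x ^+ i * (2 * x) ^+ j.+1 = 2 ^+ j.+1 * (y * (x ^+ (i + j) * x)).
    by rewrite exprMn exprD !exprS; ring.
  by rewrite key s1.
apply: ler_pM; rewrite ?exprn_ge0 ?mulr_ge0 ?exprn_ge0 ?(ltW del0) //.
  apply: ler_weXn2l; first by rewrite ler1n.
  by rewrite mr ltnS -s1 leq_addl.
by rewrite ler_wpM2l // ler_wpM2l ?exprn_ge0 ?(ltW del0).
Qed.

End Cutoff.

(** * Networks from trigonometric polynomials *)

Section RidgeMass.
Variable R : realType.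
Local Notation C := (complex R).
Variables (N V : nat).
Hypothesis VN : (V <= N)%N.
Hypothesis N0 : (0 < N)%N.

Definition trig (be : 'I_V -> C) (t : nat) : R :=
  complex.Re (\sum_v be v * cexp (v%:R * t%:R / N%:R)).

(** The range is extended to a full period [N], over which the [V <= N] exponentials are
    orthogonal. *)
Lemma trig_bessel (be : 'I_V -> C) T : (T <= N)%N ->
  \sum_(t < T) trig be t ^+ 2 <= N%:R * \sum_v n2 (be v).
Proof.
move=> TN.
have orth (v v' : 'I_V) : \sum_(t : 'I_N) cexp (v%:R * t%:R / N%:R) * conjc (cexp (v'%:R * t%:R / N%:R)) =
    if v == v' then real_complex R N%:R else 0.
  transitivity (\sum_(t < N) cexp ((v%:Z - v'%:Z)%:~R * t%:R / N%:R : R)).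
    apply: eq_bigr => t _; rewrite -cexpN -cexpD; congr cexp.
    by rewrite rmorphB /= !mulrBl.
  rewrite cexp_orth //.
    rewrite subr_eq0 eqz_nat -[LHS]/(if (v == v' :> nat) then _ else _) (inj_eq val_inj).
    by case: eqP => // _; rewrite rmorph_nat.
  by have := ltn_ord v; have := ltn_ord v'; move: (nat_of_ord v) (nat_of_ord v') => i j; lia.
rewrite -(parseval orth be) (big_ord_widen _ (fun t => trig be t ^+ 2) TN).
rewrite [leRHS](bigID (fun t : 'I_N => (t < T)%N)) /= ler_wpDr //.
  by apply: sumr_ge0 => t _; exact: n2_ge0.
by apply: ler_sum => t _; exact: Re_le_n2.
Qed.

Lemma fdiff_trig (be : 'I_V -> C) :
  fdiff (trig be) = trig (fun v => be v * (cexp (v%:R / N%:R) - 1)).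
Proof.
apply/funext => t; rewrite /fdiff /trig -[LHS]/(complex.Re _ - complex.Re _).
rewrite !Re_sum -sumrB; apply: eq_bigr => v _.
have -> : cexp (v%:R * t.+1%:R / N%:R : R) = cexp (v%:R / N%:R) * cexp (v%:R * t%:R / N%:R).
  by rewrite -cexpD -natr1; congr cexp; ring.
have ReB (x y : C) : complex.Re x - complex.Re y = complex.Re (x - y) by case: x => ? ?; case: y.
by rewrite ReB; congr complex.Re; ring.
Qed.

Lemma sqr_abs_sum_le (T : nat) (g : nat -> R) :
  (\sum_(t < T) `|g t|) ^+ 2 <= T%:R * \sum_(t < T) g t ^+ 2.
Proof.
have := @sqr_sum_le R 'I_T xpredT (fun t => `|g t|); rewrite card_ord.
by under [X in _ <= _ * X]eq_bigr do rewrite real_normK ?num_real //.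
Qed.

(** The left side is the mass bound of [ridge_net]. A difference multiplies the coefficient at
    frequency [v / N] by at most [8 * v / N] in modulus, so the second difference with its factor
    [T] yields the fourth power of [T * v / N]. *)
Lemma trig_ridge_mass (be : 'I_V -> C) T : (0 < T)%N -> (T <= N)%N ->
  (T%:R^-1 * (\sum_(i < T) `|trig be i|) + 2 * (\sum_(i < T) `|fdiff (trig be) i|)
      + 3 * T%:R * (\sum_(i < T) `|fdiff (fdiff (trig be)) i|)) ^+ 2 <=
  27 * 64 ^+ 2 * (N%:R / T%:R) * \sum_(v : 'I_V) (1 + T%:R * v%:R / N%:R) ^+ 4 * n2 (be v).
Proof.
move=> T0 TN; have TR : 0 < T%:R :> R by rewrite ltr0n.
have NR : 0 < N%:R :> R by rewrite ltr0n.
rewrite !fdiff_trig.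
set be1 := (fun v => be v * _); set be2 := (fun v => be1 v * _).
have a0 := sqr_abs_sum_le T (trig be).
have a1 := sqr_abs_sum_le T (trig be1).
have a2 := sqr_abs_sum_le T (trig be2).
have b0 := trig_bessel be TN.
have b1 := trig_bessel be1 TN.
have b2 := trig_bessel be2 TN.
move: a0 a1 a2 b0 b1 b2.
set S0 := \sum_(t < T) `|trig be t|; set S1 := \sum_(t < T) `|trig be1 t|; set S2 := \sum_(t < T) `|trig be2 t|.
set E0 := \sum_v n2 (be v); set E1 := \sum_v n2 (be1 v); set E2 := \sum_v n2 (be2 v).
move=> a0 a1 a2 b0 b1 b2.
have c0 : S0 ^+ 2 <= T%:R * (N%:R * E0) by apply: le_trans a0 _; rewrite ler_wpM2l.
have c1 : S1 ^+ 2 <= T%:R * (N%:R * E1) by apply: le_trans a1 _; rewrite ler_wpM2l.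
have c2 : S2 ^+ 2 <= T%:R * (N%:R * E2) by apply: le_trans a2 _; rewrite ler_wpM2l.
have three (x y z : R) : (x + y + z) ^+ 2 <= 3 * (x ^+ 2 + y ^+ 2 + z ^+ 2).
  have := sqr_ge0 (x - y); have := sqr_ge0 (x - z); have := sqr_ge0 (y - z).
  by rewrite !expr2; clear; lra.
apply: le_trans (three _ _ _) _; rewrite !exprMn.
apply: (@le_trans _ _ (3 * (T%:R^-1 ^+ 2 * (T%:R * (N%:R * E0)) + 2 ^+ 2 * (T%:R * (N%:R * E1))
    + 3 ^+ 2 * T%:R ^+ 2 * (T%:R * (N%:R * E2))))).
  by rewrite ler_wpM2l // !lerD // ler_wpM2l // ?mulr_ge0 // ?exprn_ge0 // invr_ge0.
have -> : 3 * (T%:R^-1 ^+ 2 * (T%:R * (N%:R * E0)) + 2 ^+ 2 * (T%:R * (N%:R * E1))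
    + 3 ^+ 2 * T%:R ^+ 2 * (T%:R * (N%:R * E2))) =
   N%:R / T%:R * (3 * E0 + 12 * (T%:R ^+ 2 * E1) + 27 * (T%:R ^+ 4 * E2)).
  by field; rewrite gt_eqF.
rewrite [leRHS](_ : _ = N%:R / T%:R * (27 * 64 ^+ 2 *
  \sum_(v : 'I_V) (1 + T%:R * v%:R / N%:R) ^+ 4 * n2 (be v))); last first.
  by rewrite [RHS]mulrA; congr (_ * _); rewrite mulrC.
apply: ler_wpM2l; first by rewrite divr_ge0.
have -> : 3 * E0 + 12 * (T%:R ^+ 2 * E1) + 27 * (T%:R ^+ 4 * E2) =
    \sum_v (3 * n2 (be v) + 12 * (T%:R ^+ 2 * n2 (be1 v)) + 27 * (T%:R ^+ 4 * n2 (be2 v))).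
  by rewrite !big_split -!mulr_sumr.
rewrite mulr_sumr. apply: ler_sum => v _.
set th := T%:R * v%:R / N%:R.
have th0 : 0 <= th by rewrite /th divr_ge0 ?mulr_ge0 // ltW.
have k1 : T%:R ^+ 2 * n2 (cexp (v%:R / N%:R) - 1) <= 64 * th ^+ 2.
  have -> : 64 * th ^+ 2 = T%:R ^+ 2 * (64 * (v%:R / N%:R) ^+ 2) by rewrite /th; ring.
  by rewrite ler_wpM2l ?exprn_ge0 // n2_cexp_sub1_le.
rewrite /be2 /be1 !n2M; set A := n2 (cexp _ - 1) in k1 *; set B := n2 (be v).
have A0 : 0 <= A := n2_ge0 _; have B0 : 0 <= B := n2_ge0 _.
have k2 : (T%:R ^+ 2 * A) ^+ 2 <= (64 * th ^+ 2) ^+ 2.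
  by rewrite lerXn2r ?nnegrE ?mulr_ge0 ?exprn_ge0.
have -> : 3 * B + 12 * (T%:R ^+ 2 * (B * A)) + 27 * (T%:R ^+ 4 * (B * A * A)) =
   (3 + 12 * (T%:R ^+ 2 * A) + 27 * (T%:R ^+ 2 * A) ^+ 2) * B by ring.
rewrite [leRHS]mulrA; apply: ler_wpM2r => //.
have t2 : 0 <= th ^+ 2 by rewrite exprn_ge0.
have t3 : 0 <= th ^+ 3 by rewrite exprn_ge0.
have t4 : 0 <= th ^+ 4 by rewrite exprn_ge0.
have e4 : (1 + th) ^+ 4 = 1 + 4 * th + 6 * th ^+ 2 + 4 * th ^+ 3 + th ^+ 4 by ring.
have e2 : (64 * th ^+ 2) ^+ 2 = 64 ^+ 2 * th ^+ 4 by ring.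
have s2 : 64 <= 64 ^+ 2 :> R by rewrite expr2; lra.
rewrite e2 in k2; rewrite e4.
move: k1 k2 th0 t2 t3 t4 s2.
move: ((T%:R ^+ 2 * A) ^+ 2) (T%:R ^+ 2 * A) (th ^+ 4) (th ^+ 3) (th ^+ 2) (64 ^+ 2 : R) => a b c e f s.
move=> k1 k2 th0 t2 t3 t4 s2.
have st : 0 <= (s - 64) * f by rewrite mulr_ge0 // subr_ge0.
have s0 : 0 <= s by lra.
have s1 : 0 <= s * th by rewrite mulr_ge0.
have s3 : 0 <= s * e by rewrite mulr_ge0.
by lra.
Qed.

End RidgeMass.

Lemma card_diam (T : finType) (h : T -> nat) (P : pred T) (D : nat) : injective h ->
  (forall y y', P y -> P y' -> (h y <= h y' + D)%N) -> (#|P| <= D.+1)%N.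
Proof.
move=> hi hD; case: (pickP P) => [y1 Py1|P0]; last by rewrite (eq_card0 P0).
case: (@arg_minnP _ y1 P h Py1) => y0 Py0 hmin.
rewrite -[leqRHS](card_ord D.+1).
apply: (@leq_card_in _ _ (fun y => inord (h y - h y0) : 'I_D.+1)) => y y' Py Py' /(congr1 val) /=.
have b z : P z -> (h z - h y0 < D.+1)%N by move=> Pz; rewrite ltnS leq_subLR; exact: hD.
rewrite !inordK ?b // => e; apply: hi.
by rewrite -(subnK (hmin _ Py)) e subnK // hmin.
Qed.

Lemma prod_card_bound (e : nat) (F : 'I_e.+1 -> nat) (l : 'I_e.+1) (A : nat) :
  (F l <= 2)%N -> (forall j, j != l -> (F j <= A)%N) -> (\prod_j F j <= 2 * A ^ e)%N.
Proof.
move=> h1 h2; rewrite (bigD1 l) //= leq_mul //.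
apply: (@leq_trans (\prod_(j | j != l) A)%N); first by apply: leq_prod => j; exact: h2.
by rewrite prod_nat_const cardC1 card_ord.
Qed.

(** * Grouping the frequencies by rounded direction *)

Section Cones.
Variables (e H K : nat).
Hypothesis K0 : (0 < K)%N.
Local Notation d := e.+1.
Local Notation n := (H.*2.+1).
Local Notation G := {ffun 'I_d -> 'I_H.*2.+1}.
Local Notation P := {ffun 'I_d -> 'I_(2 * K).+1}.

Definition cone (k : G) : 'I_d := [arg max_(j > ord0) `|kap (k j)|%N].
Definition vmax (k : G) : nat := `|kap (k (cone k))|.

Lemma kap_le_vmax (k : G) j : (`|kap (k j)| <= vmax k)%N.
Proof. by rewrite /vmax /cone; case: arg_maxnP => // i _; apply. Qed.

Lemma vmax_le (k : G) : (vmax k <= H)%N.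
Proof. exact: absz_kap. Qed.

(** The ratio [x / v] in [[-1, 1]], rounded down to the grid of mesh [1 / K] and shifted to
    [[0, 2 K]]. For [v = 0] division returns [0], which still counts as an end of the range in
    [quot_ends]. *)
Definition quot (v : nat) (x : int) : nat := ((K * `|(x + v%:Z)%R|) %/ v)%N.

Lemma quot_le v x : (`|x| <= v)%N -> (quot v x <= 2 * K)%N.
Proof.
move=> h; rewrite /quot; case: (posnP v) => [->|v0]; first by rewrite divn0.
by rewrite -ltnS ltn_divLR //; nia.
Qed.

Lemma quot_ends v x : `|x|%N = v -> (quot v x == 0)%N || (quot v x == 2 * K)%N.
Proof.
move=> h; rewrite /quot; case: (posnP v) => [->|v0]; first by rewrite divn0.
have [hx|hx] : x = v%:Z \/ x = - v%:Z by lia.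
  have -> : `|(x + v%:Z)%R|%N = (2 * v)%N by lia.
  by rewrite mulnA [(K * 2)%N]mulnC mulnK // eqxx orbT.
have -> : `|(x + v%:Z)%R|%N = 0%N by lia.
by rewrite muln0 div0n.
Qed.

Lemma quot_round v x : (`|x| <= v)%N ->
  0 <= K%:Z * x - v%:Z * ((quot v x)%:Z - K%:Z) <= v%:Z.
Proof.
move=> h; rewrite /quot; case: (posnP v) => [v0|v0].
  have -> : x = 0 by lia.
  by rewrite v0 mul0r subr0 mulr0 !lexx.
set y := `|(x + v%:Z)%R|%N.
have hy : y%:Z = x + v%:Z by rewrite /y; lia.
have := divn_eq (K * y) v; have := ltn_pmod (K * y) v0.
move: ((K * y) %/ v)%N ((K * y) %% v)%N => a b hb hab.
have : (K%:Z * y%:Z = a%:Z * v%:Z + b%:Z) by rewrite -!PoszM -PoszD -hab.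
rewrite hy => e1.
have -> : K%:Z * x - v%:Z * (a%:Z - K%:Z) = K%:Z * (x + v%:Z) - a%:Z * v%:Z by ring.
by rewrite e1 addrAC subrr add0r; lia.
Qed.

Definition pdir (k : G) : P := [ffun j => inord (quot (vmax k) (kap (k j)))].

Lemma pdirE k j : pdir k j = quot (vmax k) (kap (k j)) :> nat.
Proof. by rewrite ffunE inordK // ltnS quot_le // kap_le_vmax. Qed.

(** The top coordinate of a direction is [1] or [-1] after scaling, so only [extremal] pairs occur.
    They form a set of dimension [e], one less than the space. *)
Definition cls (k : G) : 'I_d * P := (cone k, pdir k).
Definition extremal (i : 'I_d * P) : bool := (val (i.2 i.1) == 0)%N || (val (i.2 i.1) == 2 * K)%N.

Lemma cls_extremal k : extremal (cls k).
Proof. by rewrite /extremal /= pdirE; apply: quot_ends. Qed.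

Lemma card_extremal : (#|extremal| <= d * (2 * (2 * K).+1 ^ e))%N.
Proof.
have -> : #|extremal| = (\sum_(l : 'I_d) \sum_(p : P | extremal (l, p)) 1)%N.
  by rewrite -sum1_card pair_big_dep /=; apply: eq_bigl => -[l p].
rewrite -[X in (_ <= X * _)%N](card_ord d) -sum_nat_const; apply: leq_sum => l _.
rewrite sum1_card.
pose F (j : 'I_d) : pred 'I_(2 * K).+1 :=
  fun y => (j != l) || (val y == 0)%N || (val y == 2 * K)%N.
apply: (@leq_trans #|[pred f : P | [forall j, F j (f j)]]|).
  apply: subset_leq_card; apply/fintype.subsetP => p; rewrite !inE => hp.
  apply/forallP => j; rewrite /F; case: eqP => [->|] //=.
rewrite card_ffun_forall; apply: (prod_card_bound (l := l)).
  rewrite /F eqxx /= -[leqRHS]card_bool.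
  apply: (@leq_card_in _ _ (fun y => val y == 0%N)) => y y' hy hy' ee; apply: val_inj.
  move: hy hy' ee; rewrite /in_mem /=; move: (nat_of_ord y) (nat_of_ord y') => a b.
  case: (a =P 0%N) => [->|_]; case: (b =P 0%N) => [->|_] //=.
  by move=> /eqP -> /eqP ->.
by move=> j jl; rewrite -[leqRHS](card_ord _) max_card.
Qed.

(** At height [v] the top coordinate has two possible values, and each other coordinate lies in a
    window of length [v / K]. *)
Lemma card_cls (i : 'I_d * P) v :
  (#|[pred k : G | (cls k == i) && (vmax k == v)]| <= 2 * (v %/ K).+1 ^ e)%N.
Proof.
case: i => l p.
pose F (j : 'I_d) : pred 'I_n := fun y =>
  if j == l then `|kap y|%N == v else (`|kap y| <= v)%N && (quot v (kap y) == p j).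
apply: (@leq_trans #|[pred k : G | [forall j, F j (k j)]]|).
  apply: subset_leq_card; apply/fintype.subsetP => k; rewrite !inE => /andP[/eqP[cl pk] /eqP kv].
  apply/forallP => j; rewrite /F; case: eqP => [->|_]; first by rewrite -kv /vmax cl.
  by rewrite -kv kap_le_vmax -pk pdirE eqxx.
rewrite card_ffun_forall; apply: (prod_card_bound (l := l)).
  rewrite /F eqxx -[leqRHS]card_bool.
  apply: (@leq_card_in _ _ (fun y => 0 <= kap y)) => y y' hy hy' ee; apply: (@kap_inj H).
  move: hy hy' ee; rewrite /in_mem /=; move: (kap y) (kap y') => a b /eqP h1 /eqP h2.
  by case: (leP 0 a) => ha; case: (leP 0 b) => hb // _; lia.
move=> j jl; rewrite /F (negPf jl).
pose h (y : 'I_n) : nat := `|(kap y + H%:Z)%R|%N.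
have hE y : (h y)%:Z = kap y + H%:Z by rewrite /h; have := absz_kap y; lia.
apply: (@card_diam _ h).
  by move=> y y' /(congr1 Posz); rewrite !hE => /addIr /kap_inj.
move=> y y' /andP[yv /eqP yq] /andP[yv' /eqP yq'].
have r1 := quot_round yv; have r2 := quot_round yv'.
rewrite yq in r1; rewrite yq' in r2.
have := hE y; have := hE y'; move: (h y) (h y') => a a'.
move: (kap y) (kap y') (p j : nat) yv yv' r1 r2 => b b' c yv yv' r1 r2 e1 e2.
suff : (a - a' <= v %/ K)%N by rewrite leq_subLR.
rewrite leq_divRL // mulnC.
have : K%:Z * b - K%:Z * b' <= v%:Z.
  by case/andP: r1 => _; case/andP: r2; move: (v%:Z * _) => q; lia.
rewrite -mulrBr => r3.
case: (leqP a a') => aa; first by move: aa; rewrite -subn_eq0 => /eqP ->; rewrite muln0.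
have : (K * (a - a'))%:Z <= v%:Z by rewrite PoszM -subzn ?(ltnW aa) //; have -> : a%:Z - a'%:Z = b - b' by lia.
by rewrite lez_nat.
Qed.

Lemma card_cls_mul v : (2 * (v %/ K).+1 ^ e * (d * (2 * (2 * K).+1 ^ e)) <= 4 * d * (3 * (v + K)) ^ e)%N.
Proof.
have -> : (2 * (v %/ K).+1 ^ e * (d * (2 * (2 * K).+1 ^ e)) = 4 * d * ((v %/ K).+1 * (2 * K).+1) ^ e)%N.
  by rewrite expnMn; ring.
rewrite leq_mul2l; apply/orP; right.
have h : ((v %/ K).+1 * (2 * K).+1 <= 3 * (v + K))%N.
  by have := leq_trunc_div v K; nia.
by elim: (e) => // i IH; rewrite !expnS leq_mul.
Qed.

End Cones.

(** * A network from a trigonometric polynomial *)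

Section TrigNet.
Variable R : realType.
Local Notation C := (complex R).
Variables (e H K Q : nat).
Hypotheses (K0 : (0 < K)%N) (Q0 : (0 < Q)%N).
Local Notation d := e.+1.
Local Notation n := (H.*2.+1).
Local Notation G := {ffun 'I_d -> 'I_H.*2.+1}.
Local Notation P := {ffun 'I_d -> 'I_(2 * K).+1}.
Hypothesis nKQ : (K * Q <= n)%N.
Hypothesis ndQ : (2 * d * Q <= n)%N.
Variable b : G -> C.

(** With directions rounded to multiples of [1 / K], all phases at grid points are multiples of
    [1 / N]. Slopes lie in [[-Z, Z]]; adding [Z] makes them natural numbers up to [T = 2 * Z], as
    [ridge_net] requires. *)
Let N := (n * K)%N.
Let T := (2 * d * Q * K)%N.
Let Z := (d * Q * K)%N.

Let N0 : (0 < N)%N. Proof. by rewrite muln_gt0 K0. Qed.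
Let T0 : (0 < T)%N. Proof. by rewrite !muln_gt0 K0 Q0. Qed.
Let TN : (T <= N)%N. Proof. by rewrite leq_mul2r ndQ orbT. Qed.
Let HN : (H.+1 <= N)%N. Proof. by rewrite (leq_trans _ (leq_pmulr _ K0)) //; lia. Qed.

Definition vord (k : G) : 'I_H.+1 := Ordinal (vmax_le k : (vmax k < H.+1)%N).

(** The exponential in front undoes the shift of the slope by [Z]. *)
Definition cls_coef (i : 'I_d * P) (v : 'I_H.+1) : C :=
  cexp (- (v%:R * Z%:R / N%:R)) * \sum_(k | (cls K k == i) && (vmax k == v)) b k.

Definition slope (i : 'I_d * P) (z : 'I_d -> int) : int := \sum_j ((i.2 j)%:Z - K%:Z) * z j.

Definition round_phase (k : G) (z : 'I_d -> int) : R := (vmax k)%:R * (slope (cls K k) z)%:~R / N%:R.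
Definition phase (k : G) (z : 'I_d -> int) : R := \sum_j (kap (k j))%:~R * (z j)%:~R / n%:R.

Lemma slope_abs i z : (forall j, (`|z j| <= Q)%N) -> (`|slope i z| <= Z)%N.
Proof.
move=> hz; rewrite -lez_nat abszE /slope.
apply: le_trans (ler_norm_sum _ _ _) _.
apply: (@le_trans _ _ (\sum_(j < d) (Q * K)%:Z)).
  apply: ler_sum => j _; rewrite normrM mulrC PoszM; apply: ler_pM => //.
    by rewrite -abszE lez_nat.
  by have := ltn_ord (i.2 j); lia.
by rewrite sumr_const card_ord /Z -mulnA -[leLHS]mulr_natl natz -PoszM.
Qed.

Lemma trig_cls_coef i z (t : nat) : t%:Z = slope i z + Z%:Z ->
  trig N (cls_coef i) t = complex.Re (\sum_(k | cls K k == i) b k * cexp (round_phase k z)).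
Proof.
move=> ht; rewrite /trig; congr complex.Re.
rewrite [RHS](partition_big vord xpredT) //=; apply: eq_bigr => v _.
rewrite /cls_coef mulrAC mulr_sumr.
have -> : \sum_(k | (cls K k == i) && (vord k == v)) b k * cexp (round_phase k z) =
   \sum_(k | (cls K k == i) && (vmax k == v)) b k * cexp (round_phase k z) by [].
apply: eq_bigr => k /andP[/eqP ki /eqP kv].
rewrite -cexpD mulrC; congr (_ * cexp _).
have -> : t%:R = (slope i z)%:~R + Z%:R :> R by rewrite pmulrn ht rmorphD.
by rewrite /round_phase ki kv; ring.
Qed.

Lemma phase_round k z : (forall j, (`|z j| <= Q)%N) ->
  `|phase k z - round_phase k z| <= d%:R * Q%:R / K%:R.
Proof.
move=> hz; have nR := nR_gt0 R H; have KR : 0 < K%:R :> R by rewrite ltr0n.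
have -> : phase k z - round_phase k z = \sum_j
   (K%:Z * kap (k j) - (vmax k)%:Z * ((quot K (vmax k) (kap (k j)))%:Z - K%:Z))%:~R * (z j)%:~R / N%:R.
  rewrite /phase /round_phase /slope rmorph_sum /= mulr_sumr mulr_suml -sumrB; apply: eq_bigr => j _.
  rewrite pdirE // rmorphB !rmorphM !rmorphB /= /N natrM -!pmulrn.
  by field; rewrite !gt_eqF.
apply: le_trans (ler_norm_sum _ _ _) _.
apply: (@le_trans _ _ (\sum_(j < d) Q%:R / K%:R)); last first.
  by rewrite sumr_const card_ord -[leLHS]mulr_natl mulrA.
apply: ler_sum => j _; have := quot_round K0 (kap_le_vmax k j).
move: (K%:Z * _ - _) => r /andP[r0 r1].
rewrite !normrM normfV [`|N%:R|]ger0_norm // /N natrM ler_pdivrMr ?mulr_gt0 //.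
have -> : Q%:R / K%:R * (n%:R * K%:R) = n%:R * Q%:R :> R by field; rewrite gt_eqF.
rewrite -!intr_norm; apply: ler_pM => //.
  rewrite -[n%:R]/((n%:Z)%:~R) ler_int; have := vmax_le k; lia.
by rewrite -[Q%:R]/((Q%:Z)%:~R) ler_int -abszE lez_nat.
Qed.

Definition cls_dir (i : 'I_d * P) : 'rV[R]_d.+1 :=
  \row_a (if unlift ord_max a is Some j then Q%:R * ((i.2 j)%:R - K%:R) else Z%:R).

Lemma cls_dir_l1 i : \sum_a `|cls_dir i 0 a| <= T%:R.
Proof.
rewrite (bigD1 ord_max) //= mxE unlift_none ger0_norm //.
have -> : \sum_(a | a != ord_max) `|cls_dir i 0 a| = \sum_(j < d) `|Q%:R * ((i.2 j)%:R - K%:R)| :> R.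
  rewrite (reindex (lift ord_max)) /=; last first.
    exists (fun a => odflt ord0 (unlift ord_max a)) => [j _|a]; first by rewrite liftK.
    by rewrite inE; case: unliftP => [j -> //|->]; rewrite eqxx.
  apply: eq_big => [j|j _]; first by rewrite eq_sym neq_lift.
  by rewrite mxE liftK.
apply: (@le_trans _ _ (Z%:R + \sum_(j < d) Q%:R * K%:R)).
  rewrite lerD2l; apply: ler_sum => j _; rewrite normrM ger0_norm // ler_wpM2l //.
  have := ltn_ord (i.2 j); rewrite ltnS => h.
  have h' : (i.2 j)%:R <= 2 * K%:R :> R by rewrite -natrM ler_nat.
  by rewrite ler_norml; have : 0 <= (i.2 j)%:R :> R by []; move: h'; lra.
rewrite sumr_const card_ord -[_ *+ d]mulr_natl /Z /T !natrM; lra.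
Qed.

Lemma dotv_cls_dir i (z : 'I_d -> int) :
  dotv (ext (\row_j ((z j)%:~R / Q%:R))) (cls_dir i) = (slope i z + Z%:Z)%:~R.
Proof.
have QR : 0 < Q%:R :> R by rewrite ltr0n.
rewrite dotv_ext rmorphD /= mxE unlift_none; congr (_ + _).
rewrite /dotv /slope rmorph_sum; apply: eq_bigr => j _.
rewrite !mxE liftK rmorphM rmorphB /= -!pmulrn; field; by rewrite gt_eqF.
Qed.

(** The first factor is that of [trig_ridge_mass]. The power of [2 * d] comes from
    [T / N = 2 * d * Q / n] in the weight, and [2 * 3 ^ e] from counting classes and their
    members. *)
Definition net_const : R := 27 * 64 ^+ 2 * (2 * 3 ^+ e * (2 * d%:R) ^+ 4).

(* Cauchy-Schwarz over the extremal classes; the multiplicity [(v %/ K).+1 ^ e] of a class at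
   frequency [v] times the number [K ^ e] of classes is the number of lattice points at height [v]. *)
Lemma cls_mass_sum (mass : 'I_d * P -> R) :
  (forall i, mass i ^+ 2 <= 27 * 64 ^+ 2 * (N%:R / T%:R) *
     \sum_(v : 'I_H.+1) (1 + T%:R * v%:R / N%:R) ^+ 4 * n2 (cls_coef i v)) ->
  (\sum_(i | extremal i) mass i) ^+ 2 <=
  net_const * (n%:R / Q%:R) ^+ d * \sum_(k : G) (1 + rfreq R Q (k (cone k))) ^+ (d + 3) * n2 (b k).
Proof.
move=> hm; have nR := nR_gt0 R H; have KR : 0 < K%:R :> R by rewrite ltr0n.
have QR : 0 < Q%:R :> R by rewrite ltr0n.
have dR : 1 <= d%:R :> R by rewrite ler1n.
pose X := #|@extremal e K|.
have [D DE0] : exists D : R, D = 27 * 64 ^+ 2 * (N%:R / T%:R) by exists (27 * 64 ^+ 2 * (N%:R / T%:R)).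
have D0 : 0 <= D by rewrite DE0 !mulr_ge0 // ?exprn_ge0 // invr_ge0.
rewrite -DE0 in hm.
have nv i (v : 'I_H.+1) : n2 (cls_coef i v) <=
   (2 * (v %/ K).+1 ^ e)%N%:R * \sum_(k | (cls K k == i) && (vmax k == v)) n2 (b k).
  rewrite /cls_coef n2M n2_cexp mul1r; apply: le_trans (n2_sum_le _ _) _.
  rewrite ler_wpM2r //; first by apply: sumr_ge0 => k _; exact: n2_ge0.
  by rewrite ler_nat; apply: leq_trans (card_cls H K0 i v); apply: eq_leq; exact: eq_card.
apply: (@le_trans _ _ (X%:R * \sum_(i | extremal i) D * \sum_(v : 'I_H.+1) \sum_(k | (cls K k == i) && (vord k == v))
     (1 + T%:R * (vmax k)%:R / N%:R) ^+ 4 * (2 * (vmax k %/ K).+1 ^ e)%N%:R * n2 (b k))).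
  apply: le_trans (sqr_sum_le _ _) _; rewrite ler_wpM2l //; apply: ler_sum => i _.
  apply: le_trans (hm i) _; rewrite ler_wpM2l //; apply: ler_sum => v _.
  have p0 : 0 <= (1 + T%:R * v%:R / N%:R) ^+ 4 :> R.
    by rewrite exprn_ge0 // addr_ge0 // divr_ge0 // mulr_ge0.
  apply: le_trans (ler_wpM2l p0 (nv i v)) _; rewrite mulrA mulr_sumr.
  rewrite le_eqVlt; apply/orP; left; apply/eqP; apply: eq_bigr => k /andP[_ /eqP kv].
  by rewrite kv.
have -> : \sum_(i | extremal i) D * \sum_(v : 'I_H.+1) \sum_(k | (cls K k == i) && (vord k == v))
     (1 + T%:R * (vmax k)%:R / N%:R) ^+ 4 * (2 * (vmax k %/ K).+1 ^ e)%N%:R * n2 (b k) =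
   D * \sum_(k : G) (1 + T%:R * (vmax k)%:R / N%:R) ^+ 4 * (2 * (vmax k %/ K).+1 ^ e)%N%:R * n2 (b k).
  rewrite -mulr_sumr; congr (_ * _).
  rewrite [RHS](partition_big (cls K) (@extremal e K)) /=; last by move=> k _; exact: cls_extremal.
  by apply: eq_bigr => i _; rewrite [RHS](partition_big vord xpredT).
rewrite !mulr_sumr; apply: ler_sum => k _.
rewrite !mulrA ler_wpM2r ?n2_ge0 //.
set rho := rfreq R Q (k (cone k)).
have rho0 : 0 <= rho by exact: rfreq_ge0.
have rE : (vmax k)%:R * Q%:R = rho * n%:R :> R by rewrite /rho /rfreq /vmax divfK // gt_eqF.
have thE : T%:R * (vmax k)%:R / N%:R = 2 * d%:R * rho.
  rewrite /T /N !natrM /rho /rfreq /vmax; field; by rewrite !gt_eqF.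
have h1 : (1 + T%:R * (vmax k)%:R / N%:R) ^+ 4 <= (2 * d%:R) ^+ 4 * (1 + rho) ^+ 4.
  rewrite -exprMn thE lerXn2r ?nnegrE ?addr_ge0 ?mulr_ge0 ?addr_ge0 //.
  by rewrite mulrDr mulr1 lerD2r; lra.
(* Number of classes times size of a class; here [K * Q <= n] lets [n / Q] replace [K]. *)
have h2 : X%:R * (2 * (vmax k %/ K).+1 ^ e)%N%:R <= 4 * d%:R * 3 ^+ e * ((n%:R / Q%:R) ^+ e * (1 + rho) ^+ e).
  apply: (@le_trans _ _ (4 * d * (3 * (vmax k + K)) ^ e)%N%:R).
    rewrite -natrM ler_nat; apply: leq_trans (card_cls_mul e K0 (vmax k)).
    by rewrite mulnC leq_mul2l card_extremal // orbT.
  rewrite !natrM natrX natrM exprMn -!mulrA ler_wpM2l // ler_wpM2l // ler_wpM2l ?exprn_ge0 //.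
  rewrite -exprMn lerXn2r ?nnegrE ?mulr_ge0 ?invr_ge0 ?addr_ge0 //.
  have -> : n%:R / Q%:R * (1 + rho) = (n%:R + (vmax k)%:R * Q%:R) / Q%:R by rewrite rE; ring.
  rewrite ler_pdivlMr // natrD mulrDl addrC lerD2r -natrM ler_nat //.
have DE : D = 27 * 64 ^+ 2 * (n%:R / Q%:R / (2 * d%:R)).
  rewrite DE0 /N /T !natrM; congr (_ * _); field.
  by rewrite !gt_eqF // (lt_le_trans _ dR).
rewrite DE.
have p1 : 0 <= (1 + T%:R * (vmax k)%:R / N%:R) ^+ 4 :> R.
  by rewrite exprn_ge0 // thE addr_ge0 // !mulr_ge0.
have h3 := ler_pM p1 (mulr_ge0 (ler0n R _) (ler0n R _)) h1 h2.
have h4 := ler_wpM2l D0 h3; rewrite DE in h4.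
apply: le_trans (le_trans _ h4) _; rewrite le_eqVlt; apply/orP; left; apply/eqP; first by ring.
have -> : (1 + rho) ^+ (d + 3) = (1 + rho) ^+ e * (1 + rho) ^+ 4.
  by rewrite -exprD addSnnS.
rewrite /net_const (exprS _ e).
have d0 : d%:R != 0 :> R by rewrite pnatr_eq0.
move: (64 ^+ 2 : R) ((n%:R / Q%:R) ^+ e) ((1 + rho) ^+ e) (3 ^+ e : R) ((1 + rho) ^+ 4) => u1 u2 u3 u4 u5.
move: (d%:R : R) d0 => dd d0.
by field; rewrite d0 gt_eqF.
Qed.

(** The mass bound is free of [K], while the error of rounding the directions decreases like
    [1 / K]. So [K] can be chosen last, with [n] adapted to it. *)
Lemma trig_net : exists s : seq (R * 'rV[R]_d.+1),
  seq_mass s ^+ 2 <= net_const * (n%:R / Q%:R) ^+ d *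
     \sum_(k : G) (1 + rfreq R Q (k (cone k))) ^+ (d + 3) * n2 (b k) /\
  forall z : 'I_d -> int, (forall j, (`|z j| <= Q)%N) ->
    (seq_net s (\row_j ((z j)%:~R / Q%:R)) - complex.Re (\sum_k b k * cexp (phase k z))) ^+ 2 <=
    64 * (d%:R * Q%:R / K%:R) ^+ 2 * (n%:R ^+ d * \sum_k n2 (b k)).
Proof.
have hnet i := ridge_net (trig N (cls_coef i)) T0 (cls_dir_l1 i).
have [sf hsf] := choice hnet.
exists (flatten [seq sf i | i <- enum (@extremal e K)]); split.
  rewrite /seq_mass big_flatten big_map big_enum /=.
  apply: cls_mass_sum => i; apply: le_trans (trig_ridge_mass HN N0 _ T0 TN).
  have [h _] := hsf i.
  have m0 : 0 <= \sum_(p <- sf i) `|p.1| * enorm p.2.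
    by apply: sumr_ge0 => p _; rewrite mulr_ge0 // enorm_ge0.
  by rewrite lerXn2r ?nnegrE // (le_trans m0 h).
move=> z hz.
have -> : seq_net (flatten [seq sf i | i <- enum (@extremal e K)]) (\row_j ((z j)%:~R / Q%:R)) =
    complex.Re (\sum_k b k * cexp (round_phase k z)).
  rewrite /seq_net big_flatten big_map big_enum /=.
  rewrite (partition_big (cls K) (@extremal e K)) /=; last by move=> k _; exact: cls_extremal.
  rewrite Re_sum; apply: eq_bigr => i _.
  have sl := slope_abs i hz.
  pose t : nat := `|(slope i z + Z%:Z)%R|%N.
  have tE : t%:Z = slope i z + Z%:Z by rewrite /t; move: sl; move: (slope i z) Z => a c; lia.
  rewrite -(trig_cls_coef tE); have [_] := hsf i; apply.
    suff : t%:Z <= T%:Z by rewrite lez_nat.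
    rewrite tE; have -> : T = (Z + Z)%N by rewrite /T /Z; ring.
    by move: sl; move: (slope i z) Z => a c; lia.
  by rewrite dotv_cls_dir -tE.
have ReB (x y : C) : complex.Re x - complex.Re y = complex.Re (x - y) by case: x => ? ?; case: y.
rewrite ReB -sumrB; apply: le_trans (Re_le_n2 _) _.
apply: le_trans (n2_sum_le _ _) _.
have -> : #|(fun _ : G => true)|%:R = n%:R ^+ d :> R.
  by rewrite -natrX; congr (_%:R); rewrite card_ffun !card_ord.
rewrite mulrCA ler_wpM2l ?exprn_ge0 // mulr_sumr; apply: ler_sum => k _.
rewrite -mulrBr n2M mulrC ler_wpM2r ?n2_ge0 //.
apply: le_trans (n2_cexpB_le _ _) _; rewrite ler_wpM2l //.
rewrite -[X in X <= _]real_normK ?num_real // lerXn2r ?nnegrE ?divr_ge0 ?mulr_ge0 //.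
by rewrite distrC phase_round.
Qed.

End TrigNet.

(** * The Hoelder class *)

Section HolderGrid.
Variable R : realType.
Local Notation C := (complex R).
Variables (e r : nat) (beta c : R).
Local Notation d := e.+1.
Local Notation m := r.+1.
Local Notation p := (d + 4)%N.
Hypothesis beta01 : 0 < beta <= 1.

Lemma cexp_sum (I : finType) (t : I -> R) : cexp (\sum_i t i) = \prod_i cexp (t i) :> C.
Proof. by apply: (big_morph (@cexp R)); [exact: cexpD|exact: cexp0]. Qed.

(** This is [4 ^ - alpha], the ratio between the squared [m]-th differences of consecutive dyadic
    steps. *)
Definition hol_y : R := 2 `^ (- (2 * (r%:R + beta))).
Hypothesis x1 : 1 < 2 ^+ (d + 3) * hol_y.

Lemma hol_y01 : 0 < hol_y <= 1.
Proof.
case/andP: beta01 => b0 _; rewrite /hol_y powR_gt0 //= powRN invf_le1 ?powR_gt0 //.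
by rewrite -[leLHS](powRr0 2) ler_powR ?ler1n // mulr_ge0 // addr_ge0 // ltW.
Qed.

Lemma hol_y_dyadic j : ((2 ^+ j.+2)^-1 ^+ r * (2 ^+ j.+2)^-1 `^ beta) ^+ 2 <= hol_y ^+ j.
Proof.
case/andP: beta01 => b0 _; set del := (2 ^+ j.+2)^-1; set a := r%:R + beta.
have a0 : 0 < a by rewrite ltr_wpDl.
have p0 : 0 < del by rewrite invr_gt0 exprn_gt0.
have -> : del ^+ r * del `^ beta = del `^ a.
  by rewrite powRD ?powR_mulrn ?(ltW p0) // (gt_eqF p0) implybT.
have -> : del = 2 `^ (- j.+2%:R) by rewrite powRN powR_mulrn.
rewrite -powRrM /hol_y -/a -powR_mulrn; last exact: powR_ge0.
rewrite -[leLHS]powR_mulrn; last exact: powR_ge0.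
rewrite -!powRrM.
apply: ler_powR; first by rewrite ler1n.
have -> : j.+2%:R = j%:R + 2 :> R by rewrite -addn2 natrD.
have j0 : 0 <= j%:R :> R by [].
by have := mulr_ge0 j0 (ltW a0); move: (j%:R : R) j0 a0 => u *; lra.
Qed.

Definition mass_const : R :=
  net_const R e * d%:R * energy_const d m hol_y * (4 ^+ m * c) ^+ 2 * (3 * m + 7)%N%:R ^+ d.

Variables (F : 'rV[R]_d -> R).
Hypothesis Fholder : holder_norm_le r beta F c.

Section Torus.
Variables (J q H K : nat).
Hypotheses (pJ : (p <= 2 ^ J)%N) (Jq : (J <= q)%N) (K0 : (0 < K)%N).
Local Notation n := (H.*2.+1).
Local Notation G := {ffun 'I_d -> 'I_H.*2.+1}.
Local Notation Q := (2 ^ q)%N.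
Local Notation w := (2 ^ (q - J))%N.
Hypotheses (nbig : ((4 * m + 6) * Q < n)%N) (nKQ : (K * Q <= n)%N) (ndQ : (2 * d * Q <= n)%N).

Let Q0 : (0 < Q)%N. Proof. by rewrite expn_gt0. Qed.
Let w0 : (0 < w)%N. Proof. by rewrite expn_gt0. Qed.
Let f : G -> R := cutoff F m Q.
Let g : G -> R := smooth w p m f.
Let cf : R := (4 ^+ m * c) ^+ 2.

Let c_ge0 : 0 <= c.
Proof. by case: Fholder => _ hb _; apply: le_trans (normr_ge0 _) (hb [::] isT 0). Qed.

Let F_bound x : `|F x| <= c.
Proof. by case: Fholder => _ hb _; exact: (hb [::]). Qed.

Let f_sqr a : f a ^+ 2 <= cf.
Proof.
have h : `|f a| <= 4 ^+ m * c.
  apply: (@le_trans _ _ c); first by apply: (cutoff_bound _ Q0); exact: F_bound.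
  by rewrite -[leLHS]mul1r; apply: ler_wpM2r; [exact: c_ge0|rewrite exprn_ege1 // ler1n].
rewrite -[leLHS]real_normK ?num_real // /cf lerXn2r ?nnegrE //.
exact: le_trans (normr_ge0 _) h.
Qed.

Let f_diff l j : (j.+2 <= q)%N -> forall a, iter m (tdiff l (2 ^ (q - j.+2))) f a ^+ 2 <= cf * hol_y ^+ j.
Proof.
move=> jq a; rewrite iter_tdiff_dseq -[leLHS]real_normK ?num_real //.
have S0 : (0 < 2 ^ (q - j.+2) <= Q)%N by rewrite expn_gt0 /= leq_exp2l // leq_subr.
have dE : (2 ^ (q - j.+2))%:R / Q%:R = (2 ^+ j.+2)^-1 :> R.
  have -> : Q%:R = (2 ^ (q - j.+2))%:R * 2 ^+ j.+2 :> R by rewrite -natrX -natrM -expnD subnK.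
  have : (2 ^ (q - j.+2))%:R != 0 :> R by rewrite pnatr_eq0 -lt0n expn_gt0.
  by move: (_%:R) (2 ^+ _) => u v u0; rewrite invfM mulrA divff // mul1r.
have := cutoff_dseq Q0 erefl beta01 Fholder nbig l a S0 (size_nseq m (2 ^ (q - j.+2))%N).
rewrite all_nseq leqnn orbT dE => /(_ isT) h.
apply: (@le_trans _ _ ((4 ^+ m * c * ((2 ^+ j.+2)^-1 ^+ r * (2 ^+ j.+2)^-1 `^ beta)) ^+ 2)).
  by rewrite lerXn2r ?nnegrE // (le_trans (normr_ge0 _) h).
by rewrite exprMn ler_wpM2l ?sqr_ge0 // hol_y_dyadic.
Qed.

Let nsupp_f : (nsupp f)%:R <= ((3 * m + 7)%N%:R * Q%:R) ^+ d :> R.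
Proof.
rewrite -natrM -natrX ler_nat; apply: (@leq_trans (((3 * m + 6) * Q).+1 ^ d)%N); first exact: nsupp_cutoff.
by rewrite leq_exp2r //; nia.
Qed.

(** The phase moves the origin of the Fourier series to the torus index at which [gridpt] puts the
    origin of the space. *)
Let b (k : G) : C := hat g k * cexp (\sum_j (kap (k j))%:~R * ((2 * m + 4) * Q)%N%:R / n%:R).

Let n2_b k : n2 (b k) = n2 (hat g k).
Proof. by rewrite /b n2M n2_cexp mulr1. Qed.

Lemma holder_torus_net : exists s : seq (R * 'rV[R]_d.+1),
  seq_mass s ^+ 2 <= mass_const * (2 ^+ (d + 3) * hol_y) ^+ J /\
  forall z : 'I_d -> int, (forall j, (`|z j| <= Q)%N) ->
    `|seq_net s (\row_j ((z j)%:~R / Q%:R)) - F (\row_j ((z j)%:~R / Q%:R))| <=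
    (2 + 2 ^+ m) ^+ d * (4 ^+ m * c * ((p%:R / 2 ^+ J) ^+ r * (p%:R / 2 ^+ J) `^ beta)) +
    Num.sqrt (64 * (d%:R * Q%:R / K%:R) ^+ 2 *
      (smooth_const R m ^+ d * (cf * ((3 * m + 7)%N%:R * Q%:R) ^+ d))).
Proof.
have nR := nR_gt0 R H; have QR : 0 < Q%:R :> R by rewrite ltr0n.
have [s [hs1 hs2]] := trig_net K0 Q0 nKQ ndQ b.
have cf0 : 0 <= cf by rewrite sqr_ge0.
have S0 : 0 <= smooth_const R m ^+ d by rewrite exprn_ge0 // smooth_const_ge0.
exists s; split.
  apply: le_trans hs1 _.
  have W0 (k : G) l : 0 <= (1 + rfreq R Q (k l)) ^+ (d + 3) * n2 (hat g k).
    by rewrite mulr_ge0 ?n2_ge0 // exprn_ge0 // addr_ge0 // rfreq_ge0.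
  have net0 : 0 <= net_const R e.
    by rewrite /net_const !mulr_ge0 // !exprn_ge0 // mulr_ge0.
  pose E1 : R := energy_const d m hol_y * (cf * (nsupp f)%:R / n%:R ^+ d) * (2 ^+ (d + 3) * hol_y) ^+ J.
  have h1 : \sum_(k : G) (1 + rfreq R Q (k (cone k))) ^+ (d + 3) * n2 (b k) <= d%:R * E1.
    apply: (@le_trans _ _ (\sum_(k : G) \sum_(l < d) (1 + rfreq R Q (k l)) ^+ (d + 3) * n2 (hat g k))).
      apply: ler_sum => k _; rewrite n2_b (bigD1 (cone k)) //= lerDl.
      by apply: sumr_ge0 => l _; exact: W0.
    rewrite exchange_big /= mulr_natl -[in leRHS](card_ord d) -sumr_const; apply: ler_sum => l _.
    by apply: weighted_energy => //; [exact: hol_y01|exact: f_diff].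
  apply: le_trans (ler_wpM2l _ h1) _; first by rewrite mulr_ge0 // exprn_ge0 // divr_ge0.
  have en0 : 0 <= energy_const d m hol_y.
    rewrite /energy_const mulr_ge0 // addr_ge0 ?exprn_ge0 // mulr_ge0 ?exprn_ge0 //.
    by rewrite addr_ge0 // invr_ge0 subr_ge0 ltW.
  have xJ : 0 <= (2 ^+ (d + 3) * hol_y) ^+ J by rewrite exprn_ge0 // (le_trans _ (ltW x1)).
  (* The side [n] of the torus cancels, and the [Q ^ d] left is matched by the size of the support.
     Hence [mass_const] involves neither [q], [H] nor [K]. *)
  have -> : net_const R e * (n%:R / Q%:R) ^+ d * (d%:R * E1) =
     net_const R e * d%:R * energy_const d m hol_y * cf * ((nsupp f)%:R / Q%:R ^+ d) * (2 ^+ (d + 3) * hol_y) ^+ J.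
    rewrite /E1 expr_div_n.
    have : n%:R ^+ d != 0 :> R by rewrite expf_neq0 // gt_eqF.
    have : Q%:R ^+ d != 0 :> R by rewrite expf_neq0 // gt_eqF.
    move: (n%:R ^+ d) (Q%:R ^+ d) => u v v0 u0.
    move: (net_const R e) (energy_const _ _ _) ((_ * hol_y) ^+ J) (d%:R : R) ((nsupp f)%:R : R) => a1 a2 a3 a4 a5.
    by field; rewrite ?u0 ?v0.
  rewrite /mass_const -/cf; apply: ler_wpM2r => //; apply: ler_wpM2l.
    exact: (mulr_ge0 (mulr_ge0 (mulr_ge0 net0 (ler0n _ _)) en0) cf0).
  by rewrite ler_pdivrMr ?exprn_gt0 // -exprMn.
move=> z hz.
pose a : G := [ffun j => inord `|(((2 * m + 4) * Q)%:Z + z j)%R|%N].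
have aE j : (a j)%:Z = ((2 * m + 4) * Q)%:Z + z j.
  have := hz j; rewrite ffunE; move: (z j) => zj hzj.
  have h0 : (`|(((2 * m + 4) * Q)%:Z + zj)%R| < n)%N by move: nbig hzj; clear; nia.
  by rewrite inordK //; move: hzj; clear; nia.
have gp : gridpt R m Q a = \row_j ((z j)%:~R / Q%:R).
  apply/rowP => j; rewrite !mxE; congr (_ / _).
  have -> : (a j)%:R = ((a j)%:Z)%:~R :> R by [].
  by rewrite aE rmorphD /=; ring.
have fa : f a = F (\row_j ((z j)%:~R / Q%:R)).
  rewrite /f cutoff_eq ?gp // => j.
  by have := hz j; have := aE j; move: (nat_of_ord (a j)) (z j) => aj zj; clear; nia.
have ga : complex.Re (\sum_k b k * cexp (phase R k z)) = g a.
  have -> : \sum_k b k * cexp (phase R k z) = \sum_k hat g k * chi R k a.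
    apply: eq_bigr => k _; rewrite /b -mulrA -cexpD /phase -big_split /= /chi -cexp_sum.
    congr (_ * _); congr (cexp _); apply: eq_bigr => j _.
    have -> : (a j)%:R = ((a j)%:Z)%:~R :> R by [].
    by rewrite aE intrD; move: ((2 * m + 4) * Q)%N => c1; rewrite -pmulrn mulrDr mulrDl.
  by rewrite hat_inversion.
rewrite -fa.
have -> : seq_net s (\row_j ((z j)%:~R / Q%:R)) - f a = (g a - f a) + (seq_net s (\row_j ((z j)%:~R / Q%:R)) - g a) by ring.
apply: le_trans (ler_normD _ _) _; apply: lerD.
  rewrite distrC; apply: smooth_error => //.
    by rewrite !mulr_ge0 ?exprn_ge0 ?powR_ge0 // divr_ge0 // exprn_ge0.
  move=> l; apply: iter_bsm_bound => // a' s' ss as'.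
  have pw : (0 < p * w <= Q)%N.
    apply/andP; split; first by rewrite muln_gt0 w0 addnS.
    by rewrite -[X in (_ <= 2 ^ X)%N](subnKC Jq) expnD leq_mul2r pJ orbT.
  have := cutoff_dseq Q0 erefl beta01 Fholder nbig l a' pw ss as'.
  have -> // : (p * w)%N%:R / Q%:R = p%:R / 2 ^+ J :> R.
  have -> : Q%:R = w%:R * 2 ^+ J :> R by rewrite -natrX -natrM -expnD subnK.
  have : w%:R != 0 :> R by rewrite pnatr_eq0 -lt0n.
  by rewrite natrM; move: (w%:R) (2 ^+ J) (p%:R) => u v t u0; rewrite invfM mulrA mulfK.
rewrite -[leLHS]sqrtr_sqr; apply: ler_wsqrtr; rewrite -ga.
apply: le_trans (hs2 z hz) _; rewrite ler_wpM2l ?mulr_ge0 ?sqr_ge0 //.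
apply: (@le_trans _ _ (n%:R ^+ d * \sum_k smooth_const R m ^+ d * n2 (hat f k))).
  rewrite ler_wpM2l ?exprn_ge0 //; apply: ler_sum => k _; rewrite n2_b; exact: n2_hat_smooth.
rewrite -mulr_sumr mulrCA ler_wpM2l // hat_parseval mulrA divff ?mul1r; last first.
  by rewrite expf_neq0 // gt_eqF.
by apply: le_trans (sum_sqr_nsupp f_sqr) _; rewrite ler_wpM2l.
Qed.

End Torus.

(** [K] is chosen to bring the rounding error below [eta], then [H] to meet the three lower bounds
    on the torus; the mass bound feels neither. *)
Lemma holder_grid_net (J q : nat) (eta : R) : (p <= 2 ^ J)%N -> (J <= q)%N -> 0 < eta ->
  exists s : seq (R * 'rV[R]_d.+1),
  seq_mass s ^+ 2 <= mass_const * (2 ^+ (d + 3) * hol_y) ^+ J /\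
  forall z : 'I_d -> int, (forall j, (`|z j| <= 2 ^ q)%N) ->
    `|seq_net s (\row_j ((z j)%:~R / (2 ^ q)%:R)) - F (\row_j ((z j)%:~R / (2 ^ q)%:R))| <=
    (2 + 2 ^+ m) ^+ d * (4 ^+ m * c * ((p%:R / 2 ^+ J) ^+ r * (p%:R / 2 ^+ J) `^ beta)) + eta.
Proof.
move=> pJ Jq eta0; set Q := (2 ^ q)%N.
pose A : R := d%:R * Q%:R; pose D : R := smooth_const R m ^+ d * ((4 ^+ m * c) ^+ 2 * ((3 * m + 7)%N%:R * Q%:R) ^+ d).
have D0 : 0 <= D.
  by rewrite /D mulr_ge0 ?exprn_ge0 ?smooth_const_ge0 // mulr_ge0 ?sqr_ge0 // exprn_ge0 // mulr_ge0.
pose B : R := 64 * A ^+ 2 * D.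
have B0 : 0 <= B by rewrite /B mulr_ge0 // mulr_ge0 // sqr_ge0.
have [K hK] : exists K : nat, (B + 1) / eta <= K%:R.
  exists (Num.truncn ((B + 1) / eta)).+1; exact: ltW (truncnS_gt _).
have KR : 0 < K%:R :> R.
  by apply: lt_le_trans hK; rewrite divr_gt0 // ltr_wpDl.
have K0 : (0 < K)%N by rewrite -(ltr0n R).
pose H := ((4 * m + 6) * Q + K * Q + 2 * d * Q)%N.
have [s [h1 h2]] := @holder_torus_net J q H K pJ Jq K0
  ltac:(by rewrite /H -/Q; lia) ltac:(by rewrite /H -/Q; lia) ltac:(by rewrite /H -/Q; lia).
exists s; split => // z hz; apply: le_trans (h2 z hz) _; rewrite lerD2l.
rewrite -[leRHS]ger0_norm ?(ltW eta0) // -[leRHS]sqrtr_sqr; apply: ler_wsqrtr.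
have -> : 64 * (d%:R * (2 ^ q)%:R / K%:R) ^+ 2 * D = B / K%:R ^+ 2.
  rewrite /B -/Q -/A; move: (A) => A'; rewrite expr_div_n; ring.
rewrite ler_pdivrMr ?exprn_gt0 // -exprMn.
have h3 : B + 1 <= eta * K%:R by rewrite mulrC -ler_pdivrMr.
apply: (@le_trans _ _ ((B + 1) ^+ 2)); first by move: B0; rewrite expr2; nra.
have B1 : 0 <= B + 1 by rewrite addr_ge0.
by rewrite lerXn2r ?nnegrE // (le_trans B1 h3).
Qed.

End HolderGrid.

(** * From the grid to the ball *)

Section HolderNet.
Variable R : realType.

Lemma holder_step (d r : nat) (beta c del h : R) (F : 'rV[R]_d -> R) (j : 'I_d) y :
  0 < beta <= 1 -> holder_norm_le r beta F c -> 0 < del <= 1 -> 0 <= h <= del ->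
  `|F (y + h *: delta_mx 0 j) - F y| <= c * del `^ beta.
Proof.
move=> b01 Fh /andP[d0 d1] hd.
have [h1 h2] := @dpart_dirseq_bound R d j r beta c del F b01 Fh (ltW d0) [:: h]
  ltac:(by rewrite /= hd) [::].
have c0 : 0 <= c by case: Fh => _ hb _; apply: le_trans (normr_ge0 _) (hb [::] isT 0).
case: (posnP r) => [r0|r0].
  by have := h2 isT; rewrite r0 /= expr0 mul1r; apply.
apply: (@le_trans _ _ (c * del)); first by have := h1; rewrite /= expr1; apply.
by rewrite ler_wpM2l //; apply: ger1_powR; [rewrite d0|case/andP: b01].
Qed.

Lemma holder_box (d r : nat) (beta c del : R) (F : 'rV[R]_d -> R) (x y : 'rV[R]_d) :
  0 < beta <= 1 -> holder_norm_le r beta F c -> 0 < del <= 1 ->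
  (forall j, 0 <= x 0 j - y 0 j <= del) -> `|F x - F y| <= d%:R * (c * del `^ beta).
Proof.
move=> b01 Fh d01 hxy.
pose u (i : nat) : 'rV[R]_d := \row_j (if (j < i)%N then x 0 j else y 0 j).
have u0 : u 0%N = y by apply/rowP => j; rewrite mxE.
have ud : u d = x by apply/rowP => j; rewrite mxE ltn_ord.
have hu i : (i <= d)%N -> `|F (u i) - F y| <= i%:R * (c * del `^ beta).
  elim: i => [|i IH] id; first by rewrite u0 subrr normr0 mul0r.
  have -> : u i.+1 = u i + (x 0 (Ordinal id) - y 0 (Ordinal id)) *: delta_mx 0 (Ordinal id).
    apply/rowP => j; rewrite !mxE eqxx /= ltnS leq_eqVlt.
    case: (eqVneq j (Ordinal id)) => [->|ne] /=; first by rewrite eqxx ltnn mulr1 addrC subrK.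
    have -> : (j == i :> nat) = false by apply/negbTE; apply: contra ne => /eqP e; apply/eqP/val_inj.
    by rewrite mulr0 addr0.
  rewrite -[_ - F y](subrKA (F (u i))); apply: le_trans (ler_normD _ _) _.
  rewrite -natr1 mulrDl mul1r addrC; apply: lerD; first exact: IH (ltnW id).
  exact: holder_step b01 Fh d01 (hxy _).
by have := hu d (leqnn d); rewrite ud.
Qed.

(** Both points are compared with their coordinatewise minimum, since [holder_box] moves by
    nonnegative increments only. *)
Lemma holder_modulus (d r : nat) (beta c del : R) (F : 'rV[R]_d -> R) (x x' : 'rV[R]_d) :
  0 < beta <= 1 -> holder_norm_le r beta F c -> 0 < del <= 1 ->
  (forall j, `|x 0 j - x' 0 j| <= del) -> `|F x - F x'| <= 2 * (d%:R * (c * del `^ beta)).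
Proof.
move=> b01 Fh d01 hx.
pose y : 'rV[R]_d := \row_j Num.min (x 0 j) (x' 0 j).
have h1 : `|F x - F y| <= d%:R * (c * del `^ beta).
  apply: (holder_box b01 Fh d01).
  move=> j; rewrite mxE; have := hx j; rewrite ler_norml.
  by case: (leP (x 0 j) (x' 0 j)) => h /andP[]; case/andP: d01 => d0 _; move=> *; apply/andP; split; lra.
have h2 : `|F x' - F y| <= d%:R * (c * del `^ beta).
  apply: (holder_box b01 Fh d01).
  move=> j; rewrite mxE; have := hx j; rewrite ler_norml.
  by case: (leP (x 0 j) (x' 0 j)) => h /andP[]; case/andP: d01 => d0 _; move=> *; apply/andP; split; lra.
have -> : F x - F x' = (F x - F y) - (F x' - F y) by ring.
by apply: le_trans (ler_normB _ _) _; rewrite mulr2n mulrDl !mul1r lerD.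
Qed.

(** The grid estimate extends to the ball because both sides have a modulus of continuity that is
    known before [q] is chosen, the mass bound being independent of [q]. In [C2] the [3] is one
    [eta] from the grid and two from this passage. *)
Lemma holder_NN (e r : nat) (beta c : R) : 0 < beta <= 1 ->
  r%:R + beta < (e.+1%:R + 3) / 2 ->
  exists C1 C2 : R, [/\ 0 <= C1, 0 <= C2 & forall F, holder_norm_le r beta F c ->
    forall J, (e.+1 + 4 <= 2 ^ J)%N -> exists N g,
      NN e.+1 N (C1 * (2 ^+ J) `^ ((e.+1%:R + 3) / 2 - (r%:R + beta))) g /\
      forall x, unit_ball e.+1 x -> `|g x - F x| <= C2 * (2 ^+ J) `^ (- (r%:R + beta))].
Proof.
move=> b01 ra; set al := r%:R + beta; set d := e.+1; set m := r.+1.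
have [b0 b1] := andP b01.
have al0 : 0 < al by rewrite ltr_wpDl.
case: (leP 0 c) => c0; last first.
  exists 0, 0; split=> // F [_ hb _]; have := hb [::] isT 0.
  by move=> /(le_trans (normr_ge0 _)); rewrite leNgt c0.
have xE : 2 ^+ (d + 3) * hol_y r beta = 2 `^ (2 * ((d%:R + 3) / 2 - al)) :> R.
  rewrite /hol_y -/al -powR_mulrn // -powRD; last by rewrite pnatr_eq0 implybT.
  by congr (2 `^ _); rewrite natrD; field.
have x1 : 1 < 2 ^+ (d + 3) * hol_y r beta :> R.
  have t0 : 0 < 2 * ((d%:R + 3) / 2 - al) by rewrite mulr_gt0 // subr_gt0.
  have := @gt0_ltr_powR R _ t0 1 2; rewrite !nnegrE powR1 -xE; apply => //.
  by rewrite ltr1n.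
pose C1 : R := Num.sqrt (mass_const e r beta c).
pose C2 : R := (2 + 2 ^+ m) ^+ d * (4 ^+ m * c * (d + 4)%N%:R `^ al) + 3.
exists C1, C2; split; first exact: sqrtr_ge0.
  rewrite addr_ge0 // mulr_ge0 ?exprn_ge0 ?addr_ge0 ?exprn_ge0 //.
  by rewrite !mulr_ge0 ?exprn_ge0 ?powR_ge0.
move=> F Fh J pJ.
have J0 : 0 < 2 ^+ J :> R by rewrite exprn_gt0.
pose eta : R := (2 ^+ J) `^ (- al).
have eta0 : 0 < eta by rewrite powR_gt0.
pose M1 : R := C1 * (2 ^+ J) `^ ((d%:R + 3) / 2 - al).
have M10 : 0 <= M1 by rewrite mulr_ge0 ?powR_ge0 ?sqrtr_ge0.
(* The first term makes a step of the grid change [F] by at most [eta], the second does the same for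
   a network of mass [M1]. *)
pose X : R := ((d%:R * c + 1) / eta) `^ beta^-1 + d%:R * M1 / eta.
have [q0 _ hq0] := exists_nat_ge X.
pose q := maxn J q0; pose Q := (2 ^ q)%N.
have QX : X <= Q%:R.
  apply: le_trans hq0 _; rewrite ler_nat; apply: leq_trans (leq_maxr J q0) _.
  exact: ltnW (ltn_expl _ _).
have Q0 : (0 < Q)%N by rewrite expn_gt0.
have QR : 0 < Q%:R :> R by rewrite ltr0n.
have dc0 : 0 < d%:R * c + 1 by rewrite ltr_wpDl // mulr_ge0.
have t1 : 0 <= ((d%:R * c + 1) / eta) `^ beta^-1 by exact: powR_ge0.
have t2 : 0 <= d%:R * M1 / eta by rewrite divr_ge0 ?(ltW eta0) // mulr_ge0.
have e1 : d%:R * Q%:R^-1 * M1 <= eta.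
  have : d%:R * M1 / eta <= Q%:R by apply: le_trans QX; rewrite /X lerDr.
  rewrite ler_pdivrMr // => h.
  by rewrite mulrAC ler_pdivrMr // mulrC [leRHS]mulrC // mulrC.
have e2 : d%:R * (c * Q%:R^-1 `^ beta) <= eta.
  have : ((d%:R * c + 1) / eta) `^ beta^-1 <= Q%:R by apply: le_trans QX; rewrite /X lerDl.
  move=> /(ge0_ler_powR (ltW b0)); rewrite !nnegrE => /(_ t1 (ltW QR)).
  rewrite -powRrM mulVf ?gt_eqF // powRr1; last by rewrite divr_ge0 ?(ltW dc0) ?(ltW eta0).
  rewrite ler_pdivrMr // => h.
  have Qb : 0 < Q%:R `^ beta :> R by rewrite powR_gt0.
  rewrite -powR_inv1 // -powRrM mulN1r powRN mulrA ler_pdivrMr // [leRHS]mulrC.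
  by apply: le_trans h; rewrite lerDl.
have [s [hs1 hs2]] := holder_grid_net b01 x1 Fh pJ (leq_maxl J q0) eta0.
have sM : seq_mass s <= M1.
  have m0 : 0 <= seq_mass s by apply: sumr_ge0 => p _; rewrite mulr_ge0 // enorm_ge0.
  have mc : 0 <= mass_const e r beta c.
    rewrite -(pmulr_lge0 _ (exprn_gt0 J (lt_trans ltr01 x1))).
    exact: le_trans (sqr_ge0 _) hs1.
  rewrite -[leLHS]ger0_norm // -[leLHS]sqrtr_sqr.
  apply: le_trans (ler_wsqrtr hs1) _; rewrite sqrtrM // -/C1 /M1 ler_wpM2l ?sqrtr_ge0 //.
  rewrite xE -[leRHS]ger0_norm ?powR_ge0 // -[leRHS]sqrtr_sqr; apply: ler_wsqrtr.
  rewrite -powR_mulrn ?powR_ge0 // -powRrM -[in leRHS]powR_mulrn // -powRrM.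
  rewrite -[in leRHS]powR_mulrn ?powR_ge0 // -powRrM.
  by rewrite le_eqVlt; apply/orP; left; apply/eqP; congr (2 `^ _); ring.
have sNN : NN d (size s) M1 (seq_net s) by exact: seq_net_NN.
exists (size s), (seq_net s); split => // x xb.
pose z (j : 'I_d) : int := Num.floor (Q%:R * x 0 j).
have xj j : `|x 0 j| <= 1 by exact: le_trans (coord_le_enorm _ _) xb.
have zlo j : (z j)%:~R <= Q%:R * x 0 j by exact: floor_le.
have zhi j : Q%:R * x 0 j < (z j)%:~R + 1.
  by have := floorD1_gt (Q%:R * x 0 j); rewrite intrD.
have zQ j : (`|z j| <= Q)%N.
  have h1 := ler_wpM2l (ltW QR) (xj j).
  have : `|Q%:R * x 0 j| <= Q%:R by rewrite normrM ger0_norm // -[leRHS]mulr1.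
  rewrite ler_norml => /andP[h2 h3].
  have a1 : z j <= Q%:Z by rewrite -(ler_int R); apply: le_trans (zlo j) h3.
  have a2 : - Q%:Z < z j + 1.
    by rewrite -(ltr_int R) rmorphN intrD; apply: le_lt_trans h2 (zhi j).
  by move: a1 a2; clear; lia.
pose x' : 'rV[R]_d := \row_j ((z j)%:~R / Q%:R).
have hx j : 0 <= x 0 j - x' 0 j <= Q%:R^-1.
  rewrite mxE; have -> : x 0 j - (z j)%:~R / Q%:R = (Q%:R * x 0 j - (z j)%:~R) / Q%:R.
    by field; rewrite gt_eqF.
  rewrite divr_ge0 ?subr_ge0 ?zlo // -[leRHS]mul1r ler_pM2r ?invr_gt0 //.
  by rewrite lerBlDr addrC ltW.
have Q1 : 0 < (Q%:R^-1 : R) <= 1 by rewrite invr_gt0 QR invf_le1 // ler1n.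
have b1' := hs2 z zQ.
have b2 : `|F x - F x'| <= eta by apply: le_trans (holder_box b01 Fh Q1 hx) e2.
have b3 : `|seq_net s x - seq_net s x'| <= eta.
  apply: le_trans (nn_fun_lip (x := x) (x' := x') (delta := Q%:R^-1) sNN _ _) e1.
    by rewrite invr_ge0.
  by move=> j; have /andP[h1 h2] := hx j; rewrite ger0_norm.
have -> : seq_net s x - F x = (seq_net s x - seq_net s x') + (seq_net s x' - F x') - (F x - F x') by ring.
apply: le_trans (ler_normB _ _) _; apply: le_trans (lerD (ler_normD _ _) (lexx _)) _.
have pe : ((d + 4)%N%:R / 2 ^+ J) ^+ r * ((d + 4)%N%:R / 2 ^+ J) `^ beta = (d + 4)%N%:R `^ al * eta :> R.
  have p0 : 0 < (d + 4)%N%:R / 2 ^+ J :> R by rewrite divr_gt0 // ltr0n addnS.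
  rewrite -powR_mulrn ?(ltW p0) // -powRD; last by rewrite (gt_eqF p0) implybT.
  rewrite -/al powRM ?invr_ge0 ?(ltW J0) //; congr (_ * _).
  by rewrite /eta -powR_inv1 ?(ltW J0) // -powRrM mulN1r.
rewrite pe in b1'.
have -> : C2 * (2 ^+ J) `^ (- al) = eta + ((2 + 2 ^+ m) ^+ d * (4 ^+ m * c * ((d + 4)%N%:R `^ al * eta)) + eta) + eta.
  by rewrite /C2 -/eta; ring.
by apply: lerD => //; apply: lerD.
Qed.

End HolderNet.

(** * Matching the scale with the mass *)

Section HolderRate.
Variable R : realType.

(** Constants must be fixed before [h] is given, whereas [holder_ball] hides [r] and [beta] behind
    [h]. Uniqueness identifies the two choices. *)
Lemma holder_exponent_unique (r r' : nat) (beta beta' : R) :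
  0 < beta <= 1 -> 0 < beta' <= 1 -> r%:R + beta = r'%:R + beta' -> r = r' /\ beta = beta'.
Proof.
move=> /andP[b0 b1] /andP[b0' b1'] h.
have rr : r = r'.
  case: (ltngtP r r') => // rr.
    by have : r.+1%:R <= r'%:R :> R; [rewrite ler_nat|clear rr; rewrite -natr1 => q; exfalso; lra].
  by have : r'.+1%:R <= r%:R :> R; [rewrite ler_nat|clear rr; rewrite -natr1 => q; exfalso; lra].
by split=> //; move: h; rewrite rr => /addrI.
Qed.

(* The scale [2 ^ J] is the largest dyadic number below [th * n ^ (1 / s)]; [th] makes the mass at
   that scale fit into [m1 * n ^ (gam / s)], and the small [n] are served by the zero network. *)
Lemma dyadic_scale (C1 m1 gam al s P : R) : 0 <= C1 -> 0 < m1 -> 0 < gam -> 0 < al -> 0 < s -> 1 <= P ->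
  exists2 C : R, 0 < C & forall n : nat, (2 <= n)%N ->
    (1 <= C * n%:R `^ (- (al / s))) \/
    exists J : nat, [/\ P <= 2 ^+ J, C1 * (2 ^+ J) `^ gam <= m1 * n%:R `^ (gam / s) &
      (2 ^+ J) `^ (- al) <= C * n%:R `^ (- (al / s))].
Proof.
move=> C10 m10 gam0 al0 s0 P1.
pose th : R := (m1 / (C1 + 1)) `^ gam^-1.
have C11 : 0 < C1 + 1 by rewrite ltr_wpDl.
have th0 : 0 < th by rewrite powR_gt0 // divr_gt0.
have thg : th `^ gam = m1 / (C1 + 1).
  by rewrite -powRrM mulVf ?gt_eqF // powRr1 // divr_ge0 // ltW.
pose C : R := (th / 2) `^ (- al) + (2 * P / th) `^ al.
have P0 : 0 < P by exact: lt_le_trans P1.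
have c1 : 0 < (th / 2) `^ (- al) by rewrite powR_gt0 // divr_gt0.
have c2 : 0 < (2 * P / th) `^ al by rewrite powR_gt0 // divr_gt0 // mulr_gt0.
exists C; first by rewrite addr_gt0.
move=> n n2; have nR : 0 < n%:R :> R by rewrite ltr0n; case: n n2.
pose L : R := n%:R `^ s^-1.
have L0 : 0 < L by rewrite powR_gt0.
have LE a : n%:R `^ (a / s) = L `^ a by rewrite /L -powRrM mulrC.
have LEN : n%:R `^ (- (al / s)) = L `^ (- al) by rewrite -mulNr LE.
rewrite LEN LE.
case: (ltP (th * L) (2 * P)) => h; [left|right].
  have LP : L <= 2 * P / th by rewrite ler_pdivlMr // mulrC ltW.
  rewrite powRN ler_pdivlMr ?powR_gt0 // mul1r.
  apply: (@le_trans _ _ ((2 * P / th) `^ al)); last by rewrite /C lerDr ltW.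
  by apply: ge0_ler_powR; rewrite ?nnegrE ?(ltW al0) ?(ltW L0) // ltW // divr_gt0 // mulr_gt0.
have rho1 : 1 <= th * L by apply: le_trans h; move: P1; clear; lra.
have [k _ hk] := exists_nat_ge (th * L).
have rk : th * L < 2 ^+ k.
  apply: le_lt_trans hk _; rewrite -natrX ltr_nat; exact: ltn_expl.
have [J _ /andP[j1 j2]] := dyadic_block rho1 rk.
have J0 : 0 < 2 ^+ J :> R by rewrite exprn_gt0.
exists J; split.
- by have := le_lt_trans h j2; rewrite exprS ltr_pM2l // => /ltW.
- have h1 : (2 ^+ J) `^ gam <= th `^ gam * L `^ gam.
    rewrite -powRM ?(ltW th0) ?(ltW L0) //.
    by apply: ge0_ler_powR; rewrite ?nnegrE ?(ltW gam0) ?(ltW J0) // mulr_ge0 ?(ltW th0) ?(ltW L0).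
  apply: le_trans (ler_wpM2l C10 h1) _; rewrite thg mulrA ler_wpM2r ?powR_ge0 //.
  by rewrite mulrA ler_pdivrMr // mulrC ler_wpM2l ?(ltW m10) // lerDl.
have h2 : th / 2 * L <= 2 ^+ J by move: j2; rewrite exprS; move: (2 ^+ J : R) (th) (L) => u a b; clear; nra.
have h3 : 0 < th / 2 * L by rewrite mulr_gt0 // divr_gt0.
have h4 : (2 ^+ J) `^ (- al) <= (th / 2 * L) `^ (- al).
  rewrite !powRN lef_pV2 ?posrE ?powR_gt0 //.
  by apply: ge0_ler_powR; rewrite ?nnegrE ?(ltW al0) ?(ltW J0) ?(ltW h3).
apply: le_trans h4 _; rewrite powRM ?(ltW L0) ?divr_ge0 ?(ltW th0) //.
by rewrite ler_wpM2r ?powR_ge0 // /C lerDl ltW.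
Qed.

Lemma NN_zero (d : nat) (M : R) : 0 <= M -> NN d 0 M (fun=> 0).
Proof.
move=> M0; exists (fun=> 0), (fun=> 0); rewrite /kappa big_ord0; split=> //.
by apply/funext => x; rewrite /nn_fun big_ord0.
Qed.

Lemma NN_mono (d N : nat) (M M' : R) g : M <= M' -> NN d N M g -> NN d N M' g.
Proof. by move=> MM' [a [w [k1 k2]]]; exists a, w; split=> //; exact: le_trans MM'. Qed.

Lemma holder_ball_bound (d : nat) (alpha : R) h : holder_ball d alpha h ->
  forall x, unit_ball d x -> `|h x| <= 2.
Proof.
move=> [r [beta [_ _ /(_ 1 ltr01)[F [Fh [_ hb _]]]]]] x xb.
by rewrite -Fh // (le_trans (hb [::] _ x)) //; lra.
Qed.

Lemma holder_ball_unif_cont (d : nat) (alpha : R) h : holder_ball d alpha h ->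
  forall e : R, 0 < e -> exists2 del : R, 0 < del & forall x x',
     unit_ball d x -> unit_ball d x' -> (forall j, `|x 0 j - x' 0 j| <= del) -> `|h x - h x'| <= e.
Proof.
move=> [r [beta [b01 _ /(_ 1 ltr01)[F [Fh FH]]]]] e e0.
have [b0 b1] := andP b01.
pose A : R := 2 * (d%:R * (1 + 1)) + 1.
have A0 : 0 < A by rewrite ltr_wpDl // !mulr_ge0 // addr_ge0.
pose del : R := Num.min 1 ((e / A) `^ beta^-1).
have del0 : 0 < del by rewrite lt_min ltr01 powR_gt0 // divr_gt0.
exists del => // x x' xb xb' hx; rewrite -!Fh //.
have d01 : 0 < del <= 1 by rewrite del0 ge_min lexx.
apply: le_trans (holder_modulus b01 FH d01 hx) _.
have db : del `^ beta <= e / A.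
  have -> : e / A = ((e / A) `^ beta^-1) `^ beta.
    by rewrite -powRrM mulVf ?gt_eqF // powRr1 // divr_ge0 ?ltW.
  by apply: ge0_ler_powR; rewrite ?nnegrE ?powR_ge0 ?(ltW b0) ?(ltW del0) // ge_min lexx orbT.
apply: (@le_trans _ _ (A * (e / A))); last by rewrite mulrC divfK // gt_eqF.
have -> : 2 * (d%:R * ((1 + 1) * del `^ beta)) = (2 * (d%:R * (1 + 1))) * del `^ beta by ring.
apply: ler_pM; rewrite ?powR_ge0 ?mulr_ge0 ?addr_ge0 //.
by rewrite /A lerDl.
Qed.

Lemma holder_erm_rate (d : nat) (B alpha m1 m2 k : R) : (1 <= d)%N -> 0 < B ->
  0 < alpha -> alpha < (d%:R + 3) / 2 -> 0 < m1 -> m1 <= m2 -> 0 < k ->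
  exists C c1 c2 : R, [/\ 0 < C, 0 < c1, 0 < c2 &
     erm_rate d B (holder_ball d alpha)
       (fun n Mn => m1 * n%:R `^ ((d%:R + 3 - 2 * alpha) / (2 * d%:R + 4 * alpha))
                    <= Mn <=
                    m2 * n%:R `^ ((d%:R + 3 - 2 * alpha) / (2 * d%:R + 4 * alpha)))
       (fun n Nn => k * n%:R `^ (d%:R / (d%:R + 2 * alpha)) <= Nn%:R)
       (2 * alpha / (d%:R + 2 * alpha)) (d%:R / (d%:R + 2 * alpha)) C c1 c2].
Proof.
move=> d1 B0 al0 al3 m10 m12 k0.
have s0 : 0 < d%:R + 2 * alpha by rewrite ltr_wpDl // mulr_gt0.
have [C0 C00 hC0] : exists2 C0 : R, 0 <= C0 & forall h n M, holder_ball d alpha h -> (2 <= n)%N ->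
    m1 * n%:R `^ ((d%:R + 3 - 2 * alpha) / (2 * d%:R + 4 * alpha)) <= M ->
    exists N' g0, NN d N' M g0 /\ forall x, unit_ball d x ->
       `|g0 x - h x| <= C0 * n%:R `^ (- (alpha / (d%:R + 2 * alpha))).
  (* [holder_NN] needs [r] and [beta] ahead of [h]; in the other case no [h] belongs to the ball. *)
  have [[r [beta [b01 alE]]]|no] := pselect (exists (r : nat) (beta : R), 0 < beta <= 1 /\ alpha = r%:R + beta); last first.
    by exists 0 => // h n M [r [beta [b01 alE _]]]; case: no; exists r, beta.
  case: d d1 al3 s0 => // e _ al3 s0; set d := e.+1 in al3 s0 *.
  have [C1 [C2 [C10 C20 hNN]]] := @holder_NN R e r beta (1 + 1) b01 ltac:(by rewrite -alE).
  rewrite -alE in hNN.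
  pose gam : R := (d%:R + 3) / 2 - alpha.
  have gam0 : 0 < gam by rewrite subr_gt0.
  have P1 : 1 <= (d + 4)%N%:R :> R by rewrite ler1n addnS.
  have [Cs Cs0 hCs] := dyadic_scale C10 m10 gam0 al0 s0 P1.
  exists ((2 + C2) * Cs); first by rewrite mulr_ge0 ?(ltW Cs0) // addr_ge0.
  move=> h n M hh n2 hM; set v := n%:R `^ (- _).
  have M0 : 0 <= M by apply: le_trans hM; rewrite mulr_ge0 ?powR_ge0 ?(ltW m10).
  have v0 : 0 <= v by exact: powR_ge0.
  have Cv : 0 <= Cs * v by rewrite mulr_ge0 // ltW.
  case: (hCs n n2) => [big|[J [PJ hJ1 hJ2]]].
    exists 0%N, (fun=> 0); split; first exact: NN_zero.
    move=> x xb; rewrite sub0r normrN; apply: le_trans (holder_ball_bound hh xb) _.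
    rewrite -mulrA mulrDl -[leLHS]mulr1; apply: (@le_trans _ _ (2 * (Cs * v))).
      by rewrite ler_wpM2l.
    by rewrite lerDl mulr_ge0.
  have [r' [beta' [b01' alE' /(_ 1 ltr01)[F [Fh FH]]]]] := hh.
  have [rr bb] := holder_exponent_unique b01' b01 (esym (etrans (esym alE) alE')).
  rewrite rr bb in FH.
  have pJ : (e.+1 + 4 <= 2 ^ J)%N by rewrite -(ler_nat R) natrX.
  have [N [g [gN hg]]] := hNN F FH J pJ.
  exists N, g; split.
    apply: NN_mono gN; apply: le_trans hM; apply: le_trans hJ1 _.
    rewrite le_eqVlt; apply/orP; left; apply/eqP; congr (_ * _ `^ _).
    by rewrite /gam; field; rewrite !gt_eqF //; lra.
  move=> x xb; rewrite -Fh //; apply: le_trans (hg x xb) _.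
  apply: le_trans (ler_wpM2l C20 hJ2) _.
  by rewrite -mulrA ler_wpM2r // lerDr.
apply: (@erm_rate_of_approximation R d B alpha m2 k 2 C0) => //.
- exact: ltW.
- exact: lt_le_trans m12.
- move=> n M /andP[h1 ->]; rewrite andbT; apply: le_trans h1.
  by rewrite mulr_ge0 ?powR_ge0 ?(ltW m10).
- exact: holder_ball_bound.
- exact: holder_ball_unif_cont.
by move=> h n M hh n2 /andP[h1 _]; exact: hC0.
Qed.

End HolderRate.

Theorem theorem3 (R : realType) (d : nat) (B : R) :
  (1 <= d)%N -> 0 < B ->
  (* (1) Hoelder class H^alpha *)
  (forall alpha : R, 0 < alpha -> alpha < (d%:R + 3) / 2 ->
   forall m1 m2 k : R, 0 < m1 -> m1 <= m2 -> 0 < k ->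
   exists C c1 c2 : R, [/\ 0 < C, 0 < c1, 0 < c2 &
     erm_rate d B (holder_ball d alpha)
       (fun n Mn => m1 * n%:R `^ ((d%:R + 3 - 2 * alpha) / (2 * d%:R + 4 * alpha))
                    <= Mn <=
                    m2 * n%:R `^ ((d%:R + 3 - 2 * alpha) / (2 * d%:R + 4 * alpha)))
       (fun n Nn => k * n%:R `^ (d%:R / (d%:R + 2 * alpha)) <= Nn%:R)
       (2 * alpha / (d%:R + 2 * alpha)) (d%:R / (d%:R + 2 * alpha)) C c1 c2])
  /\
  (* (2) Barron-type class F_sigma(1) *)
  (forall M k : R, 1 <= M -> 0 < k ->
   exists C c1 c2 : R, [/\ 0 < C, 0 < c1, 0 < c2 &
     erm_rate d B (Fsigma_ball d 1)
       (fun n Mn => Mn = M)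
       (fun n Nn => k * n%:R `^ (d%:R / (2 * d%:R + 3)) <= Nn%:R)
       ((d%:R + 3) / (2 * d%:R + 3)) (d%:R / (2 * d%:R + 3)) C c1 c2]).
Proof.
move=> d1 B0; split=> [alpha al0 al3 m1 m2 k m10 m12 k0|M k M1 k0].
  exact: holder_erm_rate.
exact: Fsigma_erm_rate.
Qed.
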